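(* Let $X$ be a generalized Raynaud surface over a pre-Tango curve $C$, as constructed in the context. Then the canonical divisor $K_X$ is ample if $(p,\ell)=(3,4)$ or $p\ge 5$.
   Context: Construction of the generalized Raynaud surface. Let $k$ be an algebraically closed field of characteristic $p>0$ and $C$ a smooth projective curve over $k$ of genus $g\ge 2$ with function field $K(C)$. A pre-Tango structure on $C$ is an invertible sheaf $\mathcal L=\mathcal O_C(D)$, with $D$ an ample divisor (i.e. $\deg D>0$), such that $(df)\ge pD$ for some $f\in K(C)\setminus K(C)^p$; $C$ is a pre-Tango curve if it has such a structure. Fix such $\mathcal L=\mathcal O_C(D)$ and $f_0\in K(C)\setminus K(C)^p$ with $(df_0)\ge pD$. Fix an integer $e\ge 2$ prime to $p$ with $e\mid\deg\mathcal L$, and an ample invertible sheaf $\mathcal N$ on $C$ with $\mathcal L=\mathcal N^{e}$. Fix an integer $\ell\ge 2$ with $\ell\mid p+1$ and $\ell\mid e$, and put $\mathcal N_\ell:=\mathcal N^{e/\ell}$ (so $\mathcal N_\ell^{\ell}=\mathcal L$). Let $F$ be the Frobenius morphism of $C$ and $\mathcal B^1$ the image of $F_*d:F_*\mathcal O_C\to F_*\Omega^1_C$, so $0\to\mathcal O_C\to F_*\mathcal O_C\to\mathcal B^1\to0$ is exact. Then $H^0(C,\mathcal B^1\otimes\mathcal L^{-1})=\{df: (df)\ge pD\}$, and the connecting map $\eta:H^0(C,\mathcal B^1\otimes\mathcal L^{-1})\to H^1(C,\mathcal L^{-1})$ is injective with image the kernel of $F^*:H^1(C,\mathcal L^{-1})\to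 H^1(C,\mathcal L^{-p})$. The class $\eta(df_0)\neq0$ defines a non-split extension $0\to\mathcal O_C\to\mathcal E\to\mathcal L\to0$ with $\mathcal E$ locally free of rank 2, while $0\to\mathcal O_C\to F^*\mathcal E\to\mathcal L^{p}\to0$ splits (uniquely). Let $\pi:P=\mathbb P(\mathcal E)=\mathrm{Proj}\,S(\mathcal E)\to C$ ($\pi_*\mathcal O_P(1)=\mathcal E$), and let $E\subset P$ be the section of $\pi$ which is the zero divisor of the section $s\in H^0(P,\mathcal O_P(1))=H^0(C,\mathcal E)$ that is the image of $1\in H^0(C,\mathcal O_C)$; so $\mathcal O_P(E)\cong\mathcal O_P(1)$. The splitting gives an exact sequence $0\to\mathcal O_C\to F^*\mathcal E\otimes\mathcal L^{-p}\to\mathcal L^{-p}\to 0$; the image of $1$ in $H^0(C,F^*\mathcal E\otimes\mathcal L^{-p})$ defines a section curve $\Gamma'$ of $P'=\mathbb P(F^*\mathcal E\otimes \mathcal L^{-p})\cong\mathbb P(F^*\mathcal E)\to C$. Let $C''\subset P$ be the preimage of $\Gamma'$ under the relative Frobenius $P\to P'$ over $C$ ($p$-th power on the fibre coordinates). Then $\mathcal O_P(C'')\cong\mathcal O_P(p)\otimes\pi^*\mathcal L^{-p}$ and $E\cap C''=\emptyset$. Put $\mathcal M:=\mathcal O_P\big(-\tfrac{p+1}{\ell}\big)\otimes\pi^*\mathcal N_\ell^{\,p}$, so $\mathcal M^{-\ell}=\mathcal O_P(E+C'')$. Let $\psi:X:=\mathcal{S}pec\big(\bigoplus_{i=0}^{\ell-1}\mathcal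 M^i\big)\to P$ be the cyclic cover of degree $\ell$ ramified at $E+C''$, the algebra structure being tensor product followed, when $i+j\ge\ell$, by multiplication with the section of $\mathcal M^{-\ell}$ defining $E+C''$. *)

(* Defs.v *)
(* An integral separated scheme of finite type over an algebraically closed
   field k, with function field F, is represented by the set of its local
   rings, each viewed as a subring of F (Zariski's "models").  A model is
   therefore a [set (set F)]; the generic point is the member [set: F], and k
   enters through the set [k0 : set F] of constants.  Torsion-free sheaves of
   rank one are embedded in the constant sheaf F, i.e. given by their stalks
   [set F -> set F] at the local rings of the model. *)
From HB Require Import structures.
From mathcomp Require Export all_boot all_order all_algebra.
From mathcomp Require Export all_classical.

Set Implicit Arguments.
Unset Strict Implicit.
Unset Printing Implicit Defensive.

Import Order.TTheory GRing.Theory Num.Theory.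

Local Open Scope classical_set_scope.
Local Open Scope ring_scope.

(** * Models of a function field *)

Definition gen_ring (F : fieldType) (S : set F) : set F :=
  smallest [set A : set F | GRing.subring_closed (mem A)] S.

Definition prime_ideal (F : fieldType) (A q : set F) : Prop :=
  [/\ q `<=` A, GRing.zmod_closed (mem q),
      (forall a b, A a -> q b -> q (a * b)), ~ q 1
    & forall a b, A a -> A b -> q (a * b) -> q a \/ q b].

Definition localization (F : fieldType) (A q : set F) : set F :=
  [set a / b | a in A & b in A `\` q].

Definition Spec (F : fieldType) (A : set F) : set (set F) :=
  [set localization A q | q in prime_ideal A].

(* The image of the rational map (f_0 : ... : f_n) to P^n. *)
Definition proj_chart (F : fieldType) (k0 : set F) (n : nat)
    (f : 'I_n.+1 -> F) (i : 'I_n.+1) : set (set F) :=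
  Spec (gen_ring (k0 `|` range (fun j => f j / f i))).

Definition proj_model (F : fieldType) (k0 : set F) (n : nat)
    (f : 'I_n.+1 -> F) : set (set F) :=
  [set R | exists2 i, f i != 0 & proj_chart k0 f i R].

(* [Y [set: F]] says that the function field of Y is F and not a subfield. *)
Definition projective_model (F : fieldType) (k0 : set F) (Y : set (set F)) :
    Prop :=
  Y [set: F] /\ exists (n : nat) (f : 'I_n.+1 -> F), Y = proj_model k0 f.

Definition dominates (K F : fieldType) (j : K -> F) (R : set F) (Q : set K) :
    Prop :=
  (forall a, Q a -> R (j a)) /\ (forall a, Q a -> R (j a)^-1 -> Q a^-1).

(** * Discrete valuation rings and divisors *)

Definition uniformizer (F : fieldType) (R : set F) (t : F) : Prop :=
  [/\ GRing.subring_closed (mem R), R t, t != 0, ~ R t^-1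
    & forall h, h != 0 -> exists (u : F) (n : int),
        [/\ R u, R u^-1 & h = u * t ^ n]].

Definition dvr (F : fieldType) (R : set F) : Prop := exists t, uniformizer R t.

(* Junk value 0 when R is not a discrete valuation ring or h = 0. *)
Definition ord (F : fieldType) (R : set F) (h : F) : int :=
  xget 0 [set n : int | exists t u,
    [/\ uniformizer R t, u != 0, R u, R u^-1 & h = u * t ^ n]].

(* On a normal model the points of codimension one are the local rings that
   are discrete valuation rings.  A Weil divisor is a function on all subsets
   of F of which only the values at the prime divisors of Y matter. *)
Definition prime_divisor (F : fieldType) (Y : set (set F)) (W : set F) : Prop :=
  Y W /\ dvr W.

Definition is_divisor (F : fieldType) (Y : set (set F)) (D : set F -> int) :
    Prop :=
  finite_set [set W | prime_divisor Y W /\ D W <> 0].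

(* Every closed point of a curve over an algebraically closed field has
   degree one. *)
Definition deg (F : fieldType) (Y : set (set F)) (D : set F -> int) : int :=
  \sum_(W \in [set W | prime_divisor Y W]) D W.

Definition lin_equiv (F : fieldType) (Y : set (set F)) (D D' : set F -> int) :
    Prop :=
  exists2 h : F, h != 0 &
    forall W, prime_divisor Y W -> D W = D' W + ord W h.

(* Y is a normal model.  At each point R of the chart of f_i the stalk O_Y(D)_R
   is R f_i, so that D is Cartier there and the f_j (which lie in R f_i) are
   sections of O_Y(D) generating it; the induced morphism to P^n is a closed
   immersion because Y equals, as a model of F, its image. *)
Definition very_ample (F : fieldType) (k0 : set F) (Y : set (set F))
    (D : set F -> int) : Prop :=
  Y [set: F] /\ exists (n : nat) (f : 'I_n.+1 -> F),
    Y = proj_model k0 f /\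
    forall i, f i != 0 -> forall R, proj_chart k0 f i R ->
    forall W, prime_divisor Y W -> R `<=` W -> ord W (f i) + D W = 0.

Definition ample (F : fieldType) (k0 : set F) (Y : set (set F))
    (D : set F -> int) : Prop :=
  exists2 m : nat, (0 < m)%N & very_ample k0 Y (fun W => m%:Z * D W).

(** * Differential forms *)

Definition derivation (F : fieldType) (k0 : set F) (d : F -> F) : Prop :=
  [/\ forall a b, d (a + b) = d a + d b,
      forall a b, d (a * b) = a * d b + b * d a
    & forall c, k0 c -> d c = 0].

Definition der (F : fieldType) (k0 : set F) := {d : F -> F | derivation k0 d}.

(* For a finitely generated F/k, Omega_{F/k} is the F-dual of Der_k(F, F):
   rational 1-forms and 2-forms are functions of one or two derivations. *)
Definition diff (F : fieldType) (k0 : set F) (a : F) : der k0 -> F^o :=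
  fun d => sval d a.

Definition wedge (F : fieldType) (k0 : set F) (a b : F) :
    der k0 -> der k0 -> F^o :=
  fun d d' => sval d a * sval d' b - sval d b * sval d' a.

Definition span (F : fieldType) (V : lmodType F) (R : set F) (S : set V) :
    set V :=
  smallest [set B : set V | GRing.zmod_closed (mem B)]
    [set r *: v | r in R & v in S].

(* For R a regular local ring of the model these are the images, in the forms
   on F, of Omega_{R/k} and of its second exterior power. *)
Definition Omega1 (F : fieldType) (k0 : set F) (R : set F) :
    set (der k0 -> F^o) :=
  span R [set diff a | a in R].

Definition Omega2 (F : fieldType) (k0 : set F) (R : set F) :
    set (der k0 -> der k0 -> F^o) :=
  span R [set wedge a b | a in R & b in R].

(* Order of w along W with respect to a free W-module L of rank one: the order
   of any g such that W w = g L. *)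
Definition ord_form (F : fieldType) (V : lmodType F) (W : set F) (L : set V)
    (w : V) : int :=
  xget 0 [set n : int | exists g : F,
    [/\ g != 0, span W [set w] = [set g *: v | v in L] & n = ord W g]].

Definition canonical_divisor_surface (F : fieldType) (k0 : set F)
    (X : set (set F)) (KX : set F -> int) : Prop :=
  exists w, [/\ Omega2 [set: F] w, w != 0 :> (der k0 -> der k0 -> F^o)
    & forall W, prime_divisor X W -> KX W = ord_form W (Omega2 W) w].

(** * Curves *)

(* Over an algebraically closed field smooth means regular, i.e. every closed
   point is a discrete valuation ring; the second clause excludes a point. *)
Definition smooth_projective_curve (K : fieldType) (k0 : set K)
    (C : set (set K)) : Prop :=
  [/\ projective_model k0 C, exists Q, prime_divisor C Q
    & forall Q, C Q -> Q = [set: K] \/ dvr Q].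

Definition global_form (K : fieldType) (k0 : set K) (C : set (set K))
    (w : der k0 -> K^o) : Prop :=
  forall Q, C Q -> Omega1 Q w.

(* g = dim_k H^0(C, Omega^1_C) *)
Definition has_genus (K : fieldType) (k0 : set K) (C : set (set K)) (g : nat) :
    Prop :=
  exists w : 'I_g -> (der k0 -> K^o),
    (forall i, global_form C (w i)) /\
    forall v, global_form C v ->
      exists! c : {ffun 'I_g -> K},
        (forall i, k0 (c i)) /\ v = \sum_i c i *: w i.

Definition div_form_ge (K : fieldType) (k0 : set K) (C : set (set K))
    (f : K) (D : set K -> int) : Prop :=
  forall Q, prime_divisor C Q ->
    D Q <= ord_form Q (Omega1 Q) (diff f : der k0 -> K^o).

(** * Sheaves on a model *)

Definition addgen (F : fieldType) (S : set F) : set F :=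
  smallest [set B : set F | GRing.zmod_closed (mem B)] S.

Definition tensorS (F : fieldType) (L M : set F -> set F) : set F -> set F :=
  fun R => addgen [set a * b | a in L R & b in M R].

(* L^0 is the structure sheaf, whose stalk at R is R itself. *)
Definition expS (F : fieldType) (L : set F -> set F) (n : nat) :
    set F -> set F :=
  iter n (tensorS L) id.

Definition dualS (F : fieldType) (L : set F -> set F) : set F -> set F :=
  fun R => [set h | forall a, L R a -> R (h * a)].

Definition OD (F : fieldType) (Y : set (set F)) (D : set F -> int) :
    set F -> set F :=
  fun R => [set h | forall W, prime_divisor Y W -> R `<=` W ->
    h = 0 \/ 0 <= ord W h + D W].

(* The ideal sheaf of the zero scheme of the section s of L. *)
Definition zero_ideal (F : fieldType) (L : set F -> set F) (s : F) :
    set F -> set F :=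
  fun R => [set s * a | a in dualS L R].

(* The module over the local rings of a model of F generated by the stalks
   [G Q] (contained in F), Q being the image in the model C of the point R. *)
Definition extendS (K F : fieldType) (j : K -> F) (C : set (set K))
    (G : set K -> set F) : set F -> set F :=
  fun R => addgen [set r * w | r in R &
    w in [set w | exists Q, [/\ C Q, dominates j R Q & G Q w]]].

Definition pullbackS (K F : fieldType) (j : K -> F) (C : set (set K))
    (L : set K -> set K) : set F -> set F :=
  extendS j C (fun Q => j @` L Q).

(* The relative Proj of the symmetric algebra of the sheaf E over C, where
   E Q is a Q-submodule of F and F is the function field of the bundle. *)
Definition proj_bundle (K F : fieldType) (j : K -> F) (C : set (set K))
    (E : set K -> set F) : set (set F) :=
  [set R | exists Q s, [/\ C Q, E Q s, s != 0
    & Spec (gen_ring (j @` Q `|` [set w / s | w in E Q])) R]].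

(* The relative Spec over Y of (+)_(i < l) M^i z^i, where z^l in F.  When
   z^l M^l is contained in O_Y this algebra is generated by M z. *)
Definition cyclic_cover (F F' : fieldType) (j : F -> F') (Y : set (set F))
    (M : set F -> set F) (z : F') : set (set F') :=
  [set S | exists2 R, Y R &
    Spec (gen_ring (j @` R `|` [set j m * z | m in M R])) S].

(** * The generalized Raynaud surface *)

(* The function field K(x) of the ruled surface. *)
Definition ruled_field (K : fieldType) := {fraction {poly K}}.

Definition ratX (K : fieldType) : ruled_field K :=
  FracField.tofrac ('X : {poly K}).

Definition ratC (K : fieldType) (a : K) : ruled_field K :=
  FracField.tofrac a%:P.

(* The extension E of L = O_C(D) by O_C with class eta(df0).  The generic
   fibre of E is K + K x, where 1 is the image of 1 in O_C and x maps to
   1 in K = L (x) K.  Locally at Q, df0 = db with b in O_C(-pD)_Q, and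
   f0 - b = a^p; the differences of the a's for two points Q form the cocycle
   eta(df0) in H^1(C, L^-1), so that x + a gives the splitting of E at Q.
   (Replacing eta by -eta gives an isomorphic E, with the same subsheaf O_C.) *)
Definition raynaud_E (K : fieldType) (p : nat) (C : set (set K))
    (D : set K -> int) (f0 : K) : set K -> set (ruled_field K) :=
  fun Q => [set w | exists a u v,
    [/\ OD C (fun W => - (p%:Z * D W)) Q (f0 - a ^+ p), Q u, OD C D Q v
      & w = ratC u + ratC v * (ratX K + ratC a)]].

(* F^*E, embedded in K(x) by the relative Frobenius, which sends the
   pull-back of a section w of E to w^p; its generic fibre is K + K x^p. *)
Definition frob_pullback (K : fieldType) (p : nat)
    (E : set K -> set (ruled_field K)) : set K -> set (ruled_field K) :=
  fun Q => addgen [set ratC c * w ^+ p | c in Q & w in E Q].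

(* v |-> v theta is a splitting L^p -> F^*E of the projection F^*E -> L^p,
   u + v x^p |-> v. *)
Definition frob_splitting (K : fieldType) (p : nat) (C : set (set K))
    (E : set K -> set (ruled_field K)) (L : set K -> set K)
    (theta : ruled_field K) : Prop :=
  (exists c : K, theta = ratX K ^+ p + ratC c) /\
  forall Q, C Q -> forall v, expS L p Q v ->
    frob_pullback p E Q (ratC v * theta).

Definition raynaud_P (K : fieldType) (C : set (set K))
    (E : set K -> set (ruled_field K)) : set (set (ruled_field K)) :=
  proj_bundle (@ratC K) C E.

Definition OP1 (K : fieldType) (C : set (set K))
    (E : set K -> set (ruled_field K)) :
    set (ruled_field K) -> set (ruled_field K) :=
  extendS (@ratC K) C E.

Definition ideal_E (K : fieldType) (C : set (set K))
    (E : set K -> set (ruled_field K)) :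
    set (ruled_field K) -> set (ruled_field K) :=
  zero_ideal (OP1 C E) 1.

(* theta is the section of F^*E (x) L^-p that is the image of 1, i.e. the
   section of O(1) on P(F^*E (x) L^-p) with zero scheme Gamma'; the ideal is
   that of the preimage of Gamma' under the relative Frobenius. *)
Definition ideal_C'' (K : fieldType) (p : nat) (C : set (set K))
    (E : set K -> set (ruled_field K)) (L : set K -> set K)
    (theta : ruled_field K) :
    set (ruled_field K) -> set (ruled_field K) :=
  zero_ideal
    (extendS (@ratC K) C (fun Q =>
       addgen [set w * ratC a | w in frob_pullback p E Q
                              & a in dualS (expS L p) Q])) theta.

(* M = O_P(- (p + 1) / l) (x) pi^* Nl^p *)
Definition raynaud_M (K : fieldType) (p l : nat) (C : set (set K))
    (E : set K -> set (ruled_field K)) (Nl : set K -> set K) :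
    set (ruled_field K) -> set (ruled_field K) :=
  tensorS (dualS (expS (OP1 C E) (p.+1 %/ l)))
          (expS (pullbackS (@ratC K) C Nl) p).

(* s is a section of M^-l with zero scheme E + C''. *)
Definition branch_section (K : fieldType) (l : nat)
    (P : set (set (ruled_field K)))
    (M IE IC : set (ruled_field K) -> set (ruled_field K))
    (s : ruled_field K) : Prop :=
  forall R, P R -> [set s * m | m in expS M l R] = tensorS IE IC R.

(* F' = F[z] / (z^l - s) *)
Definition radical_extension (F F' : fieldType) (j : F -> F') (l : nat)
    (s : F) (z : F') : Prop :=
  z ^+ l = j s /\
  forall y : F', exists! c : {ffun 'I_l -> F}, y = \sum_i j (c i) * z ^+ i.

(* Main.v *)
(* At a local ring Q of C let v and nu generate L and N_l, and let f0 - a^p lie in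
   v^-p Q.  With y = v (x + a) and x' = nu^p z the cover is given there by
   x'^l = u (y^p + beta), where beta = v^p (f0 - a^p) and u is a unit killed by all
   derivations.  So l x'^(l-1) dx' = u v^p df0, and the 2-form df0 /\ dx has along
   every curve of X the order of an explicit monomial: K_X is linearly
   equivalent to the pull-back of a divisor of positive degree on C plus n times the
   pull-back of E, with n = (l-1)(p+1)/l - 2.  The condition on (p, l) says that n > 0.

   Instead of a numerical criterion, a multiple m K_X is shown to be very ample by
   exhibiting sections: if alpha runs over local generators of a high power of N on
   C, twisted by div(df0) - pD >= 0, then the products of alpha with 1, y, x' give
   the charts of X away from E, and the products with theta^r and theta^(r-1) v^-p
   times 1, y^(p-1), x' y^(p-b), where b = (p+1)/l and p r = n m, give those near E.
   Each alpha vanishes to high order at the finitely many bad points other than its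
   own, which absorbs the change of the local data v, a, nu. *)
Require Import Defs.
From HB Require Import structures.
From mathcomp Require Import all_boot all_order all_algebra.
From mathcomp Require Import all_classical.
From mathcomp Require Import generic_quotient.
From mathcomp Require Import ring lra zify.

Set Implicit Arguments.
Unset Strict Implicit.
Unset Printing Implicit Defensive.

Import Order.TTheory GRing.Theory Num.Theory.

Local Open Scope classical_set_scope.
Local Open Scope ring_scope.

(** * Subrings of a field, localizations and valuation rings *)

(** The tool used throughout is Chevalley's theorem: a proper ideal of a subring lies under the
    maximal ideal of some valuation ring. It yields the residue field k at closed points, the
    constancy of global functions, the finiteness of zeros and poles, and the recognition of a point
    by a valuation ring dominating it. Two obstacles shape the construction. The effective divisor
    div(df0) - pD occurs with multiplicity m, which grows in a fixed proportion to the power of N.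
    At a point of its support one therefore needs functions with an arbitrarily high pole there and
    uniformly bounded poles elsewhere; [large_poles] makes them from hyperplane sections. Secondly,
    forms at a prime divisor of X need two explicit coordinates. Away from E these are x', y over
    the generic point of C, and t, y over a closed point with parameter t, where [exclusion] shows
    that x' is a unit. Near E they are t and y^-b x'. The value of n is visible there: with h = 1/y,
    the factor x'^(l-1) equals (y^-b x')^(l-1) h^(-b(l-1)), and dh = - h^2 dy accounts for the
    correction by 2. *)

Section Subrings.
Variable F : fieldType.
Implicit Types A B I R S V W : set F.

Definition subr A : Prop :=
  [/\ A 1, (forall x y, A x -> A y -> A (x - y))
    & (forall x y, A x -> A y -> A (x * y))].

Lemma subringP A : GRing.subring_closed (mem A) <-> subr A.
Proof.
split=> -[h1 hB hM]; split.
- by have := h1; rewrite in_setE.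
- by move=> x y hx hy; have := hB x y; rewrite !in_setE => /(_ hx hy).
- by move=> x y hx hy; have := hM x y; rewrite !in_setE => /(_ hx hy).
- by rewrite in_setE.
- by move=> x y; rewrite !in_setE; exact: hB.
- by move=> x y; rewrite !in_setE; exact: hM.
Qed.

Definition unit_in A (x : F) : Prop := [/\ x != 0, A x & A x^-1].

Section Closure.
Variable A : set F.
Hypothesis hA : subr A.

Lemma subr1 : A 1. Proof. by case: hA. Qed.
Lemma subrB' x y : A x -> A y -> A (x - y). Proof. by case: hA => _ h _; exact: h. Qed.
Lemma subrM' x y : A x -> A y -> A (x * y). Proof. by case: hA => _ _ h; exact: h. Qed.
Lemma subr0' : A 0. Proof. by rewrite -(subrr 1); apply: subrB'; exact: subr1. Qed.
Lemma subrN' x : A x -> A (- x).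
Proof. by move=> hx; rewrite -sub0r; apply: subrB' => //; exact: subr0'. Qed.
Lemma subrD' x y : A x -> A y -> A (x + y).
Proof. by move=> hx hy; rewrite -(opprK y); apply: subrB' => //; exact: subrN'. Qed.
Lemma subrX' x n : A x -> A (x ^+ n).
Proof.
move=> hx; elim: n => [|n IH]; first by rewrite expr0; exact: subr1.
by rewrite exprS; exact: subrM'.
Qed.
Lemma subr_sum (J : Type) (r : seq J) (P : pred J) (E : J -> F) :
  (forall i, P i -> A (E i)) -> A (\sum_(i <- r | P i) E i).
Proof.
move=> h; elim/big_rec: _ => [|i x hi hx]; first exact: subr0'.
by apply: subrD' => //; exact: h.
Qed.
Lemma subr_prod (J : Type) (r : seq J) (P : pred J) (E : J -> F) :
  (forall i, P i -> A (E i)) -> A (\prod_(i <- r | P i) E i).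
Proof.
move=> h; elim/big_rec: _ => [|i x hi hx]; first exact: subr1.
by apply: subrM' => //; exact: h.
Qed.
Lemma subr_nat n : A n%:R.
Proof.
elim: n => [|n IH]; first exact: subr0'.
by rewrite -addn1 natrD; apply: subrD' => //; exact: subr1.
Qed.

Lemma unit1 : unit_in A 1.
Proof. by split; rewrite ?oner_neq0 ?invr1 //; exact: subr1. Qed.
Lemma unitM x y : unit_in A x -> unit_in A y -> unit_in A (x * y).
Proof.
move=> [x0 hx hx'] [y0 hy hy']; split; first by rewrite mulf_neq0.
- exact: subrM'.
- by rewrite invfM; exact: subrM'.
Qed.
Lemma unitV x : unit_in A x -> unit_in A x^-1.
Proof. by move=> [x0 hx hx']; split; rewrite ?invr_eq0 ?invrK. Qed.
Lemma unitX x n : unit_in A x -> unit_in A (x ^+ n).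
Proof.
by move=> [x0 hx hx']; split; rewrite ?expf_neq0 // -?exprVn; exact: subrX'.
Qed.
Lemma unitN x : unit_in A x -> unit_in A (- x).
Proof.
move=> [x0 hx hx']; split; rewrite ?oppr_eq0 //; first exact: subrN'.
by rewrite invrN; exact: subrN'.
Qed.
Lemma unitMl x y : A x -> A y -> unit_in A (x * y) -> unit_in A x.
Proof.
move=> hx hy [h1 h2 h3]; have y0 : y != 0 by apply: contraNneq h1 => ->; rewrite mulr0.
split=> //; first by apply: contraNneq h1 => ->; rewrite mul0r.
have -> : x^-1 = y * (x * y)^-1 by rewrite invfM mulrCA mulfV ?mulr1.
exact: subrM'.
Qed.
Lemma unitMr x y : A x -> A y -> unit_in A (x * y) -> unit_in A y.
Proof. by move=> hx hy; rewrite mulrC; exact: unitMl. Qed.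
Lemma unit_prod (J : Type) (r : seq J) (P : pred J) (E : J -> F) :
  (forall i, P i -> unit_in A (E i)) -> unit_in A (\prod_(i <- r | P i) E i).
Proof.
move=> h; elim/big_rec: _ => [|i x hi hx]; first exact: unit1.
by apply: unitM => //; exact: h.
Qed.
End Closure.

Lemma unit_sub A B x : A `<=` B -> unit_in A x -> unit_in B x.
Proof. by move=> AB [h1 /AB h2 /AB h3]. Qed.

Lemma subrT : subr [set: F]. Proof. by []. Qed.

Lemma gen_subr S : subr (gen_ring S).
Proof.
split.
- by move=> A [/subringP hA _]; exact: subr1.
- by move=> x y hx hy A [/subringP hA hS]; apply: subrB' => //; [apply: hx|apply: hy]; split=> //; apply/subringP.
- by move=> x y hx hy A [/subringP hA hS]; apply: subrM' => //; [apply: hx|apply: hy]; split=> //; apply/subringP.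
Qed.

Lemma gen_sub S : S `<=` gen_ring S.
Proof. by move=> x Sx A [_]; exact. Qed.

Lemma gen_min S A : subr A -> S `<=` A -> gen_ring S `<=` A.
Proof. by move=> /subringP hA hS x; apply; split. Qed.

Lemma gen_mono S S' : S `<=` S' -> gen_ring S `<=` gen_ring S'.
Proof. by move=> h; apply: gen_min; [exact: gen_subr|move=> x /h; exact: gen_sub]. Qed.

Definition islocal R : Prop :=
  subr R /\ forall x y, R x -> R y -> unit_in R (x + y) -> unit_in R x \/ unit_in R y.

Lemma local_subr R : islocal R -> subr R. Proof. by case. Qed.

(* [S] is the localization of [A] at a prime ideal. *)
Definition locz A S : Prop :=
  [/\ islocal S, A `<=` S
    & forall s, S s -> exists a b, [/\ A a, A b, unit_in S b & s = a / b]].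

(** The prime is recovered from [S] as the set of elements of [A] that are not units of [S]. From
    here on points are handled through [locz] rather than through prime ideals. *)
Lemma SpecP A S : subr A -> Spec A S <-> locz A S.
Proof.
move=> hA; split.
- case=> q [qA [/set_mem q0 qB0] qM q1 qP] <-.
  have qB x y : q x -> q y -> q (x - y) by have := qB0 x y; rewrite !in_setE.
  have qD x y : q x -> q y -> q (x + y).
    by move=> hx hy; rewrite -(opprK y); apply: (qB _ _ hx); rewrite -sub0r; exact: qB.
  set S' := localization A q.
  have nz b : A b -> ~ q b -> b != 0.
    by move=> _ hb; apply/eqP => b0; apply: hb; rewrite b0.
  have qmul b b' : (A `\` q) b -> (A `\` q) b' -> (A `\` q) (b * b').
    move=> [hb hqb] [hb' hqb']; split; first exact: subrM'.
    by move=> h; have [] := qP _ _ hb hb' h.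
  have AS : A `<=` S'.
    by move=> a Aa; exists a => //; exists 1; rewrite ?divr1 //; split=> //; exact: subr1.
  have hS : subr S'.
    split; first by apply: AS; exact: subr1.
    - move=> _ _ [a Aa [b bq <-]] [a' Aa' [b' bq' <-]].
      exists (a * b' - a' * b); first by apply: subrB' => //; apply: subrM' => //; [case: bq'|case: bq].
      exists (b * b'); first exact: qmul.
      have b0 := nz _ bq.1 bq.2; have b0' := nz _ bq'.1 bq'.2.
      by field; rewrite b0 b0'.
    - move=> _ _ [a Aa [b bq <-]] [a' Aa' [b' bq' <-]].
      exists (a * a'); first exact: subrM'.
      by exists (b * b'); [exact: qmul|rewrite mulf_div].
  have Sq b : (A `\` q) b -> unit_in S' b.
    move=> hb; split; [exact: nz hb.1 hb.2|by apply: AS; case: hb|].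
    by exists 1; [exact: subr1|exists b => //; rewrite div1r].
  have unitq a : A a -> unit_in S' a -> ~ q a.
    move=> Aa [a0 _ [c Ac [b bq e]]] qa; apply: (bq.2).
    have b0 := nz _ bq.1 bq.2.
    have -> : b = c * a by rewrite -[c](divfK b0) e mulrAC mulVf ?mul1r.
    exact: qM.
  split=> //; last first.
    by move=> _ [a Aa [b bq <-]]; exists a, b; split=> //; [case: bq|exact: Sq].
  split=> // _ _ [a Aa [b bq <-]] [a' Aa' [b' bq' <-]].
  have b0 := nz _ bq.1 bq.2; have b0' := nz _ bq'.1 bq'.2.
  have -> : a / b + a' / b' = (a * b' + a' * b) * (b * b')^-1 by field; rewrite b0 b0'.
  move=> hu.
  have {}hu : unit_in S' (a * b' + a' * b).
    rewrite -[X in unit_in _ X](@mulfVK _ (b * b')) ?mulf_neq0 // -[X in _ * X]invrK.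
    rewrite invrK; apply: unitM => //; first exact: Sq (qmul _ _ bq bq').
  have h1 : ~ q (a * b' + a' * b).
    apply: unitq => //; apply: subrD' => //; apply: subrM' => //; [exact: bq'.1|exact: bq.1].
  have [qa|nqa] := pselect (q a); last first.
    by left; apply: unitM => //; [apply: Sq; split|apply: unitV => //; exact: Sq].
  right; apply: unitM => //; last by apply: unitV => //; exact: Sq.
  apply: Sq; split=> // qa'; apply: h1; rewrite mulrC; apply: qD.
    by apply: qM => //; exact: bq'.1.
  by rewrite mulrC; apply: qM => //; exact: bq.1.
- move=> [[hS hloc] AS hfr].
  pose q := [set a | A a /\ ~ unit_in S a].
  have q0 : q 0 by split; [exact: subr0'|case; rewrite eqxx].
  have qN x : q x -> q (- x).
    move=> [Ax nx]; split; first exact: subrN'.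
    by move=> /(unitN hS); rewrite opprK.
  exists q; first split.
  + by move=> x [].
  + split; first by rewrite in_setE.
    move=> x y; rewrite !in_setE => -[Ax nx] hy; split.
      by apply: subrB' => //; case: hy.
    have [Ay ny] := qN _ hy.
    by move=> /(hloc _ _ (AS _ Ax) (AS _ Ay)) [].
  + move=> a b Aa [Ab nb]; split; first exact: subrM'.
    by rewrite mulrC => /(unitMl hS (AS _ Ab) (AS _ Aa)).
  + by case=> _; apply; exact: unit1.
  + move=> a b Aa Ab [_ nab]; apply: contrapT => /not_orP [na nb]; apply: nab.
    apply: unitM => //; apply: contrapT => h; [apply: na|apply: nb]; by split.
  apply/seteqP; split.
  + move=> _ [a Aa [b [Ab nb] <-]].
    have ub : unit_in S b by apply: contrapT => h; apply: nb.
    by case: ub => _ _ hb; apply: subrM' => //; exact: AS.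
  + move=> s /hfr [a [b [Aa Ab ub ->]]]; exists a => //; exists b => //.
    by split=> // -[_].
Qed.

Definition valring V : Prop := subr V /\ forall x, V x \/ V x^-1.

Lemma val_local V : valring V -> islocal V.
Proof.
move=> [hV tV]; split=> // x y Vx Vy u.
have [y00|y0] := eqVneq y 0; first by left; move: u; rewrite y00 addr0.
have [x00|x0] := eqVneq x 0; first by right; move: u; rewrite x00 add0r.
have key a b : b != 0 -> V a -> V b -> V (a / b) -> unit_in V (a + b) -> unit_in V b.
  move=> b0 Va Vb Vab; have -> : a + b = b * (a / b + 1) by field.
  by apply: unitMl => //; apply: subrD' => //; exact: subr1.
have [h|h] := tV (x / y).
  by right; exact: key h u.
left; apply: (key y x) => //; last by rewrite addrC.
by move: h; rewrite invfM invrK mulrC.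
Qed.

Definition dom V R : Prop := R `<=` V /\ forall x, R x -> V x^-1 -> R x^-1.

(** The local ring of [A] at the prime lying under the maximal ideal of [V]: the denominators are
    the elements of [A] that become units in [V]. *)
Definition center A V : set F := [set s | exists a b, [/\ A a, A b, unit_in V b & s = a / b]].

Lemma centerP A V : subr A -> islocal V -> A `<=` V ->
  locz A (center A V) /\ dom V (center A V).
Proof.
move=> hA [hV hloc] AV.
have cA : A `<=` center A V.
  by move=> a Aa; exists a, 1; split=> //; [exact: subr1|exact: unit1|rewrite divr1].
have cV : center A V `<=` V.
  by move=> _ [a [b [Aa Ab [_ _ hb] ->]]]; apply: subrM' => //; exact: AV.
have nz b : unit_in V b -> b != 0 by case.
have hc : subr (center A V).
  split; first by apply: cA; exact: subr1.
  - move=> _ _ [a [b [Aa Ab ub ->]]] [a' [b' [Aa' Ab' ub' ->]]].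
    exists (a * b' - a' * b), (b * b'); split.
    + by apply: subrB' => //; exact: subrM'.
    + exact: subrM'.
    + exact: unitM.
    + by field; rewrite !nz.
  - move=> _ _ [a [b [Aa Ab ub ->]]] [a' [b' [Aa' Ab' ub' ->]]].
    exists (a * a'), (b * b'); split; try exact: subrM'; first exact: unitM.
    by rewrite mulf_div.
have dV x : center A V x -> V x^-1 -> center A V x^-1.
  move=> [a [b [Aa Ab ub ->]]] h; have [->|a0] := eqVneq a 0.
    by rewrite mul0r invr0; apply: subr0'.
  exists b, a; split=> //; last by rewrite invfM invrK mulrC.
  split=> //; first exact: AV.
  move: h; rewrite invfM invrK => h.
  have -> : a^-1 = a^-1 * b * b^-1 by rewrite mulfK // nz.
  by apply: subrM' => //; case: ub.
have uc x : center A V x -> unit_in V x -> unit_in (center A V) x.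
  by move=> hx [h1 h2 h3]; split=> //; exact: dV.
split=> //; split=> //; last first.
  move=> s [a [b [Aa Ab ub ->]]]; exists a, b; split=> //; apply: uc => //; exact: cA.
split=> // x y cx cy /(unit_sub cV) /(hloc _ _ (cV _ cx) (cV _ cy)) [] h; [left|right]; exact: uc.
Qed.

Lemma dom_unit V R x : dom V R -> R x -> unit_in V x -> unit_in R x.
Proof. by move=> [_ h] Rx [h1 h2 h3]; split=> //; exact: h. Qed.

(** Separatedness of a chart: an element of [A] is a unit of [S] exactly when it is one of the
    dominating ring [V], so [V] determines the point. *)
Lemma locz_center A S V : locz A S -> dom V S -> S = center A V.
Proof.
move=> [hS AS hfr] hd; apply/seteqP; split.
- move=> s /hfr [a [b [Aa Ab ub ->]]]; exists a, b; split=> //; exact: unit_sub hd.1 ub.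
- move=> _ [a [b [Aa Ab ub ->]]]; apply: subrM' => //; first by case: hS.
    exact: AS.
  by have [] := dom_unit hd (AS _ Ab) ub.
Qed.

Lemma locz_mono A B S : locz A S -> A `<=` B -> B `<=` S -> locz B S.
Proof.
move=> [hS AS hfr] AB BS; split=> // s /hfr [a [b [Aa Ab ub ->]]].
by exists a, b; split=> //; exact: AB.
Qed.

(** The numerator of a denominator from [B] is again a unit of [S], so fractions over [B] turn into
    fractions over [A]. This is how a point is carried from one chart to another. *)
Lemma locz_trans A B S : subr A -> locz B S -> A `<=` S ->
  (forall b, B b -> exists a c, [/\ A a, A c, unit_in S c & b = a / c]) -> locz A S.
Proof.
move=> hA [hS BS hfr] AS h; split=> //.
have sS : subr S by case: hS.
move=> s /hfr [a [b [/h [a1 [c1 [Aa1 Ac1 uc1 ea]]] Bb ub es]]].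
have [b1 [d1 [Ab1 Ad1 ud1 eb]]] := h _ Bb.
have ub1 : unit_in S b1.
  have -> : b1 = b * d1 by rewrite eb divfK //; case: ud1.
  exact: unitM.
exists (a1 * d1), (c1 * b1); split; try exact: subrM'; first exact: unitM.
rewrite es ea eb; case: ub1 => b10 _ _; case: ud1 => d10 _ _; case: uc1 => c10 _ _.
by field; rewrite b10 d10 c10.
Qed.

Lemma frac_gen A S T : subr A -> subr S -> A `<=` S ->
  (forall b, T b -> exists a c, [/\ A a, A c, unit_in S c & b = a / c]) ->
  forall b, gen_ring T b -> exists a c, [/\ A a, A c, unit_in S c & b = a / c].
Proof.
move=> hA hS AS hT; apply: gen_min => //.
split.
- by exists 1, 1; split; [exact: subr1|exact: subr1|exact: unit1|rewrite divr1].
- move=> _ _ [a [b [Aa Ab [b0 Sb Sb'] ->]]] [a' [b' [Aa' Ab' [b0' Sb1 Sb1'] ->]]].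
  exists (a * b' - a' * b), (b * b'); split.
  + by apply: subrB' => //; exact: subrM'.
  + exact: subrM'.
  + exact: unitM.
  + by field; rewrite b0 b0'.
- move=> _ _ [a [b [Aa Ab ub ->]]] [a' [b' [Aa' Ab' ub' ->]]].
  exists (a * a'), (b * b'); split; try exact: subrM'; first exact: unitM.
  by rewrite mulf_div.
Qed.

End Subrings.

(** * Existence of valuation rings *)

Section ValuationExistence.
Variable F : fieldType.
Implicit Types A B I R S V W : set F.

Definition ideal A I : Prop :=
  [/\ I `<=` A, I 0, (forall x y, I x -> I y -> I (x - y))
    & forall a x, A a -> I x -> I (a * x)].

Lemma idealN A I x : ideal A I -> I x -> I (- x).
Proof. by move=> [_ h0 hB _] hx; rewrite -sub0r; exact: hB. Qed.

Lemma idealD A I x y : ideal A I -> I x -> I y -> I (x + y).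
Proof. by move=> hI hx hy; rewrite -(opprK y); case: (hI) => _ _ hB _; apply: hB => //; exact: idealN hI hy. Qed.

Lemma ideal_sum A I (J : Type) (r : seq J) (P : pred J) (E : J -> F) : ideal A I ->
  (forall i, P i -> I (E i)) -> I (\sum_(i <- r | P i) E i).
Proof.
move=> hI h; elim/big_rec: _ => [|i x hi hx]; first by case: hI.
by apply: (idealD hI) => //; exact: h.
Qed.

(* Substituting the second relation into the leading term of the first one
   lowers its degree. *)
Lemma lower_relation B I (x : F) (c q : nat -> F) (n : nat) :
  subr B -> ideal B I -> x != 0 -> (forall i, I (c i)) -> (forall i, I (q i)) ->
  1 = \sum_(i < n.+2) c i * x ^+ i -> 1 = \sum_(i < n.+2) q i * x^-1 ^+ i ->
  exists c' : nat -> F, (forall i, I (c' i)) /\ 1 = \sum_(i < n.+1) c' i * x ^+ i.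
Proof.
move=> hB hI x0 hc hq ec eq_.
(* The second relation times x^(n+1) expresses [(1 - q 0) * x ^+ n.+1] by lower powers ([e1] below).
   The first relation times [1 - q 0], with [q 0] added on both sides, then has these
   coefficients. *)
pose c' (i : nat) : F := (if i == 0%N then q 0%N else 0) + (1 - q 0%N) * c i + c n.+1 * q (n.+1 - i)%N.
have B1q : B (1 - q 0%N) by apply: subrB' => //; [exact: subr1|case: hI => h _ _ _; exact: h].
case: (hI) => IB I0 _ IM.
exists c'; split.
  move=> i; rewrite /c'; apply: (idealD hI); first apply: (idealD hI).
  - by case: ifP => // _.
  - exact: IM.
  - by apply: IM => //; exact: IB.
have e1 : (1 - q 0%N) * x ^+ n.+1 = \sum_(i < n.+1) q (n.+1 - i)%N * x ^+ i.
  rewrite {1}eq_ big_ord_recl expr0 mulr1 addrAC subrr add0r mulr_suml.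
  rewrite [RHS](reindex_inj rev_ord_inj) /=; apply: eq_bigr => i _.
  have hi := ltn_ord i.
  have -> : (n.+1 - (n.+1 - i.+1))%N = i.+1 by lia.
  rewrite /bump /= add1n -mulrA; congr (_ * _).
  have le_in : (i.+1 <= n.+1)%N by rewrite ltn_ord.
  have -> : x ^+ n.+1 = x ^+ (n.+1 - i.+1) * x ^+ i.+1 by rewrite -exprD subnK.
  by rewrite exprVn mulrCA mulVf ?mulr1 // expf_neq0.
rewrite -[LHS](subrK (q 0%N)) -[X in X + _]mulr1 {2}ec big_ord_recr /= mulrDr.
rewrite [_ * (c n.+1 * _)]mulrCA e1 /c' [RHS](eq_bigr (fun i : 'I_n.+1 =>
  (if val i == 0%N then q 0%N else 0) * x ^+ i + (1 - q 0%N) * (c i * x ^+ i)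
  + c n.+1 * (q (n.+1 - i)%N * x ^+ i))); last by move=> i _; rewrite !mulrDl !mulrA.
rewrite !big_split /= -!mulr_sumr.
have -> : \sum_(i < n.+1) (if val i == 0%N then q 0%N else 0) * x ^+ i = q 0%N.
  by rewrite big_ord_recl /= expr0 mulr1 big1 ?addr0 // => i _; rewrite mul0r.
by rewrite [LHS]addrC addrA.
Qed.

Lemma adjoin_subr B x : subr B ->
  subr [set y | exists p : {poly F}, (forall i, B p`_i) /\ y = p.[x]].
Proof.
move=> hB; split.
- exists 1; rewrite hornerC; split=> // i; rewrite coef1; exact: subr_nat.
- move=> _ _ [p [hp ->]] [q [hq ->]]; exists (p - q); rewrite hornerD hornerN.
  by split=> // i; rewrite coefB; exact: subrB'.
- move=> _ _ [p [hp ->]] [q [hq ->]]; exists (p * q); rewrite hornerM.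
  by split=> // i; rewrite coefM; apply: subr_sum => // j _; exact: subrM'.
Qed.

Lemma adjoin_ideal B I x : subr B -> ideal B I ->
  ideal [set y | exists p : {poly F}, (forall i, B p`_i) /\ y = p.[x]]
        [set y | exists p : {poly F}, (forall i, I p`_i) /\ y = p.[x]].
Proof.
move=> hB hI; case: (hI) => IB I0 IBB IM; split.
- by move=> _ [p [hp ->]]; exists p; split=> // i; exact: IB.
- by exists 0; rewrite horner0; split=> // i; rewrite coef0.
- move=> _ _ [p [hp ->]] [q [hq ->]]; exists (p - q); rewrite hornerD hornerN.
  by split=> // i; rewrite coefB; exact: IBB.
- move=> _ _ [p [hp ->]] [q [hq ->]]; exists (p * q); rewrite hornerM.
  by split=> // i; rewrite coefM; apply: ideal_sum hI _ => j _; exact: IM.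
Qed.

Lemma poly_relation I x : 
  (exists p : {poly F}, (forall i, I p`_i) /\ 1 = p.[x]) ->
  exists n (c : nat -> F), (forall i, I (c i)) /\ 1 = \sum_(i < n) c i * x ^+ i.
Proof. by move=> [p [hp e]]; exists (size p), (fun i => p`_i); rewrite -horner_coef. Qed.

(** Chevalley's extension theorem. Zorn's lemma gives a maximal pair of a ring [B] and a proper
    ideal [J] above [(A, I)]. If neither x nor 1/x were in [B], then [J] would generate the unit
    ideal in [B[x]] and in [B[1/x]], and the two relations with fewest terms would contradict
    [lower_relation]. *)
Lemma val_exists A I : subr A -> ideal A I -> ~ I 1 ->
  exists V, [/\ valring V, A `<=` V & forall x, I x -> ~ unit_in V x].
Proof.
move=> hA hI I1.
pose T := {BJ : set F * set F | [/\ subr BJ.1, ideal BJ.1 BJ.2, ~ BJ.2 1, A `<=` BJ.1 & I `<=` BJ.2]}.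
pose le (s t : T) := `[< (sval s).1 `<=` (sval t).1 /\ (sval s).2 `<=` (sval t).2 >].
have t0 : T by exists (A, I); split => /=.
have : exists t : T, forall s, le t s -> s = t; first apply: Zorn.
- by move=> t; apply/asboolP; split.
- move=> r s t /asboolP [h1 h2] /asboolP [h3 h4]; apply/asboolP; split.
    exact: subset_trans h3.
  exact: subset_trans h4.
- move=> s t /asboolP [h1 h2] /asboolP [h3 h4].
  apply: eq_sig_hprop; first by move=> *; exact: Prop_irrelevance.
  rewrite [LHS]surjective_pairing [RHS]surjective_pairing.
  by congr (_, _); apply/seteqP.
- move=> D hD; have [[d0 Dd0]|Dn] := pselect (exists d, D d); last first.
    by exists t0 => s Ds; exfalso; apply: Dn; exists s.
  pose U1 := \bigcup_(d in D) (sval d).1; pose U2 := \bigcup_(d in D) (sval d).2.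
  have dir x y d d' : D d -> D d' -> (sval d).1 x -> (sval d').2 y ->
      exists2 e, D e & (sval e).1 x /\ (sval e).2 y.
    move=> Dd Dd' hx hy; have [/asboolP [h1 h2]|/asboolP [h1 h2]] := hD _ _ Dd Dd'.
      by exists d' => //; split=> //; exact: h1.
    by exists d => //; split=> //; exact: h2.
  have dir1 x y d d' : D d -> D d' -> (sval d).1 x -> (sval d').1 y ->
      exists2 e, D e & (sval e).1 x /\ (sval e).1 y.
    move=> Dd Dd' hx hy; have [/asboolP [h1 h2]|/asboolP [h1 h2]] := hD _ _ Dd Dd'.
      by exists d' => //; split=> //; exact: h1.
    by exists d => //; split=> //; exact: h1.
  have dir2 x y d d' : D d -> D d' -> (sval d).2 x -> (sval d').2 y ->
      exists2 e, D e & (sval e).2 x /\ (sval e).2 y.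
    move=> Dd Dd' hx hy; have [/asboolP [h1 h2]|/asboolP [h1 h2]] := hD _ _ Dd Dd'.
      by exists d' => //; split=> //; exact: h2.
    by exists d => //; split=> //; exact: h2.
  have hU : [/\ subr U1, ideal U1 U2, ~ U2 1, A `<=` U1 & I `<=` U2].
    split.
    + split.
      * by exists d0 => //; case: (svalP d0) => h _ _ _ _; exact: subr1.
      * move=> x y [d Dd hx] [d' Dd' hy]; have [e De [ex ey]] := dir1 _ _ _ _ Dd Dd' hx hy.
        by exists e => //; case: (svalP e) => h _ _ _ _; exact: subrB'.
      * move=> x y [d Dd hx] [d' Dd' hy]; have [e De [ex ey]] := dir1 _ _ _ _ Dd Dd' hx hy.
        by exists e => //; case: (svalP e) => h _ _ _ _; exact: subrM'.
    + split.
      * by move=> x [d Dd hx]; exists d => //; case: (svalP d) => _ [h _ _ _] _ _ _; exact: h.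
      * by exists d0 => //; case: (svalP d0) => _ [_ h _ _].
      * move=> x y [d Dd hx] [d' Dd' hy]; have [e De [ex ey]] := dir2 _ _ _ _ Dd Dd' hx hy.
        by exists e => //; case: (svalP e) => _ [_ _ h _] _ _ _; exact: h.
      * move=> x y [d Dd hx] [d' Dd' hy]; have [e De [ex ey]] := dir _ _ _ _ Dd Dd' hx hy.
        by exists e => //; case: (svalP e) => _ [_ _ _ h] _ _ _; exact: h.
    + by move=> [d Dd h1]; case: (svalP d) => _ _ h _ _; exact: h.
    + by move=> x Ax; exists d0 => //; case: (svalP d0) => _ _ _ h _; exact: h.
    + by move=> x Ax; exists d0 => //; case: (svalP d0) => _ _ _ _ h; exact: h.
  exists (exist _ (U1, U2) hU) => s Ds; apply/asboolP; split => x hx /=; by exists s.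
- move=> [[[B J] /= [hB hJ J1 AB IJ]] hmax].
  have hmax' B' J' : [/\ subr B', ideal B' J', ~ J' 1, A `<=` B' & I `<=` J'] ->
     B `<=` B' -> J `<=` J' -> B = B'.
    move=> h BB JJ; have := hmax (exist _ (B', J') h).
    have l : le (exist _ (B, J) (And5 hB hJ J1 AB IJ)) (exist _ (B', J') h) by apply/asboolP.
    by move=> /(_ l) [].
  have adj x : ~ B x -> exists n (c : nat -> F), (forall i, J (c i)) /\ 1 = \sum_(i < n) c i * x ^+ i.
    move=> Bx; apply: poly_relation; apply: contrapT => hn; apply: Bx.
    rewrite (hmax' [set y | exists p : {poly F}, (forall i, B p`_i) /\ y = p.[x]]
              [set y | exists p : {poly F}, (forall i, J p`_i) /\ y = p.[x]]).
    + exists 'X; rewrite hornerX; split=> // i; rewrite coefX; exact: subr_nat.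
    + have BB' : B `<=` [set y | exists p : {poly F}, (forall i, B p`_i) /\ y = p.[x]].
        move=> b Bb; exists b%:P; rewrite hornerC; split=> // i; rewrite coefC.
        by case: ifP => // _; exact: subr0'.
      have JJ' : J `<=` [set y | exists p : {poly F}, (forall i, J p`_i) /\ y = p.[x]].
        move=> b Bb; exists b%:P; rewrite hornerC; split=> // i; rewrite coefC.
        by case: ifP => // _; case: (hJ).
      split; [exact: adjoin_subr|exact: adjoin_ideal|exact: hn
        |exact: subset_trans BB'|exact: subset_trans JJ'].
    + move=> b Bb; exists b%:P; rewrite hornerC; split=> // i; rewrite coefC.
      by case: ifP => // _; exact: subr0'.
    + move=> b Bb; exists b%:P; rewrite hornerC; split=> // i; rewrite coefC.
      by case: ifP => // _; case: (hJ).
  exists B; split=> //; last first.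
    move=> x /IJ Jx [x0 _ Bx]; apply: (J1); rewrite -(mulVf x0).
    by case: (hJ) => _ _ _; apply.
  split=> // x; apply: contrapT => /not_orP [nx nx'].
  have x0 : x != 0 by apply: contra_notN nx => /eqP ->; exact: subr0'.
  pose rel (y : F) n := `[< exists c : nat -> F, (forall i, J (c i)) /\ 1 = \sum_(i < n) c i * y ^+ i >].
  have ex1 : exists n, rel x n by have [n [c h]] := adj _ nx; exists n; apply/asboolP; exists c.
  have ex2 : exists n, rel x^-1 n by have [n [c h]] := adj _ nx'; exists n; apply/asboolP; exists c.
  have Jz : J 0 by case: (hJ).
  have rel1 y n : rel y n -> (1 < n)%N.
    case: n => [|[|//]] /asboolP [c [hc]].
      by rewrite big_ord0 => /eqP; rewrite oner_eq0.
    by rewrite big_ord1 expr0 mulr1 => e; exfalso; apply: (J1); rewrite e.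
  have widen y n m : (n <= m)%N -> rel y n -> rel y m.
    move=> le_nm /asboolP [c [hc e]]; apply/asboolP.
    exists (fun i => if (i < n)%N then c i else 0); split=> [i|]; first by case: ifP.
    rewrite e (big_ord_widen m (fun i => c i * y ^+ i) le_nm) big_mkcond /=.
    by apply: eq_bigr => i _; case: ifP => _; rewrite ?mul0r.
  (* The shorter relation is padded with zero coefficients to the length of the longer one, which
     can then be shortened. *)
  have key y n m : y != 0 -> (m <= n)%N -> rel y n -> rel y^-1 m -> rel y n.-1.
    move=> y0 le_mn hn /(widen _ _ _ le_mn); have := rel1 _ _ hn; move: hn.
    case: n {le_mn} => [|[|n]] // /asboolP [c [hc ec]] _ /asboolP [q [hq eq_]].
    apply/asboolP; exact: (lower_relation hB hJ y0 hc hq ec eq_).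
  case: (ex_minnP ex1) => n hn minn; case: (ex_minnP ex2) => m hm minm.
  have [le_mn|/ltnW le_nm] := leqP m n.
    have := minn _ (key _ _ _ x0 le_mn hn hm); have := rel1 _ _ hn; lia.
  have x0' : x^-1 != 0 by rewrite invr_eq0.
  have := key _ _ _ x0' le_nm hm; rewrite invrK => /(_ hn) /minm; have := rel1 _ _ hm; lia.
Qed.

Lemma dominating_valring R : islocal R -> exists V, valring V /\ dom V R.
Proof.
move=> [hR hloc]; have hI : ideal R [set x | R x /\ ~ unit_in R x].
  have N x : R x /\ ~ unit_in R x -> R (- x) /\ ~ unit_in R (- x).
    by move=> [Rx ux]; split; [exact: subrN'|move=> /(unitN hR); rewrite opprK].
  split.
  - by move=> x [].
  - by split; [exact: subr0'|case; rewrite eqxx].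
  - move=> x y [Rx ux] /N [Ry uy]; split; first exact: (subrD' hR Rx Ry).
    by move=> /(hloc _ _ Rx Ry) [].
  - move=> a x Ra [Rx ux]; split; first exact: subrM'.
    by rewrite mulrC => /(unitMl hR Rx Ra).
have [V [hV RV hn]] := val_exists hR hI (fun h => h.2 (unit1 hR)).
exists V; split=> //; split=> // x Rx Vx.
have [->|x0] := eqVneq x 0; first by rewrite invr0; exact: subr0'.
apply: contrapT => h; apply: (hn x); first by split=> // -[].
by split=> //; exact: RV.
Qed.

(** Plays the part of quasi-compactness: if a suitable denominator exists at every valuation ring
    over [A], the ideal of all suitable denominators contains 1. *)
Lemma ideal_unit A I : subr A -> ideal A I ->
  (forall V, valring V -> A `<=` V -> exists2 b, I b & unit_in V b) -> I 1.
Proof.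
move=> hA hI h; apply: contrapT => /(val_exists hA hI) [V [hV AV hn]].
by have [b Ib ub] := h V hV AV; exact: hn ub.
Qed.

Lemma valring_root V x n a : valring V -> V a -> x ^+ n.+1 = a -> V x.
Proof.
move=> [hV tV] Va e; have [->|x0] := eqVneq x 0; first exact: subr0'.
have [//|hx] := tV x.
have -> : x = a * x^-1 ^+ n by rewrite -e exprS exprVn mulfK // expf_neq0.
by apply: subrM' => //; exact: subrX'.
Qed.

End ValuationExistence.

(** * Orders at discrete valuation rings *)

Section DiscreteValuations.
Variable F : fieldType.
Implicit Types A R V W : set F.

Lemma unif_subr R t : uniformizer R t -> subr R.
Proof. by case=> /subringP. Qed.

Lemma unif_ge0 R t u n : uniformizer R t -> unit_in R u -> R (u * t ^ n) <-> 0 <= n.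
Proof.
move=> ht uu; have hR := unif_subr ht; case: ht => _ Rt t0 nt _.
have key : R (t ^ n) <-> 0 <= n.
  case: n => n; first by rewrite -exprnP; split=> // _; exact: subrX'.
  split=> // h; case: nt; rewrite NegzE -exprnN in h.
  have -> : t^-1 = t ^- n.+1 * t ^+ n.
    by rewrite exprS invfM -mulrA mulVf ?mulr1 // expf_neq0.
  by apply: subrM' => //; exact: subrX'.
rewrite -key; split=> h; last by apply: subrM' => //; case: uu.
rewrite -(mulKf (x := u) _ (t ^ n)); last by case: uu.
by apply: subrM' => //; case: uu.
Qed.

(** Each uniformizer is a unit times a positive power of the other; the two exponents multiply to 1,
    so both are 1. Hence [ord] does not depend on the uniformizer picked by its definition. *)
Lemma unif_uniq R t t' u u' n n' : uniformizer R t -> uniformizer R t' ->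
  unit_in R u -> unit_in R u' -> u * t ^ n = u' * t' ^ n' -> n = n'.
Proof.
move=> ht ht' uu uu' e; have hR := unif_subr ht.
have pos s s' : uniformizer R s -> uniformizer R s' ->
    exists w k, [/\ unit_in R w, s' = w * s ^ k & 1 <= k].
  move=> hs hs'; case: (hs') => _ Rs' s0' ns' _; case: (hs) => _ Rs s0 ns dec.
  have [w [k [Rw Rw' ew]]] := dec _ s0'.
  have uw : unit_in R w by split=> //; apply: contraNneq s0' => w0; rewrite ew w0 mul0r.
  exists w, k; split=> //; rewrite -gtz0_ge1 lt_neqAle; apply/andP; split; last first.
    by rewrite -(unif_ge0 k hs uw) -ew.
  by apply/eqP => k0; apply: ns'; rewrite ew -k0 expr0z mulr1.
have [w [k [uw ew k1]]] := pos _ _ ht ht'.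
have [w' [k' [uw' ew' k1']]] := pos _ _ ht' ht.
have t0 : t != 0 by case: ht.
have w0 : w != 0 by case: uw.
have w0' : w' != 0 by case: uw'.
have uexp x m : unit_in R x -> unit_in R (x ^ m).
  by move=> ux; case: m => m; [exact: unitX|rewrite NegzE -exprnN; apply: unitV => //; exact: unitX].
have e1 : 1 * t ^ 1 = (w' * w ^ k') * t ^ (k * k').
  by rewrite mul1r expr1z {1}ew' ew expfzMl exprz_exp mulrA.
have inj a b m m' : unit_in R a -> unit_in R b -> a * t ^ m = b * t ^ m' -> m <= m'.
  move=> ua ub eab; rewrite -subr_ge0 -(unif_ge0 _ ht (unitM hR ub (unitV ua))).
  have a0 : a != 0 by case: ua.
  have -> : b / a * t ^ (m' - m) = 1.
    rewrite expfzDr // -invr_expz mulf_div -eab divff // mulf_neq0 //.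
    exact: expfz_neq0.
  exact: subr1.
have eqn a b m m' : unit_in R a -> unit_in R b -> a * t ^ m = b * t ^ m' -> m = m'.
  by move=> ua ub eab; apply/eqP; rewrite eq_le (inj _ _ _ _ ua ub eab) (inj _ _ _ _ ub ua (esym eab)).
have kk : 1 = k * k' by apply: (eqn _ _ _ _ (unit1 hR) _ e1); apply: unitM => //; exact: uexp.
have k_1 : k = 1 by nia.
rewrite k_1 expr1z in ew.
move: e; rewrite ew expfzMl mulrA => e'.
by apply: (eqn _ _ _ _ uu _ e'); apply: unitM => //; exact: uexp.
Qed.

Lemma dvr_subr R : dvr R -> subr R. Proof. by case=> t; exact: unif_subr. Qed.

Lemma ordE R t u n : uniformizer R t -> unit_in R u -> ord R (u * t ^ n) = n.
Proof.
move=> ht uu; apply: xget_unique; first by exists t, u; case: uu.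
move=> m [t' [u' [ht' u0' Ru' Ru'' e]]]; symmetry; exact: (unif_uniq ht ht' uu _ e).
Qed.

Lemma ordP R t h : uniformizer R t -> h != 0 ->
  exists u, unit_in R u /\ h = u * t ^ (ord R h).
Proof.
move=> ht h0; case: (ht) => _ _ _ _ dec; have [u [n [Ru Ru' e]]] := dec _ h0.
have uu : unit_in R u by split=> //; apply: contraNneq h0 => u0; rewrite e u0 mul0r.
by exists u; rewrite {2}e (ordE _ ht uu).
Qed.

Lemma ord_zero R : ord R 0 = 0.
Proof.
apply: xgetPN => n [t [u [ht u0 _ _ /esym/eqP]]].
by rewrite mulf_eq0 (negPf u0) /= => /eqP h; case: ht => _ _ t0 _ _; move/eqP: h; apply/negP/expfz_neq0.
Qed.

Lemma unif_neq0 R t : uniformizer R t -> t != 0. Proof. by case. Qed.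

Lemma ord_ge0 R h : dvr R -> h != 0 -> R h <-> 0 <= ord R h.
Proof.
by move=> [t ht] h0; have [u [uu e]] := ordP ht h0; rewrite {1}e; exact: unif_ge0.
Qed.

Lemma ordM R g h : dvr R -> g != 0 -> h != 0 -> ord R (g * h) = ord R g + ord R h.
Proof.
move=> [t ht] g0 h0; have [u [uu eu]] := ordP ht g0; have [v [uv ev]] := ordP ht h0.
rewrite {1}eu {1}ev mulrACA -expfzDr ?(unif_neq0 ht) // (ordE _ ht) //.
by apply: unitM => //; exact: unif_subr ht.
Qed.

Lemma ord_one R : dvr R -> ord R 1 = 0.
Proof.
by move=> [t ht]; rewrite -[1]mulr1 -(expr0z t) (ordE _ ht) //; exact: unit1 (unif_subr ht).
Qed.

Lemma ordV R h : dvr R -> ord R h^-1 = - ord R h.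
Proof.
move=> hR; have [->|h0] := eqVneq h 0; first by rewrite invr0 ord_zero oppr0.
by have e := ordM hR (invr_neq0 h0) h0; rewrite mulVf // ord_one // in e; lia.
Qed.

Lemma ordX R h n : dvr R -> h != 0 -> ord R (h ^+ n) = n%:Z * ord R h.
Proof.
move=> hR h0; elim: n => [|n IH]; first by rewrite expr0 ord_one // mul0r.
by rewrite exprS ordM // ?expf_neq0 // IH; lia.
Qed.

Lemma ord_unit R h : dvr R -> unit_in R h <-> h != 0 /\ ord R h = 0.
Proof.
move=> hR; split.
  move=> [h0 Rh Rh']; split=> //; apply/eqP; rewrite eq_le.
  move: Rh' Rh; rewrite !(ord_ge0 hR) ?invr_eq0 // (ordV _ hR) oppr_ge0.
  by move=> -> ->.
by move=> [h0 e]; split; rewrite // (ord_ge0 hR) ?invr_eq0 // ?(ordV _ hR) e.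
Qed.

Lemma ord_unif R t : uniformizer R t -> ord R t = 1.
Proof. by move=> ht; rewrite -[t in LHS]mul1r -[t in _ * t]expr1z (ordE _ ht) //; exact: unit1 (unif_subr ht). Qed.

Lemma unif_ord R t : dvr R -> t != 0 -> ord R t = 1 -> uniformizer R t.
Proof.
move=> hR t0 e; case: (hR) => s hs; case: (hs) => h1 _ _ _ _.
split=> //.
- by rewrite (ord_ge0 hR) // e.
- by rewrite (ord_ge0 hR) ?invr_eq0 // (ordV _ hR) e.
- move=> h h0; have [u [uu eu]] := ordP hs h0; have [w [uw ew]] := ordP hs t0.
  rewrite e expr1z in ew.
  have us : unit_in R (w^-1 ^ (ord R h)).
    have us : unit_in R w^-1 by exact: unitV.
    case: (ord R h) => m; first by rewrite -exprnP; apply: unitX us; exact: unif_subr hs.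
    by rewrite NegzE -exprnN; apply: unitV; apply: unitX us; exact: unif_subr hs.
  have [h3 h4 h5] := unitM (unif_subr hs) uu us.
  exists (u * w^-1 ^ (ord R h)), (ord R h); split=> //.
  rewrite {1}eu ew expfzMl mulrA -[u * _ * _]mulrA -expfzMl mulVf ?exp1rz ?mulr1 //.
  by case: uw.
Qed.

Lemma ord_expz R t n : uniformizer R t -> ord R (t ^ n) = n.
Proof. by move=> ht; rewrite -[_ ^ _]mul1r (ordE _ ht) //; exact: unit1 (unif_subr ht). Qed.

Lemma dvr_valring R : dvr R -> valring R.
Proof.
move=> hR; split; first exact: dvr_subr.
move=> x; have [->|x0] := eqVneq x 0; first by left; exact: subr0' (dvr_subr hR).
by rewrite !(ord_ge0 hR) ?invr_eq0 // (ordV _ hR); have := le_total 0 (ord R x); case/orP; lia.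
Qed.

Lemma dvr_neqT R : dvr R -> R <> [set: F].
Proof. by move=> [t [_ _ _ nt _]] RT; apply: nt; rewrite RT. Qed.

(** An element of [V] outside [R] has negative order, so any element divided by a high enough power
    of it lands in [R]. *)
Lemma dvr_overring R V : dvr R -> subr V -> R `<=` V -> V = R \/ V = [set: F].
Proof.
move=> hR hV RV; have [h|h] := pselect (V `<=` R); first by left; apply/seteqP.
right; apply/seteqP; split=> // y _.
have [x Vx nx] : exists2 x, V x & ~ R x.
  by apply: contrapT => n; apply: h => x Vx; apply: contrapT => nx; apply: n; exists x.
have x0 : x != 0 by apply: contra_notN nx => /eqP ->; exact: subr0' (dvr_subr hR).
have [->|y0] := eqVneq y 0; first exact: subr0'.
have ltx : ord R x <= -1 by move: nx; rewrite (ord_ge0 hR) //; lia.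
have -> : y = x ^+ `|ord R y| * (y / x ^+ `|ord R y|) by rewrite mulrC divfK // expf_neq0.
apply: subrM' => //; first exact: subrX'.
apply: RV; rewrite (ord_ge0 hR) ?mulf_neq0 ?invr_eq0 ?expf_neq0 //.
rewrite ordM ?invr_eq0 ?expf_neq0 // ordV // ordX //; nia.
Qed.

Lemma dvr_eq R R' : dvr R -> dvr R' -> R `<=` R' -> R' = R.
Proof. by move=> hR hR' h; have [//|/(dvr_neqT hR')] := dvr_overring hR (dvr_subr hR') h. Qed.

(** The first alternative stands for infinite order, because [ord R 0] has the default value 0. *)
Definition ordge R (n : int) x : Prop := x = 0 \/ n <= ord R x.

Lemma ordgeP R n x t : uniformizer R t -> ordge R n x <-> R (x * t ^ (- n)).
Proof.
move=> ht; have hR : dvr R by exists t.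
have [->|x0] := eqVneq x 0.
  by rewrite mul0r; split=> _; [exact: subr0' (unif_subr ht)|left].
have t0 := unif_neq0 ht; have tn : t ^ (- n) != 0 by exact: expfz_neq0.
rewrite (ord_ge0 hR) ?mulf_neq0 // ordM // (ord_expz _ ht) subr_ge0.
by split=> [[/eqP|//]|]; [rewrite (negPf x0)|right].
Qed.

Lemma ordge0P R x : dvr R -> ordge R 0 x <-> R x.
Proof. by move=> [t ht]; rewrite (ordgeP _ _ ht) oppr0 expr0z mulr1. Qed.

Lemma ordgeD R n x y : dvr R -> ordge R n x -> ordge R n y -> ordge R n (x + y).
Proof.
move=> [t ht]; rewrite !(ordgeP _ _ ht) mulrDl; exact: subrD' (unif_subr ht) _ _.
Qed.

Lemma ordgeN R n x : dvr R -> ordge R n x -> ordge R n (- x).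
Proof.
move=> [t ht]; rewrite !(ordgeP _ _ ht) mulNr; exact: subrN' (unif_subr ht) _.
Qed.

Lemma ordgeM R n m x y : dvr R -> ordge R n x -> ordge R m y -> ordge R (n + m) (x * y).
Proof.
move=> [t ht]; rewrite !(ordgeP _ _ ht) opprD expfzDr ?(unif_neq0 ht) // mulrACA.
exact: subrM' (unif_subr ht) _ _.
Qed.

Lemma ordge_le R n m x : m <= n -> ordge R n x -> ordge R m x.
Proof. by move=> mn [->|h]; [left|right; exact: le_trans h]. Qed.

Lemma ordgeX R n x k : dvr R -> ordge R n x -> ordge R (k%:Z * n) (x ^+ k).
Proof.
move=> hR hx; elim: k => [|k IH]; first by rewrite mul0r expr0; right; rewrite ord_one.
by rewrite exprS; have := ordgeM hR hx IH; congr ordge; lia.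
Qed.

Lemma ordge_prod R (J : Type) (r : seq J) (P : pred J) (n : J -> int) (E : J -> F) :
  dvr R -> (forall i, P i -> ordge R (n i) (E i)) ->
  ordge R (\sum_(i <- r | P i) n i) (\prod_(i <- r | P i) E i).
Proof.
move=> hR h; elim/big_rec2: _ => [|i m x Pi hx]; first by right; rewrite ord_one.
by apply: ordgeM => //; exact: h.
Qed.

Lemma ordD_lt R x y : dvr R -> x != 0 -> ordge R (ord R x + 1) y ->
  x + y != 0 /\ ord R (x + y) = ord R x.
Proof.
move=> hR x0 hy.
have n0 z : ordge R (ord R x + 1) z -> z != x.
  by move=> [->|h]; [rewrite eq_sym|apply: contraTneq h => ->; lia].
have xy0 : x + y != 0.
  by rewrite addr_eq0 eq_sym; apply: n0; exact: ordgeN.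
split=> //; apply/eqP; rewrite eq_le; apply/andP; split; last first.
  have: ordge R (ord R x) (x + y).
    by apply: ordgeD => //; [right|apply: ordge_le hy; lia].
  by case=> [/eqP|//]; rewrite (negPf xy0).
rewrite leNgt; apply/negP => h.
have h1 : ordge R (ord R x + 1) (x + y) by right; lia.
have := ordgeD hR h1 (ordgeN hR hy); rewrite addrK.
by case=> [/eqP|]; [rewrite (negPf x0)|lia].
Qed.

End DiscreteValuations.

(** * Recognition of a model as the image of a projective embedding *)

Section VeryAmpleCriterion.
Variable F : fieldType.
Implicit Types R S V W : set F.

Definition chart (k0 T : set F) (x : F) : set F := gen_ring (k0 `|` [set y / x | y in T]).

Lemma chart_sub_ring (k0 T : set F) x S : subr S -> k0 `<=` S ->
  (forall y, T y -> S (y / x)) -> chart k0 T x `<=` S.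
Proof.
by move=> hS kS h; apply: gen_min => // z [/kS//|[y Ty <-]]; exact: h.
Qed.

Lemma chart_k0 k0 T x : k0 `<=` chart k0 T x.
Proof. by move=> c kc; apply: gen_sub; left. Qed.

Lemma chart_mem k0 T x y : T y -> chart k0 T x (y / x).
Proof. by move=> Ty; apply: gen_sub; right; exists y. Qed.

Lemma chart_subr k0 T x : subr (chart k0 T x). Proof. exact: gen_subr. Qed.

Lemma locz_chart_change k0 (T : set F) x x' R : x != 0 -> T x -> T x' ->
  locz (chart k0 T x) R -> unit_in R (x' / x) -> locz (chart k0 T x') R.
Proof.
move=> x0 Tx Tx' h [u0 Ru Ru']; case: (h) => hR AR hfr.
have sR := local_subr hR.
have x0' : x' != 0 by apply: contraNneq u0 => ->; rewrite mul0r.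
have kR : k0 `<=` R by move=> c kc; apply: AR; exact: chart_k0.
have sub' : chart k0 T x' `<=` R.
  apply: chart_sub_ring => // y Ty.
  have -> : y / x' = y / x * (x' / x)^-1 by field; rewrite x0 x0'.
  by apply: subrM' => //; apply: AR; exact: chart_mem.
have sA := @chart_subr k0 T x'.
have frac := frac_gen sA sR sub'.
split=> // s /hfr [a [b [Aa Ab ub ->]]].
have h' c : (k0 `|` [set y / x | y in T]) c ->
    exists a c', [/\ chart k0 T x' a, chart k0 T x' c', unit_in R c' & c = a / c'].
  case=> [kc|[y Ty <-]].
    exists c, 1; split; [exact: chart_k0|exact: subr1|exact: unit1|by rewrite divr1].
  exists (y / x'), (x / x'); split; try exact: chart_mem.
  - split; first by rewrite mulf_neq0 ?invr_eq0.
    + by move: Ru'; rewrite invfM invrK mulrC.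
    + by rewrite invfM invrK mulrC.
  - by field; rewrite x0 x0'.
have [a1 [c1 [Aa1 Ac1 uc1 ea]]] := frac _ h' a Aa.
have [b1 [d1 [Ab1 Ad1 ud1 eb]]] := frac _ h' b Ab.
exists (a1 * d1), (c1 * b1); split; [exact: (subrM' sA)|exact: (subrM' sA)| |].
  apply: unitM => //; have -> : b1 = b * d1 by rewrite eb divfK //; case: ud1.
  exact: (unitM sR ub ud1).
have b10 : b1 != 0.
  by case: ub; rewrite eb mulf_eq0 negb_or => /andP [].
by rewrite ea eb; field; case: uc1 => -> _ _; case: ud1 => -> _ _; rewrite b10.
Qed.

(* A local ring of the image model is dominated by a valuation ring, which has
   a center on [Y]; both are then localizations of one chart at the center of
   the valuation. *)
Theorem very_ample_criterion (k0 : set F) (Y : set (set F)) (D : set F -> int)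
    (s : seq F) :
  Y [set: F] ->
  (forall V, valring V -> k0 `<=` V -> exists2 S, Y S & dom V S) ->
  (forall S, Y S -> islocal S /\ exists2 x, x \in s /\ x != 0 & locz (chart k0 [set` s] x) S) ->
  (forall W x, prime_divisor Y W -> x \in s -> x != 0 ->
     (forall y, y \in s -> W (y / x)) -> ord W x + D W = 0) ->
  very_ample k0 Y D.
Proof.
move=> YT hval hch hord; split=> //.
have s0 : (0 < size s)%N by have [_ [x [xs _] _]] := hch _ YT; case: (s) xs.
pose f (i : 'I_(size s).-1.+1) := nth 0 s i.
have fs i : f i \in s by apply: mem_nth; apply: leq_trans (ltn_ord i) _; rewrite prednK.
have sf x : x \in s -> exists i, f i = x.
  move=> xs; have lt : (index x s < (size s).-1.+1)%N by rewrite prednK // index_mem.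
  by exists (Ordinal lt); rewrite /f /= nth_index.
have echart i : gen_ring (k0 `|` range (fun j => f j / f i)) = chart k0 [set` s] (f i).
  rewrite /chart; congr (gen_ring (_ `|` _)); apply/seteqP; split.
    by move=> _ [j _ <-]; exists (f j) => //; exact: fs.
  by move=> _ [y /sf [j <-] <-]; exists j.
have sub x : x \in s -> x != 0 -> forall R, locz (chart k0 [set` s] x) R -> Y R.
  move=> xs x0 R hR; case: (hR) => lR cR _; have sR := local_subr lR.
  have [V [hV dVR]] := dominating_valring lR.
  have [|S YS dVS] := hval _ hV.
    by move=> c kc; apply: dVR.1; apply: cR; exact: chart_k0.
  have [lS [y [ys y0] hS]] := hch _ YS; case: (hS) => _ cS _.
  have u : unit_in V (y / x).
    split; first by rewrite mulf_neq0 ?invr_eq0.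
      by apply: dVR.1; apply: cR; exact: chart_mem.
    by apply: dVS.1; rewrite invfM invrK mulrC; apply: cS; exact: chart_mem.
  have uR : unit_in R (y / x) by apply: dom_unit dVR _ u; apply: cR; exact: chart_mem.
  have hR' := locz_chart_change x0 xs ys hR uR.
  by rewrite (locz_center hR' dVR) -(locz_center hS dVS).
exists (size s).-1, f; split.
  apply/seteqP; split.
    move=> S YS; have [_ [x [/sf [i <-] x0] h]] := hch _ YS; exists i => //.
    by rewrite /proj_chart echart; apply/SpecP => //; exact: chart_subr.
  move=> R [i fi0]; rewrite /proj_chart echart => /SpecP h.
  by apply: (sub (f i)) => //; apply: h; exact: chart_subr.
move=> i fi0 R; rewrite /proj_chart echart => /SpecP h W hW RW.
have [_ cR _] := h (@chart_subr k0 [set` s] (f i)).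
by apply: hord => // y ys; apply: RW; apply: cR; exact: chart_mem.
Qed.

End VeryAmpleCriterion.

Lemma proj_modelP (F : fieldType) (k0 : set F) n (f : 'I_n.+1 -> F) R :
  proj_model k0 f R <-> exists i, f i != 0 /\ locz (chart k0 (range f) (f i)) R.
Proof.
have e i : gen_ring (k0 `|` range (fun j => f j / f i)) = chart k0 (range f) (f i).
  rewrite /chart; congr (gen_ring (_ `|` _)); apply/seteqP; split.
    by move=> _ [j _ <-]; exists (f j) => //; exists j.
  by move=> _ [_ [j _ <-] <-]; exists j.
split=> [[i fi]|[i [fi]]].
  by rewrite /proj_chart e => /SpecP h; exists i; split=> //; apply: h; exact: chart_subr.
by move=> h; exists i => //; rewrite /proj_chart e; apply/SpecP => //; exact: chart_subr.
Qed.

(** Properness of projective space: after division by a coordinate of least value all coordinates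
    are integral. *)
Lemma valring_min (F : fieldType) (V : set F) (s : seq F) :
  valring V -> has (fun x => x != 0) s ->
  exists x, [/\ x \in s, x != 0 & forall y, y \in s -> V (y / x)].
Proof.
move=> [hV tV]; elim: s => //= a s IH; have [-> /= h|a0 _] := eqVneq a 0.
  have [x [xs x0 hx]] := IH h; exists x; split=> //; first by rewrite inE xs orbT.
  by move=> y; rewrite inE => /predU1P [->|/hx//]; rewrite mul0r; exact: subr0'.
have [h|] := boolP (has (fun x => x != 0) s); last first.
  move=> /hasPn h; exists a; split=> //; first by rewrite mem_head.
  move=> y; rewrite inE => /predU1P [->|/h]; first by rewrite divff //; exact: subr1.
  by rewrite negbK => /eqP ->; rewrite mul0r; exact: subr0'.
have [x [xs x0 hx]] := IH h; have [Vax|Vxa] := tV (a / x).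
  exists x; split=> //; first by rewrite inE xs orbT.
  by move=> y; rewrite inE => /predU1P [->|/hx].
exists a; split=> //; first by rewrite mem_head.
rewrite invfM invrK mulrC in Vxa.
move=> y; rewrite inE => /predU1P [->|/hx Vy]; first by rewrite divff //; exact: subr1.
by have := subrM' hV Vy Vxa; rewrite mulrA divfK.
Qed.

(** * Nakayama's lemma for finitely generated modules inside a field *)

Section Nakayama.
Variable F : fieldType.

Definition lincomb (R : set F) (s : seq F) (x : F) : Prop :=
  exists c : nat -> F, (forall i, R (c i)) /\ x = \sum_(i < size s) c i * s`_i.

Lemma lincomb_cons R y s x : lincomb R (y :: s) x <->
  exists r x', [/\ R r, lincomb R s x' & x = r * y + x'].
Proof.
split=> [[c [hc ->]]|[r [_ [Rr [c [hc ->]] ->]]]].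
  exists (c 0%N), (\sum_(i < size s) c i.+1 * s`_i); split=> //.
    by exists (fun i => c i.+1).
  by rewrite big_ord_recl.
exists (fun i => if i is i'.+1 then c i' else r); split; first by case.
by rewrite big_ord_recl.
Qed.

Section Lin.
Variable R : set F.
Hypothesis hR : subr R.

Lemma lincombZ s a x : R a -> lincomb R s x -> lincomb R s (a * x).
Proof.
move=> Ra [c [hc ->]]; exists (fun i => a * c i); split; first by move=> i; exact: subrM'.
by rewrite mulr_sumr; apply: eq_bigr => i _; rewrite mulrA.
Qed.

Lemma lincombD s x y : lincomb R s x -> lincomb R s y -> lincomb R s (x + y).
Proof.
move=> [c [hc ->]] [d [hd ->]]; exists (fun i => c i + d i); split.
  by move=> i; exact: subrD'.
by rewrite -big_split; apply: eq_bigr => i _; rewrite mulrDl.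
Qed.

Lemma lincomb0 s : lincomb R s 0.
Proof.
exists (fun _ => 0); split; first by move=> _; exact: subr0'.
by rewrite big1 // => i _; rewrite mul0r.
Qed.

Lemma lincomb_mem s x : x \in s -> lincomb R s x.
Proof.
elim: s => // a s IH; rewrite inE => /predU1P [->|/IH h]; apply/lincomb_cons.
  by exists 1, 0; split; [exact: subr1|exact: lincomb0|rewrite mul1r addr0].
by exists 0, x; split=> //; [exact: subr0'|rewrite mul0r add0r].
Qed.

Lemma lincomb_closed (M : set F) s x :
  M 0 -> (forall x y, M x -> M y -> M (x + y)) -> (forall a x, R a -> M x -> M (a * x)) ->
  (forall x, x \in s -> M x) -> lincomb R s x -> M x.
Proof.
move=> M0 MD MZ hs [c [hc ->]]; elim/big_ind: _ => // i _; apply: (MZ) => //.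
by apply: hs; exact: mem_nth.
Qed.

(** The first generator is eliminated by solving its own relation, in which it has the invertible
    coefficient [1 - t * r]. Substitution into the other relations preserves their shape, so
    induction applies. *)
Lemma nakayama t (M : set F) (s : seq F) :
  (forall q, R q -> unit_in R (1 - t * q)) ->
  M 0 -> (forall x y, M x -> M y -> M (x + y)) -> (forall a x, R a -> M x -> M (a * x)) ->
  R t ->
  (forall x, x \in s -> exists m y, [/\ M m, lincomb R s y & x = m + t * y]) ->
  forall x, x \in s -> M x.
Proof.
move=> hu M0 MD MZ Rt; elim: s => // a s IH h.
have [m [y [Mm hy ea]]] := h a (mem_head _ _).
have [r [y' [Rr hy' ey]]] := (lincomb_cons _ _ _ _).1 hy.
have [v0 Rv Rv'] := hu _ Rr.
have ea' : a = (1 - t * r)^-1 * m + t * ((1 - t * r)^-1 * y').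
  have e : (1 - t * r) * a = m + t * y' by rewrite mulrBl mul1r {1}ea ey; ring.
  by rewrite -[LHS](mulKf v0) e; ring.
have hs : forall x, x \in s -> M x.
  apply: IH => x xs; have [m1 [z [Mm1 hz ex]]] := h x (mem_behead (s := a :: s) xs).
  have [r1 [z' [Rr1 hz' ez]]] := (lincomb_cons _ _ _ _).1 hz.
  exists (m1 + t * r1 * ((1 - t * r)^-1 * m)), (z' + t * r1 * ((1 - t * r)^-1 * y')); split.
  - by apply: (MD) => //; apply: (MZ); [exact: subrM'|exact: MZ].
  - apply: lincombD => //; apply: lincombZ; first exact: subrM'.
    exact: lincombZ.
  - by rewrite ex ez {1}ea'; ring.
move=> x; rewrite inE => /predU1P [->|]; last exact: hs.
have My' : M y' by exact: lincomb_closed hy'.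
by rewrite ea'; apply: (MD); [exact: MZ|apply: (MZ) => //; exact: MZ].
Qed.
End Lin.
End Nakayama.

(** * Points of the curve, properness, residue fields *)

Section Curve.
Variables (k : closedFieldType) (K : fieldType) (iota : {rmorphism k -> K}).
Variable C : set (set K).
Hypothesis hC : smooth_projective_curve (range iota) C.
Notation k0 := (range iota).

Lemma const_mem c : k0 (iota c). Proof. by exists c. Qed.

Lemma const_subr : subr k0.
Proof.
split; first by exists 1; rewrite ?rmorph1.
- by move=> _ _ [a _ <-] [b _ <-]; exists (a - b); rewrite ?rmorphB.
- by move=> _ _ [a _ <-] [b _ <-]; exists (a * b); rewrite ?rmorphM.
Qed.

Lemma constV x : k0 x -> k0 x^-1.
Proof. by move=> [a _ <-]; exists a^-1; rewrite ?fmorphV. Qed.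

Lemma C_proj : exists n (f : 'I_n.+1 -> K), C = proj_model k0 f.
Proof. by case: hC => -[]. Qed.

Lemma C_generic : C [set: K]. Proof. by case: hC => -[]. Qed.

Lemma proj_model_base n (f : 'I_n.+1 -> K) Q : proj_model k0 f Q -> k0 `<=` Q /\ islocal Q.
Proof.
move=> /proj_modelP [i [_ [lQ h _]]]; split=> //; apply: subset_trans h; exact: chart_k0.
Qed.

Lemma C_k0 Q : C Q -> k0 `<=` Q.
Proof. by have [n [f ->]] := C_proj; case/proj_model_base. Qed.

Lemma C_local Q : C Q -> islocal Q.
Proof. by have [n [f ->]] := C_proj; case/proj_model_base. Qed.

Lemma C_subr Q : C Q -> subr Q. Proof. by move/C_local => []. Qed.

Lemma C_cases Q : C Q -> Q = [set: K] \/ dvr Q.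
Proof. by case: hC => _ _; apply. Qed.

Lemma C_valring Q : C Q -> valring Q.
Proof. by move/C_cases => [->|/dvr_valring//]; split=> // x; left. Qed.

Lemma C_sub Q Q' : C Q -> C Q' -> Q `<=` Q' -> Q' <> [set: K] -> Q' = Q.
Proof.
move=> /C_cases [->|hQ] /C_cases [->|hQ'] h //; last by move=> _; exact: dvr_eq.
by move=> n; case: n; apply/seteqP; split.
Qed.

(** Valuative criterion for [C]: the trace of [V] on [K] is a valuation ring, and it has a center on
    the chart of a coordinate of least value. *)
Lemma C_center (F : fieldType) (j : {rmorphism K -> F}) (V : set F) :
  valring V -> (forall c, V (j (iota c))) -> exists2 Q, C Q & dominates j V Q.
Proof.
move=> [hV tV] hk; pose V' := [set a | V (j a)].
have hV' : valring V'.
  split; last by move=> x; rewrite /V' /= fmorphV; exact: tV.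
  split; rewrite /V' /=; first by rewrite rmorph1; exact: subr1.
  - by move=> x y; rewrite rmorphB; exact: subrB'.
  - by move=> x y; rewrite rmorphM; exact: subrM'.
have [n [f eC]] := C_proj.
have nz : has (fun x => x != 0) (codom f).
  have : C [set: K] := C_generic; rewrite eC => /proj_modelP [i [fi0 _]].
  by apply/hasP; exists (f i) => //; exact: codom_f.
have [x [/codomP [i ->] fi0 hi]] := valring_min hV' nz.
have cV : chart k0 (range f) (f i) `<=` V'.
  apply: chart_sub_ring; first by case: hV'.
    by move=> _ [c _ <-]; exact: hk.
  by move=> _ [i' _ <-]; apply: hi; exact: codom_f.
have [h1 [h2 h3]] := centerP (@chart_subr _ k0 (range f) (f i)) (val_local hV') cV.
exists (center (chart k0 (range f) (f i)) V'); first by rewrite eC; apply/proj_modelP; exists i.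
by split=> [a /h2//|a ha hb]; apply: h3 => //; rewrite /V' /= fmorphV.
Qed.

(** [Q] is itself a valuation ring, and such a ring is dominated only by its equals; so the point
    below [V] is unique. *)
Lemma dominatesE (F : fieldType) (j : {rmorphism K -> F}) (V : set F) Q : C Q ->
  dominates j V Q -> Q = [set a | V (j a)].
Proof.
move=> CQ [h1 h2]; apply/seteqP; split=> // a /= Va; have [_ /(_ a) [//|Qa]] := C_valring CQ.
by rewrite -[a]invrK; apply: h2 => //; rewrite fmorphV invrK.
Qed.

Lemma poly_unit (R : set K) (a : K) (g : {poly k}) : subr R -> k0 `<=` R -> g != 0 ->
  (forall c, unit_in R (a - iota c)) -> unit_in R (map_poly iota g).[a].
Proof.
move=> hR kR g0 hu; have [r ->] := closed_field_poly_normal g.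
rewrite map_polyZ rmorph_prod hornerZ horner_prod /=; apply: unitM => //.
  split; first by rewrite fmorph_eq0 lead_coef_eq0.
    by apply: kR; exact: const_mem.
  by apply: kR; apply: constV; exact: const_mem.
apply: unit_prod => // c _; rewrite rmorphB /= map_polyX map_polyC hornerXsubC; exact: hu.
Qed.

(** Take the ring k[1/a] + m and its ideal of elements whose polynomial part has no constant term.
    If 1 were in it, a nonzero polynomial in 1/a, which is a unit of [R] since k is algebraically
    closed, would lie in [m]. A valuation ring above this pair has 1/a in its maximal ideal. *)
Lemma pole_valring (R m : set K) (a : K) : subr R -> k0 `<=` R -> ideal R m -> ~ m 1 ->
  (forall c, unit_in R (a - iota c)) ->
  exists V, [/\ valring V, k0 `<=` V, m `<=` V & ~ V a].
Proof.
move=> hR kR hm m1 hu; case: (hm) => mR m0 mB mM.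
have ua : unit_in R a by have := hu 0; rewrite rmorph0 subr0.
have a0 : a != 0 by case: ua.
have huV c : unit_in R (a^-1 - iota c).
  have [->|c0] := eqVneq c 0; first by rewrite rmorph0 subr0; exact: unitV.
  have ic0 : iota c != 0 by rewrite fmorph_eq0.
  have -> : a^-1 - iota c = (- iota c) * (a^-1 * (a - iota c^-1)).
    by rewrite fmorphV; field; rewrite a0 ic0.
  apply: unitM => //; last by apply: unitM => //; exact: unitV.
  apply: unitN => //; split=> //; first by apply: kR; exact: const_mem.
  by apply: kR; apply: constV; exact: const_mem.
pose ev (g : {poly k}) := (map_poly iota g).[a^-1].
have evR g : R (ev g).
  have [->|g0] := eqVneq g 0; first by rewrite /ev rmorph0 horner0; exact: subr0'.
  by have [] := poly_unit hR kR g0 huV.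
have evB g h : ev (g - h) = ev g - ev h by rewrite /ev rmorphB hornerD hornerN.
have evM g h : ev (g * h) = ev g * ev h by rewrite /ev rmorphM hornerM.
have evC c : ev c%:P = iota c by rewrite /ev map_polyC hornerC.
have ev1 : ev 1 = 1 by rewrite -polyC1 evC rmorph1.
pose B := [set x | exists g u, m u /\ x = ev g + u].
pose I := [set x | exists (g : {poly k}) u, [/\ m u, g`_0 = 0 & x = ev g + u]].
have BB : subr B.
  split.
  - by exists 1, 0; split=> //; rewrite (evC 1) rmorph1 addr0.
  - move=> _ _ [g [u [mu ->]]] [h [v [mv ->]]]; exists (g - h), (u - v).
    by split; [exact: mB|rewrite evB; ring].
  - move=> _ _ [g [u [mu ->]]] [h [v [mv ->]]]; exists (g * h), (ev g * v + (ev h + v) * u).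
    split; last by rewrite evM; ring.
    apply: (idealD hm); apply: (mM) => //; apply: subrD' => //; exact: mR.
have BI : ideal B I.
  split.
  - by move=> _ [g [u [mu _ ->]]]; exists g, u.
  - by exists 0, 0; rewrite coef0 /ev rmorph0 horner0 addr0.
  - move=> _ _ [g [u [mu g0 ->]]] [h [v [mv h0 ->]]]; exists (g - h), (u - v).
    by split; [exact: mB|rewrite coefB g0 h0 subr0|rewrite evB; ring].
  - move=> _ _ [g [u [mu ->]]] [h [v [mv h0 ->]]]; exists (g * h), (ev g * v + (ev h + v) * u).
    split; last by rewrite evM; ring.
      apply: (idealD hm); apply: (mM) => //; apply: subrD' => //; exact: mR.
    by rewrite coef0M h0 mulr0.
have I1 : ~ I 1.
  move=> [g [u [mu g0 e]]]; have G0 : 1 - g != 0.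
    by apply/eqP => /(congr1 (fun p : {poly k} => p`_0)); rewrite coefB coef1 g0 subr0 coef0 /= => /eqP; rewrite oner_eq0.
  have [v0 _ Rv] := poly_unit hR kR G0 huV; apply: m1.
  rewrite -(mulVf v0); apply: (mM) => //.
  have -> : (map_poly iota (1 - g)).[a^-1] = u; last by [].
  by rewrite -/(ev _) evB ev1 e; ring.
have [V [hV BV nV]] := val_exists BB BI I1.
exists V; split=> //.
- move=> _ [c _ <-]; apply: BV; exists c%:P, 0; by rewrite evC addr0.
- move=> x mx; apply: BV; exists 0, x; split=> //; by rewrite /ev rmorph0 horner0 add0r.
- move=> Va; apply: (nV a^-1).
    exists 'X, 0; split=> //; first by rewrite coefX.
    by rewrite /ev map_polyX hornerX addr0.
  split; rewrite ?invr_eq0 ?invrK //; apply: BV; exists 'X, 0.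
  by rewrite /ev map_polyX hornerX addr0.
Qed.

(** If [h] were not constant, [pole_valring] for the ring [K] and the zero ideal would give a
    valuation ring without [h]. Its center on [C] is a point at which [h] is not regular. *)
Lemma global_const h : (forall Q, C Q -> Q h) -> k0 h.
Proof.
move=> hh; apply: contrapT => nh.
have h0 c : unit_in [set: K] (h - iota c).
  split=> //; apply: contra_notN nh; rewrite subr_eq0 => /eqP ->; exact: const_mem.
have hid : ideal [set: K] [set 0].
  by split=> // [x y -> ->|a x _ ->]; rewrite ?subr0 ?mulr0.
have n1 : ~ [set 0] (1 : K) by move=> /eqP; rewrite oner_eq0.
have kT : k0 `<=` [set: K] by [].
have [V [hV kV _ nV]] := pole_valring (@subrT K) kT hid n1 h0.
have [Q CQ [QV _]] := @C_center K idfun V hV (fun c => kV _ (const_mem c)).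
by apply: nV; apply: QV; exact: hh.
Qed.

(* If the residue field were bigger than k then an element a of Q would be
   transcendental modulo the maximal ideal m; a valuation ring centered at
   m + (1/a) would be a point Q' of C, but all a^n m are contained in Q'. *)
Lemma residue Q a : C Q -> dvr Q -> Q a -> exists c, ordge Q 1 (a - iota c).
Proof.
move=> CQ dQ Qa; apply: contrapT => hn; have hQ := C_subr CQ.
have hu c : unit_in Q (a - iota c).
  have Qac : Q (a - iota c) by apply: subrB' => //; apply: (C_k0 CQ); exact: const_mem.
  have ac0 : a - iota c != 0 by apply: contra_notN hn => /eqP h; exists c; left.
  apply/(ord_unit _ dQ); split=> //; move: Qac; rewrite (ord_ge0 dQ) // => h.
  apply/eqP; rewrite eq_le h andbT leNgt; apply/negP => h'; apply: hn; exists c; right; lia.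
have hm : ideal Q [set x | ordge Q 1 x].
  split.
  - move=> x /= hx; apply/(ordge0P _ dQ); apply: ordge_le hx; lia.
  - by left.
  - by move=> x y /= hx hy; apply: ordgeD => //; exact: ordgeN.
  - move=> b x /(ordge0P _ dQ) hb hx /=; by have := ordgeM dQ hb hx; rewrite add0r.
have m1 : ~ [set x | ordge Q 1 x] 1 by case=> [/eqP|]; [rewrite oner_eq0|rewrite ord_one].
have [V [hV kV mV nV]] := pole_valring hQ (C_k0 CQ) hm m1 hu.
have [Q' CQ' [Q'V _]] := @C_center K idfun V hV (fun c => kV _ (const_mem c)).
have dV : dvr V.
  have [e|dQ'] := C_cases CQ'; first by case: nV; apply: Q'V; rewrite e.
  have [->//|e] := dvr_overring dQ' hV.1 Q'V.
  by case: nV; rewrite e.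
have [t ht] := dQ; have t0 := unif_neq0 ht.
have a0 : a != 0 by case: (hu 0); rewrite rmorph0 subr0.
have ha : ord V a < 0 by rewrite ltNge; apply/negP; rewrite -(ord_ge0 dV a0).
have key n : 0 <= n%:Z * ord V a + ord V t.
  rewrite -ordX // -ordM ?expf_neq0 // -ord_ge0 ?mulf_neq0 ?expf_neq0 //.
  apply: mV => /=; right; rewrite ordM ?expf_neq0 // ordX // (ord_unif ht).
  by have := (ord_ge0 dQ a0).1 Qa; nia.
by have := key (`|ord V t|.+1); nia.
Qed.

End Curve.

(** * Derivations *)

Section Derivations.
Variables (K F : fieldType) (j : {rmorphism K -> F}) (k0 : set K).

(** Derivations with values in an extension field: a derivation of the function field of the surface
    restricts to one of these on [K]. *)
Definition jder (d : K -> F) : Prop :=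
  [/\ forall a b, d (a + b) = d a + d b, forall a b, d (a * b) = j a * d b + j b * d a
    & forall c, k0 c -> d c = 0].

Variable d : K -> F.
Hypothesis hd : jder d.

Lemma jderD a b : d (a + b) = d a + d b. Proof. by case: hd. Qed.
Lemma jderM a b : d (a * b) = j a * d b + j b * d a. Proof. by case: hd. Qed.
Lemma jder0 : d 0 = 0.
Proof. by apply: (addrI (d 0)); rewrite -jderD !addr0. Qed.
Lemma jder1 : d 1 = 0.
Proof.
have := jderM 1 1; rewrite mulr1 rmorph1 !mul1r => /eqP.
by rewrite -subr_eq subrr eq_sym => /eqP.
Qed.
Lemma jderN a : d (- a) = - d a.
Proof. by apply: (addrI (d a)); rewrite -jderD !subrr jder0. Qed.
Lemma jderB a b : d (a - b) = d a - d b.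
Proof. by rewrite jderD jderN. Qed.
Lemma jderXn a n : d (a ^+ n) = n%:R * j a ^+ n.-1 * d a.
Proof.
elim: n => [|[|n] IH]; first by rewrite expr0 jder1 !mul0r.
  by rewrite expr1 expr0 !mul1r.
rewrite exprS jderM IH /= rmorphXn [n.+2%:R]mulrS exprS.
ring.
Qed.
Lemma jderV a : d a^-1 = - (j a) ^- 2 * d a.
Proof.
have [->|a0] := eqVneq a 0; first by rewrite invr0 jder0 mulr0.
have ja0 : j a != 0 by rewrite fmorph_eq0.
have := jderM a a^-1; rewrite mulfV // jder1 fmorphV => /esym/eqP.
rewrite addr_eq0 => /eqP h; apply: (mulfI ja0); rewrite h.
by field.
Qed.
Lemma jder_pX p a : p \in [pchar F] -> d (a ^+ p) = 0.
Proof. by move=> hp; rewrite jderXn pcharf0 // !mul0r. Qed.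

End Derivations.

Section Frobenius.
Variables (F : fieldType) (p : nat).
Hypothesis hp : p \in [pchar F].
Lemma exprDp (x y : F) : (x + y) ^+ p = x ^+ p + y ^+ p.
Proof. by have := pFrobenius_autD_comm hp (mulrC x y); rewrite !pFrobenius_autE. Qed.
Lemma exprBp (x y : F) : (x - y) ^+ p = x ^+ p - y ^+ p.
Proof. by have := pFrobenius_autB_comm hp (mulrC x y); rewrite !pFrobenius_autE. Qed.
Lemma pchar_gt0 : (0 < p)%N. Proof. exact: prime_gt0 (pcharf_prime hp). Qed.
End Frobenius.

Lemma closed_root (k : closedFieldType) n (c : k) : (0 < n)%N -> exists b, b ^+ n = c.
Proof.
move=> n0; have /closed_rootP [b] : size ('X^n - c%:P : {poly k}) != 1%N.
  by rewrite size_XnsubC // eqSS -lt0n.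
by rewrite rootE !hornerE subr_eq0 => /eqP; exists b.
Qed.

(** * Orders of differential forms *)

Section Forms.
Variables (F : fieldType) (V : lmodType F) (W : set F).

Lemma span_min (S : set V) (B : set V) :
  B 0 -> (forall x y, B x -> B y -> B (x - y)) ->
  (forall r v, W r -> S v -> B (r *: v)) -> Defs.span W S `<=` B.
Proof.
move=> B0 BB hB x; apply; split; last by move=> _ [r Wr [v Sv <-]]; exact: hB.
by split=> [|x' y]; rewrite ?in_setE //; exact: BB.
Qed.

Lemma span_gen (S : set V) r v : W r -> S v -> Defs.span W S (r *: v).
Proof. by move=> Wr Sv B [_]; apply; exists r => //; exists v. Qed.

Lemma span0 (S : set V) : Defs.span W S 0.
Proof. by move=> B [[B0 BB] hB]; rewrite in_setE in B0. Qed.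

Lemma ord_form_gen (w0 : V) (c g : F) : dvr W -> w0 != 0 -> c != 0 -> g != 0 ->
  ord_form W [set q *: w0 | q in [set q * g | q in W]] (c *: w0) = ord W c - ord W g.
Proof.
move=> dW w00 c0 g0; have hW := dvr_subr dW.
have inj a b : a *: w0 = b *: w0 -> a = b.
  move=> /eqP; rewrite -subr_eq0 -scalerBl scaler_eq0 (negPf w00) orbF subr_eq0.
  by move/eqP.
have espan : Defs.span W [set c *: w0] = [set (q * c) *: w0 | q in W].
  apply/seteqP; split.
    apply: span_min.
    - by exists 0; [exact: subr0'|rewrite mul0r scale0r].
    - move=> _ _ [q Wq <-] [r Wr <-]; exists (q - r); first exact: subrB'.
      by rewrite mulrBl scalerBl.
    - by move=> r _ Wr ->; exists r => //; rewrite scalerA.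
  by move=> _ [q Wq <-]; rewrite -scalerA; exact: span_gen.
apply: xget_unique.
  exists (c / g); split; first by rewrite mulf_neq0 ?invr_eq0.
    rewrite espan; apply/seteqP; split.
      move=> _ [q Wq <-]; exists ((q * g) *: w0); first by exists (q * g) => //; exists q.
      by rewrite scalerA; congr (_ *: _); field.
    move=> _ [_ [_ [q Wq <-] <-] <-]; exists q => //; rewrite scalerA; congr (_ *: _).
    by field.
  by rewrite ordM ?invr_eq0 // ordV.
move=> n [h [h0 e ->]].
have e2 : [set (q * c) *: w0 | q in W] = [set (q * (h * g)) *: w0 | q in W].
  rewrite -espan e; apply/seteqP; split.
    by move=> _ [_ [_ [q Wq <-] <-] <-]; exists q => //; rewrite scalerA mulrCA.
  move=> _ [q Wq <-]; exists ((q * g) *: w0); first by exists (q * g) => //; exists q.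
  by rewrite scalerA mulrCA.
have [q Wq /inj eq_] : [set (q * (h * g)) *: w0 | q in W] (c *: w0).
  by rewrite -e2; exists 1; [exact: subr1|rewrite mul1r].
have [r Wr /inj er] : [set (q * c) *: w0 | q in W] ((h * g) *: w0).
  by rewrite e2; exists 1; [exact: subr1|rewrite mul1r].
have hg0 : h * g != 0 by rewrite mulf_neq0.
have uq : unit_in W q.
  have q0 : q != 0 by apply: contraNneq c0 => q0; rewrite -eq_ q0 mul0r.
  split=> //; have -> : q^-1 = r; last by [].
  by apply: (mulfI q0); rewrite mulfV //; apply: (mulIf hg0); rewrite mul1r mulrAC -mulrA (mulrC _ r) mulrCA eq_ er.
have [_ ou] := (ord_unit _ dW).1 uq.
have q0 : q != 0 by case: uq.
by have := ordM dW q0 hg0; rewrite eq_ ou ordM //; lia.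
Qed.

(** No multiple of [L] by a nonzero factor is spanned by 0, so the default value of [xget] is
    returned. The order of the zero form is thus 0, not infinity. *)
Lemma ord_form_zero (L : set V) : (exists2 v, L v & v != 0) -> ord_form W L 0 = 0.
Proof.
move=> [v Lv v0]; apply: xgetPN => n [g [g0 e _]].
have : Defs.span W [set 0] (g *: v) by rewrite e; exists v.
have sub : Defs.span W [set (0 : V)] `<=` [set 0].
  by apply: span_min => // [x y -> ->|r u _ ->]; rewrite ?subr0 ?scaler0.
by move/sub => /eqP; rewrite scaler_eq0 (negPf g0) (negPf v0).
Qed.
End Forms.

Section CurveDerivations.
Variables (k : closedFieldType) (K : fieldType) (iota : {rmorphism k -> K}).
Variable C : set (set K).
Hypothesis hC : smooth_projective_curve (range iota) C.
Notation k0 := (range iota).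

Lemma pchar_K p : p \in [pchar k] -> p \in [pchar K].
Proof. exact: rmorph_pchar. Qed.

(** The differentials of the chart coordinates generate all dh over [Q]. A coordinate is a constant
    plus t b, because the residue field is k; its differential is b dt + t db, and Nakayama's lemma
    leaves dt as the only generator. *)
Lemma der_local (F : fieldType) (j : {rmorphism K -> F}) (d : K -> F) Q t :
  jder j k0 d -> C Q -> uniformizer Q t -> forall h, Q h -> exists2 q, Q q & d h = j q * d t.
Proof.
move=> hd CQ ht; have dQ : dvr Q by exists t.
have hQ := C_subr hC CQ.
have [n [f eC]] := C_proj hC; move: (CQ); rewrite eC => /proj_modelP [i [fi0 [lQ chQ hfr]]].
pose jQ := j @` Q; have hjQ : subr jQ.
  split; first by exists 1; [exact: subr1|rewrite rmorph1].
  - by move=> _ _ [a Qa <-] [b Qb <-]; exists (a - b); rewrite ?rmorphB //; exact: subrB'.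
  - by move=> _ _ [a Qa <-] [b Qb <-]; exists (a * b); rewrite ?rmorphM //; exact: subrM'.
have jQi x : Q x -> jQ (j x) by exists x.
pose s := [seq d (f l / f i) | l <- enum 'I_n.+1].
have hs l : d (f l / f i) \in s by apply: map_f; rewrite mem_enum.
have chs : forall h, chart k0 (range f) (f i) h -> Q h /\ lincomb jQ s (d h).
  apply: gen_min.
    split; first by split; [exact: subr1|rewrite (jder1 hd); exact: lincomb0].
    - move=> a b [Qa ha] [Qb hb]; split; first exact: subrB'.
      rewrite (jderB hd) -mulN1r; apply: (lincombD hjQ) => //; apply: (lincombZ hjQ) => //.
      by rewrite -[1](rmorph1 j) -rmorphN; apply: jQi; apply: subrN' => //; exact: subr1.
    - move=> a b [Qa ha] [Qb hb]; split; first exact: subrM'.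
      by rewrite (jderM hd); apply: (lincombD hjQ); apply: (lincombZ hjQ) => //; exact: jQi.
  move=> x [kx|[_ [l _ <-] <-]].
    split; first exact: (C_k0 hC CQ).
    by case: (hd) => _ _ ->; [exact: lincomb0|].
  split; first by apply: chQ; apply: chart_mem; exists l.
  exact: lincomb_mem.
have Qs h : Q h -> lincomb jQ s (d h).
  move=> /hfr [a [b [/chs [Qa ha] /chs [Qb hb] [b0 _ Qb'] ->]]].
  rewrite (jderM hd) (jderV hd); apply: (lincombD hjQ); last first.
    by apply: (lincombZ hjQ) => //; exact: jQi.
  rewrite mulrA; apply: (lincombZ hjQ) => //.
  rewrite -rmorphXn -fmorphV -rmorphN -rmorphM; apply: jQi.
  apply: subrM' => //; apply: subrN' => //; rewrite -exprVn; exact: subrX'.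
have sM x : x \in s -> exists2 q, Q q & x = j q * d t.
  apply: (@nakayama _ jQ hjQ (j t) [set x | exists2 q, Q q & x = j q * d t]).
  - move=> _ [q Qq <-].
    have [h1 h2] : 1 + (- (t * q)) != 0 /\ ord Q (1 + - (t * q)) = ord Q 1.
      apply: ordD_lt => //; rewrite ?oner_neq0 // ord_one //; apply: ordgeN => //.
      have qq := (ordge0P q dQ).2 Qq.
      have tt : ordge Q 1 t by right; rewrite (ord_unif ht).
      by have := ordgeM dQ tt qq; rewrite add0r addr0.
    have [u1 u2 u3] : unit_in Q (1 - t * q) by apply/(ord_unit _ dQ); rewrite h2 ord_one.
    have -> : 1 - j t * j q = j (1 - t * q) by rewrite rmorphB rmorph1 rmorphM.
    by split; rewrite ?fmorph_eq0 // -?fmorphV; exact: jQi.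
  - by exists 0; [exact: subr0'|rewrite rmorph0 mul0r].
  - move=> _ _ [a Qa ->] [b Qb ->]; exists (a + b); first exact: subrD'.
    by rewrite rmorphD mulrDl.
  - move=> _ _ [a Qa <-] [b Qb ->]; exists (a * b); first exact: subrM'.
    by rewrite rmorphM mulrA.
  - by apply: jQi; case: ht.
  - move=> _ /mapP [l _ ->].
    have Qa : Q (f l / f i) by apply: chQ; apply: chart_mem; exists l.
    have [c /(ordgeP _ _ ht) hc] := residue hC CQ dQ Qa.
    rewrite exprN1 in hc.
    set b := (_ * t^-1) in hc; exists (j b * d t), (d b); split; [by exists b|exact: Qs|].
    have -> : f l / f i = iota c + t * b by rewrite /b [t * _]mulrC divfK ?(unif_neq0 ht) // addrC subrK.
    rewrite (jderD hd) (jderM hd); case: (hd) => _ _ ->; last exact: const_mem.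
    by rewrite add0r addrC.
move=> h /Qs; apply: (lincomb_closed (M := [set x | exists2 q, Q q & x = j q * d t])).
- by exists 0; [exact: subr0'|rewrite rmorph0 mul0r].
- move=> _ _ [a Qa ->] [b Qb ->]; exists (a + b); first exact: subrD'.
  by rewrite rmorphD mulrDl.
- move=> _ _ [a Qa <-] [b Qb ->]; exists (a * b); first exact: subrM'.
  by rewrite rmorphM mulrA.
- exact: sM.
Qed.

Lemma frac_point Q h : C Q -> dvr Q -> exists a b, [/\ Q a, Q b, b != 0 & h = a / b].
Proof.
move=> CQ dQ; have hQ := C_subr hC CQ; have [Qh|Qh] := (dvr_valring dQ).2 h.
  by exists h, 1; rewrite divr1 oner_neq0; split=> //; exact: subr1.
have [->|h0] := eqVneq h 0.
  by exists 0, 1; rewrite mul0r oner_neq0; split=> //; [exact: subr0'|exact: subr1].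
by exists 1, h^-1; rewrite invr_eq0 div1r invrK; split=> //; exact: subr1.
Qed.

Lemma der_zero (F : fieldType) (j : {rmorphism K -> F}) (d : K -> F) Q t :
  jder j k0 d -> C Q -> uniformizer Q t -> d t = 0 -> forall h, d h = 0.
Proof.
move=> hd CQ ht dt0 h; have [||a [b [Qa Qb b0 ->]]] := @frac_point Q h => //; first by exists t.
have [q _ ea] := der_local hd CQ ht Qa; have [r _ eb] := der_local hd CQ ht Qb.
by rewrite (jderM hd) (jderV hd) ea eb dt0 !mulr0 addr0.
Qed.

(** Derivations of [K] into [F] form a space of dimension at most one: the difference of [d] and a
    suitable multiple of [D] kills a uniformizer, hence vanishes by [der_zero]. *)
Lemma der_comp (F : fieldType) (j : {rmorphism K -> F}) (d : K -> F) (D : K -> K) f :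
  jder j k0 d -> jder idfun k0 D -> D f != 0 -> forall h, d h = d f / j (D f) * j (D h).
Proof.
move=> hd hD Df0; have [_ [Q [CQ [t ht]]] _] := hC.
have Dt0 : D t != 0.
  by apply: contraNneq Df0 => Dt; rewrite (der_zero hD CQ ht Dt).
have jDt0 : j (D t) != 0 by rewrite fmorph_eq0.
have jDf0 : j (D f) != 0 by rewrite fmorph_eq0.
have h1 : jder j k0 (fun h => d h - d t / j (D t) * j (D h)).
  case: (hd) => d1 d2 d3; case: (hD) => D1 D2 D3; split.
  - by move=> a b; rewrite d1 D1 rmorphD; ring.
  - by move=> a b; rewrite d2 D2 /= rmorphD !rmorphM; ring.
  - by move=> c kc; rewrite d3 // (D3 c) // rmorph0 mulr0 subr0.
have e h : d h = d t / j (D t) * j (D h).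
  have := der_zero h1 CQ ht; rewrite divfK // subrr => /(_ erefl h) /eqP.
  by rewrite subr_eq0 => /eqP.
by move=> h; rewrite e [d f]e; field; rewrite jDt0 jDf0.
Qed.

(** If all derivations were zero, every form would be zero. Then [w ord0 = 0], and the coefficients
    of the form 0 in terms of the [w i] would not be unique. *)
Lemma exists_der g : has_genus k0 C g -> (1 <= g)%N ->
  exists (D : K -> K) a, jder idfun k0 D /\ D a != 0.
Proof.
case: g => // g [w [hw huniq]] _.
apply: contrapT => hn.
have d0 (d : der k0) a : sval d a = 0.
  apply: contrapT => /eqP h; apply: hn; exists (sval d), a; split=> //.
  by case: (svalP d) => h1 h2 h3; split=> // b c; rewrite h2 mulrC [c * _]mulrC.
have w0 : w ord0 = 0.
  have := hw ord0 _ (C_generic hC); rewrite /Omega1.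
  have : Defs.span [set: K] [set diff a | a in [set: K]] `<=` [set (0 : der k0 -> K^o)].
    apply: span_min => // [x y -> ->|r v _ [a _ <-]]; rewrite ?subr0 //.
    by rewrite (_ : diff a = 0) ?scaler0 //; apply/funext => d; exact: d0.
  by move=> /[apply].
have g0 : global_form C (0 : der k0 -> K^o) by move=> Q _; exact: span0.
have [c [[hc ec] uc]] := huniq _ g0.
have k00 : k0 0 by exists 0 => //; rewrite rmorph0.
have k01 : k0 1 by exists 1 => //; rewrite rmorph1.
have e1 := uc [ffun => 0]; have e2 := uc [ffun i => if i == ord0 then 1 else 0].
have : c = [ffun => 0].
  by apply: e1; split=> [i|]; rewrite ?ffunE // big1 // => i _; rewrite ffunE scale0r.
have -> : c = [ffun i => if i == ord0 then 1 else 0].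
  apply: e2; split=> [i|]; first by rewrite ffunE; case: ifP.
  rewrite big1 // => i _; rewrite ffunE; case: eqP => [->|_]; last by rewrite scale0r.
  by rewrite w0 scaler0.
by move/ffunP/(_ ord0); rewrite !ffunE eqxx => /eqP; rewrite oner_eq0.
Qed.

End CurveDerivations.

(** * Separation of points; zeros and poles are finite in number *)

Section CurveForms.
Variables (k : closedFieldType) (K : fieldType) (iota : {rmorphism k -> K}).
Variable C : set (set K).
Hypothesis hC : smooth_projective_curve (range iota) C.
Notation k0 := (range iota).

Lemma der_diff (D : K -> K) (t : K) : jder idfun k0 D -> D t != 0 ->
  forall a, diff a = (D a / D t) *: (diff t : der k0 -> K^o).
Proof.
move=> hD Dt0 a; apply/funext => d /=.
have hd : jder idfun k0 (sval d).
  by case: (svalP d) => h1 h2 h3; split=> // b c; rewrite h2 mulrC [c * _]mulrC.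
rewrite /diff (der_comp hC hd hD Dt0) /= -[RHS]/((D a / D t) * sval d t).
by field.
Qed.

Lemma diff_neq0 (D : K -> K) (t : K) : jder idfun k0 D -> D t != 0 ->
  (diff t : der k0 -> K^o) != 0.
Proof.
move=> [h1 h2 h3] Dt0; have hd : derivation k0 D.
  by split=> // b c; rewrite h2 /= mulrC [c * _]mulrC.
apply/eqP => /(congr1 (fun w => w (exist _ D hd))) /= e.
by move/eqP: Dt0; apply; exact: e.
Qed.

Lemma Omega1E (D : K -> K) Q t : jder idfun k0 D -> D t != 0 -> C Q -> uniformizer Q t ->
  Omega1 Q = [set q *: (diff t : der k0 -> K^o) | q in [set q * 1 | q in Q]].
Proof.
move=> hD Dt0 CQ ht; have hQ := C_subr hC CQ; apply/seteqP; split.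
  apply: span_min.
  - by exists 0; [exists 0; rewrite ?mul0r //; exact: subr0'|rewrite scale0r].
  - move=> _ _ [_ [q Qq <-] <-] [_ [r Qr <-] <-]; exists ((q - r) * 1); last by rewrite !mulr1 scalerBl.
    by exists (q - r) => //; exact: subrB'.
  - move=> r _ Qr [a Qa <-]; rewrite (der_diff hD Dt0 a) scalerA.
    have [q Qq eq_] := der_local hC hD CQ ht Qa.
    exists (r * q * 1); first by exists (r * q) => //; exact: subrM'.
    by rewrite mulr1 eq_ /= mulfK.
move=> _ [_ [q Qq <-] <-]; rewrite mulr1; apply: span_gen => //; exists t => //.
by case: ht.
Qed.

Lemma ord_dform (D : K -> K) Q t h : jder idfun k0 D -> D t != 0 -> C Q -> uniformizer Q t ->
  ord_form Q (Omega1 Q) (diff h : der k0 -> K^o) = ord Q (D h / D t).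
Proof.
move=> hD Dt0 CQ ht; have dQ : dvr Q by exists t.
have w0 := diff_neq0 hD Dt0.
have [Dh0|Dh0] := eqVneq (D h) 0.
  rewrite (der_diff hD Dt0 h) Dh0 mul0r scale0r ord_zero; apply: ord_form_zero.
  exists (diff t) => //; rewrite (Omega1E hD Dt0 CQ ht) -[X in _ X]scale1r; exists 1 => //.
  by exists 1; [exact: subr1 (dvr_subr dQ)|rewrite mulr1].
rewrite (Omega1E hD Dt0 CQ ht) (der_diff hD Dt0 h) ord_form_gen ?oner_neq0 //.
  by rewrite ord_one // subr0.
by rewrite mulf_neq0 ?invr_eq0.
Qed.

Definition nonunit (Q : set K) x := Q x /\ ~ unit_in Q x.

Lemma nonunitD Q x y : islocal Q -> nonunit Q x -> nonunit Q y -> nonunit Q (x + y).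
Proof.
move=> [hQ hl] [Qx nx] [Qy ny]; split; first exact: subrD'.
by move/(hl _ _ Qx Qy) => [].
Qed.

Lemma nonunitM Q a x : islocal Q -> Q a -> nonunit Q x -> nonunit Q (a * x).
Proof.
move=> [hQ hl] Qa [Qx nx]; split; first exact: subrM'.
by rewrite mulrC => /(unitMl hQ Qx Qa).
Qed.

Lemma nonunitP Q x : dvr Q -> nonunit Q x <-> ordge Q 1 x.
Proof.
move=> dQ; split.
  move=> [Qx nx]; have [->|x0] := eqVneq x 0; first by left.
  right; rewrite -gtz0_ge1 lt_neqAle (ord_ge0 dQ x0).1 // andbT; apply/eqP => h.
  by apply: nx; apply/(ord_unit _ dQ).
move=> [->|h]; first by split; [exact: subr0' (dvr_subr dQ)|case; rewrite eqxx].
split; last by move/(ord_unit _ dQ) => [_ e]; rewrite e in h.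
have [->|x0] := eqVneq x 0; first exact: subr0' (dvr_subr dQ).
by rewrite (ord_ge0 dQ) //; lia.
Qed.

Lemma const_unit c : c != 0 -> unit_in k0 (iota c).
Proof.
move=> c0; split; [by rewrite fmorph_eq0|exact: const_mem|by rewrite -fmorphV; exact: const_mem].
Qed.

(** Used with [N] the common non-units of two points, to separate them, and with [N] the square of a
    maximal ideal, to find a parameter among the coordinates. *)
Lemma coordinates_span n (f : 'I_n.+1 -> K) i (N : set K) (c : 'I_n.+1 -> k) :
  (forall l, N (f l / f i - iota (c l))) ->
  N 0 -> (forall x y, N x -> N y -> N (x + y)) ->
  (forall a x, chart k0 (range f) (f i) a -> N x -> N (a * x)) ->
  forall a, chart k0 (range f) (f i) a -> exists e, N (a - iota e).
Proof.
move=> hN N0 ND NM; set A := chart _ _ _.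
have hA : subr A by exact: chart_subr.
have Ac e : A (iota e) by apply: chart_k0; exact: const_mem.
have A1 : A (-1) by exact: (subrN' hA (subr1 hA)).
suff h : forall a, A a -> A a /\ exists e, N (a - iota e) by move=> a /h [].
apply: gen_min.
  split.
  - by split; [exact: (subr1 hA)|exists 1; rewrite rmorph1 subrr].
  - move=> a b [Aa [e he]] [Ab [e' he']]; split; first exact: (subrB' hA).
    exists (e - e'); rewrite rmorphB.
    have -> : a - b - (iota e - iota e') = (a - iota e) + (-1) * (b - iota e') by ring.
    exact: (ND _ _ he (NM _ _ A1 he')).
  - move=> a b [Aa [e he]] [Ab [e' he']]; split; first exact: (subrM' hA).
    exists (e * e'); rewrite rmorphM.
    have -> : a * b - iota e * iota e' = a * (b - iota e') + iota e' * (a - iota e) by ring.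
    exact: (ND _ _ (NM _ _ Aa he') (NM _ _ (Ac _) he)).
move=> x [[e _ <-]|[_ [l _ <-] <-]]; first by split=> //; exists e; rewrite subrr.
by split; [apply: chart_mem; exists l|exists (c l)].
Qed.

(** Otherwise every chart function is congruent to one and the same constant at both points. A chart
    function that is a unit at [Q'] then has a nonzero constant and is a unit at [Q], so [Q'] lies
    in [Q]. *)
Lemma separate n (f : 'I_n.+1 -> K) i c Q Q' : C Q -> dvr Q -> C Q' -> Q' <> Q ->
  locz (chart k0 (range f) (f i)) Q -> locz (chart k0 (range f) (f i)) Q' ->
  (forall l, ordge Q 1 (f l / f i - iota (c l))) ->
  exists l, unit_in Q' (f l / f i - iota (c l)).
Proof.
move=> CQ dQ CQ' nQ [lQ AQ _] [lQ' AQ' hfr'] hc; apply: contrapT => hn; apply: nQ.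
have hQ := C_subr hC CQ; have hQ' := C_subr hC CQ'.
symmetry; apply: (C_sub hC) => //; last exact: dvr_neqT.
have key a : chart k0 (range f) (f i) a -> unit_in Q' a -> unit_in Q a.
  move=> Aa ua.
  have NN : forall l, nonunit Q (f l / f i - iota (c l)) /\ nonunit Q' (f l / f i - iota (c l)).
    move=> l; split; first exact/(nonunitP _ dQ).
    split; last by move=> h; apply: hn; exists l.
    apply: subrB' => //; first by apply: AQ'; apply: chart_mem; exists l.
    by apply: (C_k0 hC CQ'); exact: const_mem.
  have N0 (R : set K) : subr R -> nonunit R 0.
    by move=> hR; split; [exact: subr0'|case; rewrite eqxx].
  have [e [h h']] : exists e, nonunit Q (a - iota e) /\ nonunit Q' (a - iota e).
    apply: (coordinates_span (N := [set x | nonunit Q x /\ nonunit Q' x]) NN) Aa.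
    - by split; exact: N0.
    - by move=> x y [h1 h2] [h3 h4]; split; exact: nonunitD.
    - by move=> b x Ab [h1 h2]; split; apply: nonunitM => //; [exact: AQ|exact: AQ'].
  have e0 : e != 0.
    by apply/eqP => e0; case: h' => _; rewrite e0 rmorph0 subr0.
  have ue : unit_in Q (iota e) by apply: unit_sub (const_unit e0); exact: C_k0 hC _ CQ.
  have u : unit_in Q (a + - (a - iota e)) by rewrite opprB addrC subrK.
  case: (lQ.2 _ _ (AQ _ Aa) (subrN' hQ h.1) u) => // /(unitN hQ).
  by rewrite opprK => /h.2.
move=> x /hfr' [a [b [Aa Ab ub ->]]]; apply: subrM' => //; first exact: AQ.
by case: (key b Ab ub).
Qed.

Lemma residues n (f : 'I_n.+1 -> K) i Q : C Q -> dvr Q ->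
  chart k0 (range f) (f i) `<=` Q -> exists c, forall l, ordge Q 1 (f l / f i - iota (c l)).
Proof.
move=> CQ dQ AQ; have h l : exists e, ordge Q 1 (f l / f i - iota e).
  by apply: (residue hC) => //; apply: AQ; apply: chart_mem; exists l.
by have [c hc] := choice h; exists c.
Qed.

Lemma chart_unif n (f : 'I_n.+1 -> K) i Q : dvr Q -> locz (chart k0 (range f) (f i)) Q ->
  exists2 t, chart k0 (range f) (f i) t & uniformizer Q t.
Proof.
move=> dQ [_ AQ hfr]; have [t ht] := dQ.
have Qt : Q t by case: ht.
have [a [b [Aa Ab ub e]]] := hfr _ Qt; exists a => //.
have t0 := unif_neq0 ht.
have b0 : b != 0 by case: ub.
have ea : a = t * b by rewrite e divfK.
apply: unif_ord => //; first by rewrite ea mulf_neq0.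
by rewrite ea ordM // (ord_unif ht) ((ord_unit _ dQ).1 ub).2.
Qed.

(** At [Q] each coordinate minus its value is divisible by [t], up to a denominator [(gb l).2]; at
    another point of the chart one of these differences is a unit. Where the product of the
    denominators is a unit, [t] therefore vanishes at most at [Q]. *)
Lemma local_parameter n (f : 'I_n.+1 -> K) i Q t : C Q -> uniformizer Q t ->
  locz (chart k0 (range f) (f i)) Q -> chart k0 (range f) (f i) t ->
  exists b, [/\ chart k0 (range f) (f i) b, unit_in Q b
    & forall Q', C Q' -> locz (chart k0 (range f) (f i)) Q' -> Q' <> Q -> Q' (b / t)].
Proof.
move=> CQ ht hl At; have dQ : dvr Q by exists t.
case: (hl) => lQ AQ hfr; have hQ := C_subr hC CQ; have hA := @chart_subr _ k0 (range f) (f i).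
have [c hc] := residues CQ dQ AQ.
pose x l := f l / f i - iota (c l).
have hx l : exists gb : K * K, [/\ chart k0 (range f) (f i) gb.1,
    chart k0 (range f) (f i) gb.2, unit_in Q gb.2 & x l / t = gb.1 / gb.2].
  have [|g [b [h1 h2 h3 h4]]] := hfr (x l / t); last by exists (g, b).
  by have := (ordgeP _ _ ht).1 (hc l); rewrite exprN1.
have [gb hgb] := choice hx.
exists (\prod_l (gb l).2); split.
- by apply: subr_prod => // l _; case: (hgb l).
- by apply: unit_prod => // l _; case: (hgb l).
move=> Q' CQ' hl' nQ; have [l ul] := separate CQ dQ CQ' nQ hl hl' hc.
have [h1 h2 [b0 _ _] h4] := hgb l; have hQ' := C_subr hC CQ'; case: (hl') => _ AQ' _.
have [x0 Qx Qx'] := ul; have t0 := unif_neq0 ht.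
rewrite (bigD1 l) //= -mulrA mulrCA.
have -> : (gb l).2 / t = (gb l).1 / (x l).
  apply: (mulIf x0); rewrite divfK // mulrAC -mulrA h4 mulrCA mulfV ?mulr1 //.
apply: subrM' => //; first by apply: AQ'; apply: subr_prod => // l' _; case: (hgb l').
by apply: subrM' => //; exact: AQ'.
Qed.

(** On each chart consider the functions whose nonvanishing locus contains only finitely many zeros
    and poles of [h]. They form an ideal, and by [ideal_unit] it is enough to find one such function
    that is a unit at the center of a given valuation ring. *)
Lemma finite_ord h : h != 0 -> finite_set [set Q | prime_divisor C Q /\ ord Q h <> 0].
Proof.
move=> h0; have [n [f eC]] := C_proj hC.
pose A i := chart k0 (range f) (f i).
have key i : f i != 0 -> finite_set [set Q | [/\ prime_divisor C Q, locz (A i) Q & ord Q h <> 0]].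
  move=> fi0; pose T b := [set Q | [/\ prime_divisor C Q, locz (A i) Q, unit_in Q b & ord Q h <> 0]].
  have hA : subr (A i) by exact: chart_subr.
  suff [_ h1] : [set b | A i b /\ finite_set (T b)] 1.
    apply: sub_finite_set h1 => Q [[CQ dQ] lQ oQ]; split=> //; exact: unit1 (dvr_subr dQ).
  apply: (@ideal_unit _ (A i)) => //.
    split.
    - by move=> b [].
    - split; first exact: (subr0' hA).
      by rewrite (_ : T 0 = set0) //; apply/seteqP; split=> // Q [_ _ [/eqP]].
    - move=> x y [Ax fx] [Ay fy]; split; first exact: (subrB' hA).
      have fu : finite_set (T x `|` T y) by rewrite finite_setU.
      apply: sub_finite_set fu => Q [pQ lQ u o].
      have [[hQ hloc] AQ _] := lQ.
      have [ux|uy] := hloc x (- y) (AQ _ Ax) (subrN' hQ (AQ _ Ay)) u; first by left.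
      by right; split=> //; have := unitN hQ uy; rewrite opprK.
    - move=> a x Aa [Ax fx]; split; first exact: (subrM' hA).
      apply: sub_finite_set fx => Q [pQ lQ u o]; split=> //.
      have [[hQ hloc] AQ _] := lQ; apply: (unitMl hQ (AQ _ Ax) (AQ _ Aa)).
      by rewrite mulrC.
  move=> V hV AV.
  have [hl hdom] := centerP hA (val_local hV) AV; set Q := center (A i) V in hl hdom.
  have CQ : C Q by rewrite eC; apply/proj_modelP; exists i.
  have [lQ AQ hfr] := hl; have hQ := local_subr lQ.
  have [eQ|dQ] := C_cases hC CQ.
    (* At the generic point [h] is a quotient of chart functions; where both are units [h] has order
       0, so no point remains. *)
    have [a [b [Aa Ab [b0 _ _] e]]] : exists a b, [/\ A i a, A i b, unit_in Q b & h = a / b].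
      by apply: hfr; rewrite eQ.
    have ab0 : a * b != 0.
      by rewrite mulf_neq0 //; apply: contraNneq h0 => a0; rewrite e a0 mul0r.
    exists (a * b); last first.
      split=> //; [by apply: AV; exact: (subrM' hA)|by apply: hdom.1; rewrite eQ].
    split; first exact: (subrM' hA).
    rewrite (_ : T (a * b) = set0) //; apply/seteqP; split=> // Q' [[CQ' dQ'] [[hQ' _] AQ' _] u o].
    apply: o.
    have ua := unitMl hQ' (AQ' _ Aa) (AQ' _ Ab) u.
    have ub := unitMr hQ' (AQ' _ Aa) (AQ' _ Ab) u.
    by have [_] := (ord_unit _ dQ').1 (unitM hQ' ua (unitV ub)); rewrite -e.
  (* At a closed point [h] is a unit times a power of [t]. Where that unit's numerator and
     denominator and the function from [local_parameter] do not vanish, only [Q] itself remains. *)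
  have [t At ht] := chart_unif dQ hl.
  have [b0 [Ab0 ub0 hb0]] := local_parameter CQ ht hl At.
  have [u [uu eh]] := ordP ht h0.
  have [g1 [g2 [Ag1 Ag2 ug2 eu]]] : exists a b, [/\ A i a, A i b, unit_in Q b & u = a / b].
    by apply: hfr; case: uu.
  have ug1 : unit_in Q g1.
    have -> : g1 = u * g2 by rewrite eu divfK //; case: ug2.
    exact: unitM.
  exists (b0 * (g1 * g2)); last first.
    apply: (unit_sub hdom.1); apply: unitM => //; exact: unitM.
  split; first exact: (subrM' hA Ab0 (subrM' hA Ag1 Ag2)).
  apply: sub_finite_set (finite_set1 Q) => Q' [[CQ' dQ'] hl' ub o] /=.
  apply: contrapT => nQ; apply: o.
  have Q'b := hb0 Q' CQ' hl' nQ; have [[hQ' _] AQ' _] := hl'.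
  have Qg : Q' (g1 * g2) by apply: subrM' => //; exact: AQ'.
  have vb0 := unitMl hQ' (AQ' _ Ab0) Qg ub.
  have vg := unitMr hQ' (AQ' _ Ab0) Qg ub.
  have vg1 := unitMl hQ' (AQ' _ Ag1) (AQ' _ Ag2) vg.
  have vg2 := unitMr hQ' (AQ' _ Ag1) (AQ' _ Ag2) vg.
  have vt : unit_in Q' t.
    apply: (unitMl hQ' (AQ' _ At) Q'b); rewrite mulrCA divff ?mulr1 //.
    exact: unif_neq0 ht.
  have [_ ot] := (ord_unit _ dQ').1 vt.
  have [u0 ou] := (ord_unit _ dQ').1 (unitM hQ' vg1 (unitV vg2)).
  rewrite -eu in u0 ou.
  have tn m : ord Q' (t ^ m) = 0.
    case: m => m; first by rewrite -exprnP ordX ?ot ?mulr0 //; exact: unif_neq0 ht.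
    by rewrite NegzE -exprnN ordV // ordX ?ot ?mulr0 ?oppr0 //; exact: unif_neq0 ht.
  rewrite eh ordM // ?ou ?tn ?addr0 //; exact: expfz_neq0 (unif_neq0 ht).
have : finite_set (\bigcup_(i in [set i | f i != 0])
   [set Q | [/\ prime_divisor C Q, locz (A i) Q & ord Q h <> 0]]).
  by apply: bigcup_finite => [|i /key//]; exact: finite_finset.
apply: sub_finite_set => Q [[CQ dQ] o].
have /proj_modelP [i [fi0 lQ]] : proj_model k0 f Q by rewrite -eC.
by exists i.
Qed.

End CurveForms.

(** * Hyperplane sections and functions with prescribed poles on the curve *)

Section Polarized.
Variables (k : closedFieldType) (K : fieldType) (iota : {rmorphism k -> K}).
Variable C : set (set K).
Hypothesis hC : smooth_projective_curve (range iota) C.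
Notation k0 := (range iota).

Lemma cancel_lead Q x y : prime_divisor C Q -> x != 0 -> y != 0 -> ord Q x = ord Q y ->
  exists c, ordge Q (ord Q x + 1) (x - iota c * y).
Proof.
move=> [CQ dQ] x0 y0 e.
have [|c hc] := residue hC (a := x / y) CQ dQ.
  by rewrite (ord_ge0 dQ) ?mulf_neq0 ?invr_eq0 // ordM ?invr_eq0 // ordV // e subrr.
exists c; have hy : ordge Q (ord Q x) y by right; rewrite e.
have := ordgeM dQ hc hy; rewrite mulrBl divfK // addrC; exact.
Qed.

Definition polar n (f : 'I_n.+1 -> K) (H : set K -> int) : Prop :=
  C = proj_model k0 f /\ forall Q, prime_divisor C Q ->
   (forall l, ordge Q (- H Q) (f l)) /\
   (exists i, [/\ f i != 0, ord Q (f i) = - H Q & locz (chart k0 (range f) (f i)) Q]).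

Lemma very_ample_polar H : very_ample k0 C H -> exists n (f : 'I_n.+1 -> K), polar f H.
Proof.
move=> [_ [n [f [eC hf]]]]; exists n, f; split=> // Q [CQ dQ].
have /proj_modelP [i [fi0 lQ]] : proj_model k0 f Q by rewrite -eC.
have hi : ord Q (f i) = - H Q.
  apply/eqP; rewrite -addr_eq0; apply/eqP; apply: (hf i fi0 Q) => //.
  rewrite /proj_chart; have -> : gen_ring (k0 `|` range (fun j => f j / f i)) = chart k0 (range f) (f i).
    rewrite /chart; congr (gen_ring (_ `|` _)); apply/seteqP; split.
      by move=> _ [j _ <-]; exists (f j) => //; exists j.
    by move=> _ [_ [j _ <-] <-]; exists j.
  by apply/SpecP => //; exact: chart_subr.
split; last by exists i.
move=> l; have [->|fl0] := eqVneq (f l) 0; first by left.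
right; case: lQ => _ AQ _; have : Q (f l / f i) by apply: AQ; apply: chart_mem; exists l.
rewrite (ord_ge0 dQ) ?mulf_neq0 ?invr_eq0 // ordM ?invr_eq0 // ordV //; lia.
Qed.

Section WithPolar.
Variables (n : nat) (f : 'I_n.+1 -> K) (H : set K -> int).
Hypothesis hf : polar f H.

Lemma polar_chart Q i : prime_divisor C Q -> f i != 0 -> ord Q (f i) = - H Q ->
  locz (chart k0 (range f) (f i)) Q.
Proof.
move=> pQ fi0 oi; have [h1 [i' [fi0' oi' hl]]] := hf.2 Q pQ; case: (pQ) => CQ dQ.
apply: locz_chart_change hl _ => //.
apply/(ord_unit _ dQ); split; first by rewrite mulf_neq0 ?invr_eq0.
by rewrite ordM ?invr_eq0 // ordV // oi oi' subrr.
Qed.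

(** The space H^0(C, O(d H)). *)
Definition sect (d : nat) x : Prop := forall Q, prime_divisor C Q -> ordge Q (- (d%:Z * H Q)) x.

Lemma sect1 : sect 0 1.
Proof. by move=> Q [_ dQ]; rewrite mul0r oppr0; right; rewrite ord_one. Qed.

Lemma sectM d e x y : sect d x -> sect e y -> sect (d + e) (x * y).
Proof.
move=> hx hy Q pQ; have := ordgeM pQ.2 (hx Q pQ) (hy Q pQ); congr ordge; lia.
Qed.

Lemma sectX d x e : sect d x -> sect (e * d) (x ^+ e).
Proof.
move=> hx; elim: e => [|e IH]; first by rewrite expr0; exact: sect1.
by rewrite exprS mulSn; exact: sectM.
Qed.

Lemma sect_f l : sect 1 (f l).
Proof. by move=> Q pQ; rewrite mul1r; exact: (hf.2 Q pQ).1. Qed.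

Lemma sect_lin l i c : sect 1 (f l - iota c * f i).
Proof.
move=> Q pQ; apply: (ordgeD pQ.2); first exact: sect_f.
apply: (ordgeN pQ.2); have := ordgeM (n := 0) (m := - (1%:Z * H Q)) (x := iota c) (y := f i) pQ.2.
rewrite add0r; apply; last exact: sect_f.
by apply/(ordge0P _ pQ.2); apply: (C_k0 hC pQ.1); exact: const_mem.
Qed.

(** The forms [f l - c l * f i], where [c l] is the value of [f l / f i] at [P], span the
    hyperplanes through [P]. They separate [P] from the other points, and one of them has a simple
    zero at [P]. *)
Lemma hyperplanes P : prime_divisor C P -> exists Lam : 'I_n.+1 -> K,
  [/\ forall l, sect 1 (Lam l) /\ ordge P (1 - H P) (Lam l),
      forall Q, prime_divisor C Q -> Q <> P -> exists l, Lam l != 0 /\ ord Q (Lam l) = - H Q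
    & exists l, Lam l != 0 /\ ord P (Lam l) = 1 - H P].
Proof.
move=> pP; have [_ [i [fi0 oi hl]]] := hf.2 P pP; case: (pP) => CP dP.
have [lP AP hfr] := hl.
have [c hc] := residues hC CP dP AP.
have efi l : f l - iota (c l) * f i = (f l / f i - iota (c l)) * f i by rewrite mulrBl divfK.
exists (fun l => f l - iota (c l) * f i); split.
- move=> l; split; first exact: sect_lin.
  by rewrite efi; apply: ordgeM => //; right; rewrite oi.
- move=> Q pQ nQ; have [hQ [l [fl0 ol hlQ]]] := hf.2 Q pQ; case: (pQ) => CQ dQ.
  have [oiQ|noi] := eqVneq (ord Q (f i)) (- H Q).
    have hlQ' := polar_chart pQ fi0 oiQ.
    have [l' ul] := separate hC CP dP CQ nQ hl hlQ' hc; exists l'; rewrite efi.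
    have [u0 ou] := (ord_unit _ dQ).1 ul.
    by rewrite mulf_neq0 // ordM // ou oiQ add0r.
  exists l; have [|h1 h2] := @ordD_lt _ Q (f l) (- (iota (c l) * f i)) dQ fl0; last by rewrite h2.
  apply: (ordgeN dQ); have := ordgeM (n := 0) (m := ord Q (f l) + 1) (x := iota (c l)) (y := f i) dQ.
  rewrite add0r; apply.
    by apply/(ordge0P _ dQ); apply: (C_k0 hC CQ); exact: const_mem.
  right; case: (hQ i) => [/eqP|]; first by rewrite (negPf fi0).
  by move: noi; rewrite ol; move/eqP; lia.
(* If all vanished doubly, every chart function would be constant modulo the square of the maximal
   ideal, including the uniformizer that the chart contains. *)
- apply: contrapT => hn.
  have h2 l : ordge P 2 (f l / f i - iota (c l)).
    apply: contrapT => h; apply: hn; exists l; rewrite efi.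
    have x0 : f l / f i - iota (c l) != 0 by apply: contra_notN h => /eqP ->; left.
    rewrite mulf_neq0 // ordM // oi; split=> //; congr (_ - _).
    case: (hc l) => [/eqP|]; first by rewrite (negPf x0).
    move=> h1; have : ~ (2 <= ord P (f l / f i - iota (c l))) by move=> h'; apply: h; right.
    by lia.
  have [t At ht] := chart_unif dP hl.
  have [e he] : exists e, ordge P 2 (t - iota e).
    apply: (coordinates_span (N := [set x | ordge P 2 x]) h2) At => //.
    - by left.
    - by move=> x y; exact: ordgeD.
    - move=> a x Aa hx /=; have := ordgeM (n := 0) dP _ hx; rewrite add0r; apply.
      by apply/(ordge0P _ dP); exact: AP.
  have e0 : e = 0.
    apply/eqP; apply: contrapT => /negP e0; have ue := unit_sub (C_k0 hC CP) (const_unit iota e0).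
    have := (nonunitP (iota e) dP).2; case; last by move=> _; apply.
    have -> : iota e = t - (t - iota e) by rewrite opprB addrC subrK.
    apply: ordgeD => //; first by right; rewrite (ord_unif ht).
    by apply: ordgeN => //; apply: ordge_le he.
  move: he; rewrite e0 rmorph0 subr0 => -[/eqP|]; first by rewrite (negPf (unif_neq0 ht)).
  by rewrite (ord_unif ht).
Qed.

Lemma vanishing_section (S : seq (set K)) (Q : set K) (N : set K -> nat) :
  (forall P, P \in S -> prime_divisor C P /\ P <> Q) -> prime_divisor C Q ->
  exists x, [/\ x != 0, sect (\sum_(P <- S) N P) x,
    ord Q x = - ((\sum_(P <- S) N P)%N%:Z * H Q)
    & uniq S -> forall P, P \in S -> ordge P ((N P)%:Z - (\sum_(P <- S) N P)%N%:Z * H P) x].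
Proof.
move=> hS pQ; case: (pQ) => CQ dQ; elim: S hS => [|P S IH] hS.
  exists 1; rewrite big_nil oner_neq0 ord_one // mul0r; split=> //; exact: sect1.
have [|x [x0 sx ox vx]] := IH; first by move=> P' hP'; apply: hS; rewrite inE hP' orbT.
have [pP nP] := hS P (mem_head _ _).
have [Lam [h1 h2 _]] := hyperplanes pP; have [l [L0 oL]] := h2 Q pQ (nesym nP).
have [sL vL] := h1 l; rewrite big_cons.
have sLN : sect (N P) (Lam l ^+ N P) by have := sectX (N P) sL; rewrite muln1.
exists (Lam l ^+ N P * x); split.
- by rewrite mulf_neq0 // expf_neq0.
- exact: sectM.
- by rewrite ordM ?expf_neq0 // ordX // oL ox; lia.
- move=> /= /andP [nPS uS] P'; rewrite inE => /predU1P [->|hP'].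
    have := ordgeM pP.2 (ordgeX (N P) pP.2 vL) (sx P pP); congr ordge; lia.
  have pP' : prime_divisor C P' by have [] := hS P' (mem_behead (s := P :: S) hP').
  have := ordgeM pP'.2 (sLN P' pP') (vx uS P' hP'); congr ordge; lia.
Qed.

Lemma section_of_degree Q d : prime_divisor C Q ->
  exists x, [/\ x != 0, sect d x & ord Q x = - (d%:Z * H Q)].
Proof.
move=> pQ; have [_ [i [fi0 oi _]]] := hf.2 Q pQ; exists (f i ^+ d); split.
- by rewrite expf_neq0.
- by have := sectX d (sect_f i); rewrite muln1.
- by rewrite ordX ?oi //; [lia|case: pQ].
Qed.

Section Poles.
Variable Q : set K.
Hypothesis pQ : prime_divisor C Q.
Variable sigma : K.
Hypotheses (s0 : sigma != 0) (ssig : sect 1 sigma).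
Variable Z : seq (set K).
Hypothesis uZ : uniq Z.
Let dd (P : set K) : nat := `|(ord P sigma + H P)%R|%N.
Hypothesis hZ : forall P, P \in Z <-> prime_divisor C P /\ ord P sigma <> - H P.

Lemma ddE P : prime_divisor C P -> ord P sigma = (dd P)%:Z - H P.
Proof.
move=> pP; have := ssig pP; case=> [/eqP|]; first by rewrite (negPf s0).
by rewrite /dd; lia.
Qed.

Lemma dd0 P : prime_divisor C P -> P \notin Z -> dd P = 0%N.
Proof.
move=> pP /negP nZ; have h : ord P sigma = - H P.
  by apply: contrapT => h; apply: nZ; apply/hZ.
by rewrite /dd h addNr.
Qed.

Lemma dd_gt0 P : P \in Z -> (0 < dd P)%N.
Proof.
move=> /hZ [pP nP]; have := ddE pP; case: (posnP (dd P)) => // ->; by rewrite sub0r => /nP.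
Qed.

Let n0 := (\sum_(P <- Z) dd P)%N.

Lemma dd_le P : P \in Z -> (dd P <= n0)%N.
Proof.
by move=> hP; rewrite /n0 (perm_big _ (perm_to_rem hP)) big_cons leq_addr.
Qed.

(** The function is a form of degree [N] over [sigma ^+ N]. The form vanishes to order [e] at [P]
    and to order [dd P'] at each other zero of [sigma], which takes one multiple of [dd P'] off the
    pole there. *)
Lemma pole_block P e N : P \in Z -> (e + n0 <= N)%N -> (0 < N)%N ->
  exists x, [/\ x != 0, ord P x = e%:Z - N%:Z * (dd P)%:Z
    & forall P', prime_divisor C P' -> P' <> P -> ordge P' (- ((N.-1)%:Z * (dd P')%:Z)) x].
Proof.
move=> PZ le_eN N0; have [pP _] := (hZ P).1 PZ; case: (pP) => CP dP.
have [|y [y0 sy oy vy]] := @vanishing_section (rem P Z) P dd _ pP.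
  move=> P' hP'; have := mem_rem hP' => /hZ [pP' _]; split=> //.
  by move=> e'; move: hP'; rewrite e' mem_rem_uniqF.
have [Lam [h1 _ [l [L0 oL]]]] := hyperplanes pP.
have [sL _] := h1 l.
set r := (\sum_(P' <- rem P Z) dd P')%N in sy oy vy.
have rn0 : (dd P + r = n0)%N by rewrite /n0 (perm_big _ (perm_to_rem PZ)) big_cons.
have [w [w0 sw ow]] := section_of_degree (N - e - r) pP.
have st : sect N (Lam l ^+ e * y * w).
  have := sectM (sectM (sectX e sL) sy) sw; congr sect; lia.
have hN : N%:Z = e%:Z + r%:Z + (N - e - r)%N%:Z by lia.
have [t0 ot] : Lam l ^+ e * y * w != 0 /\ ord P (Lam l ^+ e * y * w) = e%:Z - N%:Z * H P.
  split; first by rewrite !mulf_neq0 ?expf_neq0.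
  rewrite hN !ordM ?mulf_neq0 ?expf_neq0 // ordX // oL oy ow; ring.
exists (Lam l ^+ e * y * w / sigma ^+ N); split.
- by rewrite mulf_neq0 // invr_eq0 expf_neq0.
- rewrite ordM ?invr_eq0 ?expf_neq0 // ordV // ordX // ot (ddE pP); ring.
- move=> P' pP' nP'; case: (pP') => CP' dP'.
  have os : ordge P' (- (N%:Z * ((dd P')%:Z - H P'))) (sigma ^+ N)^-1.
    by right; rewrite ordV // ordX // (ddE pP').
  have [hZ'|/(dd0 pP') d0] := boolP (P' \in Z); last first.
    have := ordgeM dP' (st P' pP') os; rewrite d0; apply: ordge_le; lia.
  have hP' : P' \in rem P Z by rewrite mem_rem_uniq // inE hZ' andbT; apply/eqP.
  have h2 : ordge P' ((dd P')%:Z - N%:Z * H P') (Lam l ^+ e * y * w).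
    have := ordgeM dP' (ordgeM dP' (sectX e sL pP') (vy (rem_uniq _ uZ) P' hP')) (sw P' pP').
    apply: ordge_le; rewrite hN muln1; clear; lia.
  have := ordgeM dP' h2 os; apply: ordge_le; clear -N0; nia.
Qed.

Let M := (2 * n0)%N.

(** Induction on [N]: a block has the required pole at [P], and its excess poles at the other zeros
    of [sigma] involve fewer multiples, so they are cancelled by functions from the induction
    hypothesis. [M = 2 * n0] gives the block room for [n0] at the other zeros and for e < [dd P] <=
    [n0] at [P]. *)
Lemma bounded_poles N P j : P \in Z -> (M * dd P < j)%N -> (j <= N * dd P)%N ->
  exists x, [/\ x != 0, ord P x = - j%:Z
    & forall P', prime_divisor C P' -> P' <> P -> ordge P' (- (M%:Z * (dd P')%:Z)) x].
Proof.
elim/ltn_ind: N P j => N IH P j PZ ltj lej.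
have [pP _] := (hZ P).1 PZ; case: (pP) => CP dP; have dP0 := dd_gt0 PZ; have dPn := dd_le PZ.
(* The quotient of [j] by [dd P] rounded up; the surplus [N' * dd P - j] becomes extra vanishing of
   the numerator at [P]. *)
pose N' := (j %/ dd P + (j %% dd P != 0))%N.
have hdiv := divn_eq j (dd P); have hmod := ltn_pmod j dP0.
have [N'1 N'2] : (j <= N' * dd P)%N /\ (N' * dd P < j + dd P)%N.
  by rewrite /N'; case: eqP => h; rewrite /= ?h ?addn0 ?addn1 ?mulSn in hdiv *; lia.
have N'N : (N' <= N)%N by rewrite -ltnS; nia.
have MN' : (M < N')%N by nia.
have [|//|x0 [x00 ox hx]] := @pole_block P (N' * dd P - j) N' PZ; first by rewrite /M in MN'; lia.
  by lia.
have {}ox : ord P x0 = - j%:Z by rewrite ox; lia.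
(* The pole at [P'] is lowered one order at a time by cancelling leading terms. The correction has
   only bounded poles at all other points, so the points can be treated in succession. *)
have reduce1 P' : P' \in Z -> forall (m : nat) y, (M * dd P' + m <= N'.-1 * dd P')%N ->
    ordge P' (- ((M * dd P' + m)%N%:Z)) y ->
    exists z, ordge P' (- (M%:Z * (dd P')%:Z)) (y - z) /\
      forall P'', prime_divisor C P'' -> P'' <> P' -> ordge P'' (- (M%:Z * (dd P'')%:Z)) z.
  move=> PZ'; have [pP' _] := (hZ P').1 PZ'; case: (pP') => CP' dP'.
  elim=> [|m IHm] y lem hy.
    exists 0; rewrite subr0; split; last by move=> *; left.
    by apply: ordge_le hy; lia.
  have [hy'|hy'] := pselect (ordge P' (- ((M * dd P' + m)%N%:Z)) y); first by apply: IHm => //; lia.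
  have y0 : y != 0 by apply: contra_notN hy' => /eqP ->; left.
  have oy : ord P' y = - (M * dd P' + m.+1)%N%:Z.
    case: hy => [/eqP|hy]; first by rewrite (negPf y0).
    have : ~ (- (M * dd P' + m)%N%:Z <= ord P' y) by move=> h; apply: hy'; right.
    by lia.
  have ltN : (N'.-1 < N)%N by lia.
  have [||w [w0 ow hw]] := IH _ ltN P' (M * dd P' + m.+1)%N PZ'; [lia|exact: lem|].
  have [c hc] := cancel_lead pP' y0 w0 (etrans oy (esym ow)).
  have [||z [hz1 hz2]] := IHm (y - iota c * w); first by lia.
    by apply: ordge_le hc; rewrite oy; lia.
  exists (iota c * w + z); split; first by rewrite opprD addrA.
  move=> P'' pP'' nP''; apply: ordgeD; [exact: pP''.2| |exact: hz2].
  have := ordgeM (n := 0) pP''.2 _ (hw P'' pP'' nP''); rewrite add0r; apply.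
  by apply/(ordge0P _ pP''.2); apply: (C_k0 hC pP''.1); exact: const_mem.
have reduce (S : seq (set K)) : {subset S <= Z} -> P \notin S ->
    exists z, [/\ ordge P (- (M%:Z * (dd P)%:Z)) z,
      forall P', prime_divisor C P' -> P' <> P -> ordge P' (- (N'.-1%:Z * (dd P')%:Z)) (x0 - z)
      & forall P', P' \in S -> ordge P' (- (M%:Z * (dd P')%:Z)) (x0 - z)].
  elim: S => [|P' S IHS] hS nPS.
    by exists 0; split=> //; [left|move=> P' pP' nP'; rewrite subr0; exact: hx].
  have [||z [z1 z2 z3]] := IHS.
  - by move=> P'' h; apply: hS; rewrite inE h orbT.
  - by move: nPS; rewrite inE negb_or => /andP [].
  have nP' : P' <> P by move=> e; move: nPS; rewrite e mem_head.
  have PZ' := hS P' (mem_head _ _); have [pP' _] := (hZ P').1 PZ'.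
  have MN1 : (M * dd P' <= N'.-1 * dd P')%N by rewrite leq_mul2r; lia.
  have [||u [u1 u2]] := reduce1 P' PZ' (N'.-1 * dd P' - M * dd P')%N (x0 - z).
  - by rewrite subnKC.
  - by rewrite subnKC //; have := z2 P' pP' nP'; congr ordge; lia.
  exists (z + u); rewrite opprD addrA; split.
  - by apply: (ordgeD dP) => //; exact: u2 (nesym nP').
  - move=> P'' pP'' nP''; have [->|ne] := eqVneq P'' P'.
      by apply: ordge_le u1; nia.
    apply: (ordgeD pP''.2); first exact: z2.
    apply: (ordgeN pP''.2); apply: ordge_le (u2 P'' pP'' _); last exact/eqP.
    by nia.
  - move=> P''; rewrite inE => /predU1P [->//|hP''].
    have [->|ne] := eqVneq P'' P'; first exact: u1.
    have [pP'' _] : prime_divisor C P'' /\ ord P'' sigma <> - H P''.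
      by apply/hZ; apply: hS; rewrite inE hP'' orbT.
    apply: (ordgeD pP''.2); first exact: z3.
    by apply: (ordgeN pP''.2); apply: u2 => //; apply/eqP.
have [||z [z1 z2 z3]] := reduce (rem P Z).
- by move=> P'; exact: mem_rem.
- by rewrite mem_rem_uniqF.
have [h1 h2] : x0 - z != 0 /\ ord P (x0 - z) = ord P x0.
  apply: ordD_lt => //; apply: ordgeN => //; apply: ordge_le z1; rewrite ox; lia.
exists (x0 - z); split; [exact: h1|by rewrite h2 ox|].
move=> P' pP' nP'; have [hZ'|nZ'] := boolP (P' \in Z).
  by apply: z3; rewrite mem_rem_uniq // inE hZ' andbT; apply/eqP.
by have := z2 P' pP' nP'; rewrite (dd0 pP' nZ') !mulr0.
Qed.
End Poles.

(** A hyperplane section through [Q] serves as [sigma]. The set [Z] and the bound on the other poles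
    are the same for all [j], which is what high multiples of an effective divisor require. *)
Lemma large_poles Q : prime_divisor C Q -> exists (Z : set (set K)) (N : nat),
  [/\ finite_set Z, Z `<=` prime_divisor C
    & forall j, (N < j)%N -> exists x, [/\ x != 0, ord Q x = - j%:Z,
       forall P, Z P -> P <> Q -> ordge P (- N%:Z) x
       & forall P, prime_divisor C P -> ~ Z P -> P <> Q -> ordge P 0 x]].
Proof.
move=> pQ; have [Lam [h1 _ [l [s0 os]]]] := hyperplanes pQ; have [ss _] := h1 l.
set sigma := Lam l in s0 os ss.
have fin : finite_set [set P | prime_divisor C P /\ ord P sigma <> - H P].
  have : finite_set (\bigcup_(i in [set i | f i != 0])
      [set P | prime_divisor C P /\ ord P (sigma / f i) <> 0]).
    apply: bigcup_finite => [|i /= fi0]; first exact: finite_finset.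
    by apply: (finite_ord hC); rewrite mulf_neq0 ?invr_eq0.
  apply: sub_finite_set => P [pP nP]; have [_ [i [fi0 oi _]]] := hf.2 P pP.
  exists i => //; split=> //; rewrite ordM ?invr_eq0 //; last by case: pP.
  by rewrite ordV ?oi; [lia|case: pP].
have /finite_seqP [Z0 eZ] := fin.
pose Z := undup Z0.
have uZ : uniq Z by exact: undup_uniq.
have hZ P : P \in Z <-> prime_divisor C P /\ ord P sigma <> - H P.
  rewrite mem_undup; split=> [h|h].
    have : [set` Z0] P by []. by rewrite -eZ.
  have : [set P | prime_divisor C P /\ ord P sigma <> - H P] P by []. by rewrite eZ.
have ZQ : Q \in Z by apply/hZ; split=> //; rewrite os; lia.
pose dd (P : set K) := `|(ord P sigma + H P)%R|%N.
pose n0 := (\sum_(P <- Z) dd P)%N.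
have le_d P : P \in Z -> (dd P <= n0)%N by exact: dd_le.
exists [set` Z], (2 * n0 * n0)%N; split.
- by apply/finite_seqP; exists Z.
- by move=> P /= /hZ [].
- move=> j ltj; have dQ0 : (0 < dd Q)%N by apply: dd_gt0 ZQ.
  have [||x [x0 ox hx]] := @bounded_poles sigma s0 ss Z uZ hZ j Q j ZQ.
  + by apply: leq_ltn_trans ltj; rewrite leq_mul2l le_d ?orbT.
  + by rewrite leq_pmulr.
  exists x; split=> //.
  + move=> P /= PZ nP; have [pP _] := (hZ P).1 PZ; apply: ordge_le (hx P pP nP).
    have := le_d P PZ; rewrite -/n0 -/(dd P); nia.
  + move=> P pP /= /negP nZ nP; have := hx P pP nP.
    by rewrite (dd0 (Z := Z)) // mulr0 oppr0.
Qed.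

End WithPolar.
End Polarized.

(** * Twisted ample sheaves on the curve and local p-th roots *)

Section SectionsOnCurve.
Variables (k : closedFieldType) (K : fieldType) (iota : {rmorphism k -> K}).
Variable C : set (set K).
Hypothesis hC : smooth_projective_curve (range iota) C.
Notation k0 := (range iota).

Section WithPolar.
Variables (n : nat) (f : 'I_n.+1 -> K) (H : set K -> int).
Hypothesis hf : polar iota C f H.
Notation sect := (sect C H).

(* Products of hyperplane sections. *)
Lemma vanishing_family (S : seq (set K)) (N d : nat) :
  (forall P, P \in S -> prime_divisor C P) -> uniq S -> (N * size S <= d)%N ->
  exists L : set K, [/\ finite_set L,
    forall x, L x -> [/\ x != 0, sect d x & forall P, P \in S -> ordge P (N%:Z - d%:Z * H P) x],
    exists x, L x
    & forall Q, prime_divisor C Q -> Q \notin S -> exists2 x, L x & ord Q x = - (d%:Z * H Q)].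
Proof.
move=> hS uS le_d.
have /choice [Lam hLam] : forall P, exists Lam : 'I_n.+1 -> K, P \in S ->
  [/\ forall l, sect 1 (Lam l) /\ ordge P (1 - H P) (Lam l),
      forall Q, prime_divisor C Q -> Q <> P -> exists l, Lam l != 0 /\ ord Q (Lam l) = - H Q
    & exists l, Lam l != 0 /\ ord P (Lam l) = 1 - H P].
  move=> P; have [hP|nP] := boolP (P \in S); last by exists (fun _ => 0).
  by have [Lam h] := hyperplanes hC hf (hS P hP); exists Lam.
pose pt (r : 'I_(size S)) := nth [set: K] S r.
have ptS r : pt r \in S by exact: mem_nth.
pose prd (c : {ffun 'I_(size S) -> 'I_n.+1}) (i : 'I_n.+1) : K :=
  (\prod_r Lam (pt r) (c r) ^+ N) * f i ^+ (d - N * size S).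
pose E (ci : {ffun 'I_(size S) -> 'I_n.+1} * 'I_n.+1) := prd ci.1 ci.2.
have sumc (a : int) : \sum_(r < size S) a = (size S)%:Z * a.
  by rewrite big_const_ord iter_addr_0 -mulr_natl natz.
have key (Q : set K) (c : {ffun 'I_(size S) -> 'I_n.+1}) (i : 'I_n.+1) (w : 'I_(size S) -> int) : prime_divisor C Q ->
    (forall r, ordge Q (w r) (Lam (pt r) (c r))) ->
    ordge Q (N%:Z * (\sum_r w r) - (d - N * size S)%N%:Z * H Q) (prd c i).
  move=> pQ hw; case: (pQ) => _ dQ.
  rewrite mulr_sumr -mulrN; apply: ordgeM => //.
    by apply: (@ordge_prod K Q _ _ xpredT (fun r => N%:Z * w r) (fun r => Lam (pt r) (c r) ^+ N) dQ) => r _; exact: ordgeX.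
  by apply: ordgeX => //; have := sect_f hf i pQ; rewrite mul1r.
exists (E @` [set ci | E ci != 0]); split.
- by apply: finite_image; exact: finite_finset.
- move=> _ [[c i] x0 <-]; split=> //.
    move=> Q pQ; have := @key Q c i (fun _ => - H Q) pQ; rewrite sumc => h.
    have : ordge Q (N%:Z * ((size S)%:Z * - H Q) - (d - N * size S)%N%:Z * H Q) (prd c i).
      by apply: h => r; have [h1 _ _] := hLam _ (ptS r); have := (h1 (c r)).1 Q pQ; rewrite mul1r.
    congr ordge; have -> : d%:Z = (N * size S)%N%:Z + (d - N * size S)%N%:Z by lia.
    by rewrite PoszM; ring.
  move=> P PS; have pP := hS P PS; case: (pP) => _ dP.
  have lt_r : (index P S < size S)%N by rewrite index_mem.
  pose r0 := Ordinal lt_r; have pt0 : pt r0 = P by rewrite /pt nth_index.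
  have := @key P c i (fun r => (r == r0)%:Z - H P) pP.
  have -> : \sum_r (((r == r0)%:Z - H P) : int) = 1 - (size S)%:Z * H P.
    rewrite sumrB sumc // (bigD1 r0) //= eqxx big1 ?addr0 // => r /negPf ->; by [].
  move=> h; have {}h := h _; suff : ordge P (N%:Z * (1 - (size S)%:Z * H P) - (d - N * size S)%N%:Z * H P) (prd c i).
    congr ordge; have -> : d%:Z = (N * size S)%N%:Z + (d - N * size S)%N%:Z by lia.
    by rewrite PoszM; ring.
  apply: h => r; have [h1 _ _] := hLam _ (ptS r); case: eqP => [er|_].
    by have := (h1 (c r)).2; rewrite er pt0.
  by rewrite sub0r; have := (h1 (c r)).1 P pP; rewrite mul1r.
- have hl r : exists l, Lam (pt r) l != 0.
    by have [_ _ [l [h _]]] := hLam _ (ptS r); exists l.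
  have [c hc] := choice hl.
  have [Q [CQ dQ]] : exists Q, prime_divisor C Q by case: hC.
  have [_ [i [fi0 _ _]]] := hf.2 Q (conj CQ dQ).
  exists (E (finfun c, i)), (finfun c, i) => //=.
  rewrite /E /prd /= mulf_neq0 ?expf_neq0 //; apply/prodf_neq0 => r _.
  by rewrite ffunE expf_neq0.
- move=> Q pQ nQ; case: (pQ) => CQ dQ.
  have hl r : exists l, Lam (pt r) l != 0 /\ ord Q (Lam (pt r) l) = - H Q.
    have [_ h _] := hLam _ (ptS r); apply: h => // e.
    by move: nQ; rewrite e ptS.
  have [c hc] := choice hl.
  have [_ [i [fi0 oi _]]] := hf.2 Q pQ.
  have p0 (P : pred 'I_(size S)) (r : seq 'I_(size S)) : \prod_(l <- r | P l) Lam (pt l) (finfun c l) ^+ N != 0 /\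
      ord Q (\prod_(l <- r | P l) Lam (pt l) (finfun c l) ^+ N) = \sum_(l <- r | P l) (N%:Z * - H Q).
    elim/big_rec2: _ => [|l y x _ [IH1 IH2]]; first by rewrite oner_neq0 ord_one.
    rewrite ffunE; have [h1 h2] := hc l.
    by rewrite mulf_neq0 ?expf_neq0 // ordM ?expf_neq0 // ordX // h2 IH2.
  have [h1 h2] := p0 xpredT (index_enum _).
  have e0 : E (finfun c, i) != 0 by rewrite /E /prd /= mulf_neq0 // expf_neq0.
  exists (E (finfun c, i)); first by exists (finfun c, i).
  rewrite /E /prd /= ordM ?expf_neq0 // h2 sumc // ordX // oi.
  have -> : d%:Z = (N * size S)%N%:Z + (d - N * size S)%N%:Z by lia.
  by rewrite PoszM; ring.
Qed.

(* Local generators of the sheaves O(d H + m Dp) vanishing to high order at the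
   bad points B' other than the point where they generate. *)
Lemma ample_sections (Dp : set K -> int) (B : set (set K)) :
  (forall Q, prime_divisor C Q -> 0 <= Dp Q) ->
  finite_set [set Q | prime_divisor C Q /\ Dp Q <> 0] ->
  finite_set B -> B `<=` prime_divisor C ->
  exists B', [/\ finite_set B', B `<=` B', B' `<=` prime_divisor C &
    forall N : nat, exists d0 : nat, forall d m : nat, (d0 <= d)%N -> (d0 <= m)%N ->
    exists L : set (set K * K), [/\ finite_set L,
      forall P x, L (P, x) -> [/\ x != 0, B' P \/ P = [set: K] &
        forall Q, prime_divisor C Q ->
          ordge Q (- (d%:Z * H Q + m%:Z * Dp Q)) x /\
          (B' Q -> Q <> P -> ordge Q (N%:Z - (d%:Z * H Q + m%:Z * Dp Q)) x)]
    & forall Q, C Q -> exists x, (B' Q /\ L (Q, x) \/ ~ B' Q /\ L ([set: K], x)) /\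
        (dvr Q -> ord Q x = - (d%:Z * H Q + m%:Z * Dp Q))]].
Proof.
move=> Dp0 finD finB hB.
have /choice [ZN hZN] : forall Q, exists ZN : set (set K) * nat, prime_divisor C Q ->
   [/\ finite_set ZN.1, ZN.1 `<=` prime_divisor C
    & forall j, (ZN.2 < j)%N -> exists x, [/\ x != 0, ord Q x = - j%:Z,
       forall P, ZN.1 P -> P <> Q -> ordge P (- ZN.2%:Z) x
       & forall P, prime_divisor C P -> ~ ZN.1 P -> P <> Q -> ordge P 0 x]].
  move=> Q; have [pQ|nQ] := pselect (prime_divisor C Q); last by exists (set0, 0%N).
  by have [Z [N h]] := large_poles hC hf pQ; exists (Z, N).
set supp := [set Q | prime_divisor C Q /\ Dp Q <> 0] in finD.
(* Besides [B] it contains the support of [Dp] and all points at which the functions with high poles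
   on that support may have further poles. *)
pose B' := B `|` (supp `|` \bigcup_(Q in supp) (ZN Q).1).
have finB' : finite_set B'.
  rewrite /B' !finite_setU; split=> //; split=> //; apply: bigcup_finite => // Q [pQ _].
  by have [] := hZN Q pQ.
have hB' : B' `<=` prime_divisor C.
  move=> P [/hB//|[[]//|[Q [pQ _] hP]]]; have [_ h _] := hZN Q pQ; exact: h.
exists B'; split=> //; first by move=> P BP; left.
move=> N.
have /finite_seqP [S0 eS0] := finD.
pose N1 := (\sum_(Q <- S0) (ZN Q).2)%N.
have leN1 Q : supp Q -> ((ZN Q).2 <= N1)%N.
  rewrite eS0 /= => hQ; by rewrite /N1 (perm_big _ (perm_to_rem hQ)) big_cons leq_addr.
have /finite_seqP [S1 eS1] := finB'.
pose S := undup S1.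
have uS : uniq S by exact: undup_uniq.
have hS P : P \in S <-> B' P by rewrite mem_undup eS1.
(* The degree permits vanishing to order [N + N1] at every point of [S], where [N1] pays for the
   further poles of [phi]. The last summand makes [m * Dp Q] exceed the threshold of
   [large_poles]. *)
exists ((N + N1) * size S + N1.+1)%N => d m led lem.
have home Q : B' Q -> exists x, [/\ x != 0, ord Q x = - (d%:Z * H Q + m%:Z * Dp Q) &
    forall P, prime_divisor C P -> P <> Q ->
          ordge P (- (d%:Z * H P + m%:Z * Dp P)) x /\
          (B' P -> ordge P (N%:Z - (d%:Z * H P + m%:Z * Dp P)) x)].
  move=> BQ; have pQ := hB' Q BQ; case: (pQ) => CQ dQ; have QS := (hS Q).2 BQ.
  have [|x [x0 sx ox vx]] := @vanishing_section _ _ _ _ hC _ _ _ hf (rem Q S) Q (fun _ => N + N1)%N _ pQ.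
    move=> P hP; split; first by apply: hB'; apply/hS; exact: mem_rem hP.
    by move=> e; move: hP; rewrite e mem_rem_uniqF.
  set deg := (\sum_(P <- rem Q S) (N + N1))%N in sx ox vx.
  have edeg : (deg <= (N + N1) * size S)%N.
    by rewrite /deg big_const_seq count_predT iter_addn_0 size_rem // leq_mul2l leq_pred orbT.
  have [y [y0 sy oy]] := section_of_degree hf (d - deg) pQ.
  (* [phi] supplies the factor [m * Dp Q] at [Q]; the degree [d] part is supplied by hyperplane
     sections. *)
  have [phi [phi0 ophi phi1 phi2]] : exists phi, [/\ phi != 0, ord Q phi = - (m%:Z * Dp Q),
      forall P, B' P -> P <> Q -> ordge P (- N1%:Z) phi
      & forall P, prime_divisor C P -> ~ B' P -> P <> Q -> ordge P 0 phi].
    have [e|ne] := eqVneq (Dp Q) 0.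
      exists 1; rewrite oner_neq0 ord_one // e mulr0 oppr0; split=> //.
        by move=> P /hB' [CP dP] _; right; rewrite ord_one //; lia.
      by move=> P [CP dP] _ _; right; rewrite ord_one.
    have sQ : supp Q by split=> //; exact/eqP.
    have [_ h1 h2] := hZN Q pQ; have leQ := leN1 Q sQ; have D0 := Dp0 Q pQ.
    have [|phi [phi0 ophi phi1 phi2]] := h2 (m * `|Dp Q|%N)%N.
      have : (0 < `|Dp Q|)%N by rewrite absz_gt0.
      by nia.
    exists phi; split=> //.
    - by rewrite ophi PoszM gez0_abs.
    - move=> P BP nP; have [ZP|nZP] := pselect ((ZN Q).1 P).
        by apply: ordge_le (phi1 P ZP nP); lia.
      by apply: ordge_le (phi2 P (hB' P BP) nZP nP); lia.
    - by move=> P pP nB nP; apply: phi2 => // ZP; apply: nB; right; right; exists Q.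
  exists (x * y * phi); split; first by rewrite !mulf_neq0.
    rewrite !ordM ?mulf_neq0 // ox oy ophi.
    have -> : d%:Z = deg%:Z + (d - deg)%N%:Z by lia.
    by ring.
  move=> P pP nP; case: (pP) => CP dP.
  have sxy : ordge P (- (d%:Z * H P)) (x * y).
    have := sectM sx sy pP; congr ordge; congr (- (_ * _)); lia.
  have hDP := Dp0 P pP.
  have vanish : B' P -> ordge P (N%:Z - (d%:Z * H P + m%:Z * Dp P)) (x * y * phi).
    move=> BP; have hP : P \in rem Q S by rewrite mem_rem_uniq // inE (hS P).2 // andbT; apply/eqP.
    have := ordgeM dP (ordgeM dP (vx (rem_uniq _ uS) P hP) (sy P pP)) (phi1 P BP nP).
    apply: ordge_le; have -> : d%:Z = deg%:Z + (d - deg)%N%:Z by lia.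
    rewrite !mulrDl PoszD; nia.
  split=> //; have [BP|nBP] := pselect (B' P); first by apply: ordge_le (vanish BP); lia.
  by have := ordgeM dP sxy (phi2 P pP nBP nP); apply: ordge_le; nia.
have /choice [al hal] : forall Q, exists x, B' Q -> [/\ x != 0, ord Q x = - (d%:Z * H Q + m%:Z * Dp Q) &
    forall P, prime_divisor C P -> P <> Q ->
          ordge P (- (d%:Z * H P + m%:Z * Dp P)) x /\
          (B' P -> ordge P (N%:Z - (d%:Z * H P + m%:Z * Dp P)) x)].
  move=> Q; have [BQ|nBQ] := pselect (B' Q); last by exists 0.
  by have [x hx] := home Q BQ; exists x.
have [||L0 [finL0 hL0 exL0 genL0]] := @vanishing_family S N d _ uS.
- by move=> P /hS /hB'.
- by apply: leq_trans led; rewrite mulnDl -!addnA leq_addr.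
exists ([set (Q, al Q) | Q in B'] `|` [set ([set: K], x) | x in L0]); split.
- by rewrite finite_setU; split; exact: finite_image.
- move=> P x [[Q BQ [<- <-]]|[y Ly [<- <-]]].
    have [x0 ox hx] := hal Q BQ; split=> //; first by left.
    move=> P' pP'; have [->|nP] := pselect (P' = Q); first by split=> //; right; rewrite ox.
    by have [h1 h2] := hx P' pP' nP; split=> // BP' _; exact: h2.
  have [y0 sy vy] := hL0 y Ly; split=> //; first by right.
  move=> Q pQ; have D0 := Dp0 Q pQ; split.
    by apply: ordge_le (sy Q pQ); nia.
  by move=> BQ _; apply: ordge_le (vy Q ((hS Q).2 BQ)); nia.
- move=> Q CQ; have [BQ|nBQ] := pselect (B' Q).
    have [x0 ox _] := hal Q BQ; exists (al Q); split; last by move=> _.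
    by left; split=> //; left; exists Q.
  have [eQ|dQ] := C_cases hC CQ.
    have [y Ly] := exL0; exists y; split; first by right; split=> //; right; exists y.
    by rewrite eQ => /dvr_neqT.
  have nQ : Q \notin S by apply/negP => /hS.
  have [y Ly oy] := genL0 Q (conj CQ dQ) nQ; exists y; split; first by right; split=> //; right; exists y.
  move=> _; rewrite oy; congr (- _).
  have -> : Dp Q = 0 by apply: contrapT => h; apply: nBQ; right; left.
  by rewrite mulr0 addr0.
Qed.

End WithPolar.

(* An ample divisor has positive degree. *)
Lemma no_negative_section (p : nat) (D : set K -> int) (h : K) : p \in [pchar k] ->
  ample k0 C D -> h != 0 -> ~ (forall Q, prime_divisor C Q -> p%:Z * D Q <= ord Q h).
Proof.
move=> hp [m m0 /very_ample_polar [n [f hf]]] h0 hh.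
have pK := pchar_K iota hp.
have [Q [CQ dQ]] : exists Q, prime_divisor C Q by case: hC.
have [_ [i [fi0 _ hl]]] := hf.2 Q (conj CQ dQ).
(* If p D <= div h, then h^m times the p-th power of a section of m D has no poles, hence is
   constant. Since Frobenius is injective and k has p-th roots, the ratios of the sections are
   constants too, which leaves no uniformizer. *)
have hc l : f l != 0 -> k0 (h ^+ m * f l ^+ p).
  move=> fl0; apply: (global_const hC) => P CP; have [->//|dP] := C_cases hC CP.
  rewrite (ord_ge0 dP) ?mulf_neq0 ?expf_neq0 // ordM ?expf_neq0 // !ordX //.
  have := hh P (conj CP dP); have [/(_ l) h1 _] := hf.2 P (conj CP dP).
  case: h1 => [/eqP|]; first by rewrite (negPf fl0).
  nia.
have hq l : k0 (f l / f i).
  have [->|fl0] := eqVneq (f l) 0; first by rewrite mul0r; exists 0 => //; rewrite rmorph0.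
  have [a _ ea] := hc l fl0; have [b _ eb] := hc i fi0.
  have [c ec] := closed_root (a / b) (pchar_gt0 hp).
  exists c => //; apply/eqP; rewrite -subr_eq0; apply/eqP.
  have : (iota c - f l / f i) ^+ p = 0.
    rewrite (exprBp pK) -rmorphXn ec rmorphM fmorphV ea eb; apply/eqP; rewrite subr_eq0; apply/eqP.
    rewrite expr_div_n; field; rewrite !expf_neq0 //.
  by move/eqP; rewrite expf_eq0 => /andP [_ /eqP].
have chk : chart k0 (range f) (f i) `<=` k0.
  by apply: chart_sub_ring => //; [exact: const_subr|move=> _ [l _ <-]].
have [t ht] := dQ; have [lQ AQ hfr] := hl.
have /hfr [a [b [/chk ka /chk kb _ et]]] : Q t by case: ht.
case: (ht) => _ _ _ nt _; apply: nt; apply: (C_k0 hC CQ).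
by rewrite et; apply: constV; exact: (subrM' (const_subr iota) ka (constV kb)).
Qed.

(* The lowest term of f - a^p has exponent prime to p, and is then seen by the
   derivation, or it can be removed by changing a. *)
Lemma local_root p (D : K -> K) f Q t (n : int) : p \in [pchar k] -> jder idfun k0 D ->
  C Q -> uniformizer Q t -> D t != 0 -> D f != 0 -> p%:Z * n <= ord Q (D f / D t) ->
  exists a, ordge Q (p%:Z * n) (f - a ^+ p).
Proof.
move=> hp hD CQ ht Dt0 Df0 le_n; have dQ : dvr Q by exists t.
have pK := pchar_K iota hp; have p0 := pchar_gt0 hp; have t0 := unif_neq0 ht.
have step (e : nat) : forall m : int, p%:Z * n <= m + e%:Z -> 
    (exists a, ordge Q m (f - a ^+ p)) -> exists a, ordge Q (p%:Z * n) (f - a ^+ p).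
  elim: e => [|e IH] m le_m [a ha]; first by exists a; apply: ordge_le ha; lia.
  have [le_nm|lt_mn] := lerP (p%:Z * n) m; first by exists a; exact: ordge_le ha.
  apply: (IH (m + 1)); first by lia.
  have [h|h] := pselect (ordge Q (m + 1) (f - a ^+ p)); first by exists a.
  set g := f - a ^+ p in ha h.
  have g0 : g != 0 by apply: contra_notN h => /eqP ->; left.
  have og : ord Q g = m.
    case: ha => [/eqP|ha]; first by rewrite (negPf g0).
    have : ~ (m + 1 <= ord Q g) by move=> h'; apply: h; right.
    by lia.
  have [u [uu eg]] := ordP ht g0; rewrite og in eg.
  have Qu : Q u by case: uu.
  (* The order m of the remainder is q p + r. For r = 0 the leading term is a p-th power and goes
     into [a]; for r > 0 a contradiction follows. *)
  pose q := (m %/ p%:Z)%Z; pose r := `|(m %% p%:Z)%Z|%N.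
  have em : m = q * p%:Z + r%:Z.
    by rewrite {1}(divz_eq m p%:Z) /r gez0_abs // modz_ge0; lia.
  have ltr : (r < p)%N by have := ltz_pmod m (d := p%:Z); rewrite /r; lia.
  clearbody q r.
  have [c hc] := residue hC CQ dQ Qu.
  have c0 : iota c != 0.
    apply: contraTneq isT => c0; move: hc; rewrite c0 subr0 => -[e0|].
      by case: uu; rewrite e0 eqxx.
    by have [_ ->] := (ord_unit _ dQ).1 uu.
  have etm : t ^ m = (t ^ q) ^+ p * t ^+ r.
    by rewrite em expfzDr // -exprz_exp -!exprnP.
  case: (posnP r) => [r0|r_gt0].
    have [b eb] := closed_root c p0.
    exists (a + iota b * t ^ q).
    have -> : f - (a + iota b * t ^ q) ^+ p = (u - iota c) * t ^ m.
      by rewrite (exprDp pK) exprMn -rmorphXn eb opprD addrA -/g eg etm r0 expr0; ring.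
    have tm : ordge Q m (t ^ m) by right; rewrite ord_expz.
    by have := ordgeM dQ hc tm; rewrite addrC.
  exfalso.
  (* p-th powers are constants of [D], and r is prime to p, so the derivative of [u * t ^+ r] has
     order exactly r - 1. Then [D f / D t] has order m - 1, below the assumed p n. *)
  pose g1 := g / (t ^ q) ^+ p.
  have tq0 : t ^ q != 0 by exact: expfz_neq0.
  have eg1 : g1 = u * t ^+ r.
    by rewrite /g1 eg etm; field; rewrite expf_neq0.
  have Dg : D g = D f by rewrite /g (jderB hD) (jder_pX hD a pK) subr0.
  have Dg1 : D g1 / D t = (D f / D t) / (t ^ q) ^+ p.
    rewrite /g1 -exprVn (jderM hD) /= (jder_pX hD _ pK) mulr0 add0r Dg.
    by rewrite exprVn; field; rewrite Dt0 expf_neq0.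
  have [v Qv ev] := der_local hC hD CQ ht Qu.
  have e1 : D g1 / D t = r%:R * t ^+ r.-1 * u + t ^+ r * v.
    rewrite eg1 (jderM hD) /= ev /= (jderXn hD) /=; field; exact: Dt0.
  have rK : unit_in Q (r%:R).
    have rk : (r%:R : k) != 0 by rewrite -(dvdn_pcharf hp) gtnNdvd.
    by have := unit_sub (C_k0 hC CQ) (const_unit iota rk); rewrite rmorph_nat.
  have [r00 or] := (ord_unit _ dQ).1 rK; have [u0 ou] := (ord_unit _ dQ).1 uu.
  have x0 : r%:R * t ^+ r.-1 * u != 0 by rewrite !mulf_neq0 ?expf_neq0.
  have ox : ord Q (r%:R * t ^+ r.-1 * u) = r%:Z - 1.
    rewrite !ordM ?mulf_neq0 ?expf_neq0 // or ou ordX // (ord_unif ht); clear -r_gt0; lia.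
  have [|s0 os] := @ordD_lt _ Q _ (t ^+ r * v) dQ x0.
    rewrite ox; have tr : ordge Q r (t ^+ r) by right; rewrite ordX // (ord_unif ht) mulr1.
    have := ordgeM dQ tr ((ordge0P v dQ).2 Qv); congr ordge; clear; lia.
  rewrite -e1 ox Dg1 ordM ?mulf_neq0 ?invr_eq0 ?expf_neq0 // in os.
  rewrite ordV // ordX // (ord_expz _ ht) in os.
  clear -os le_n lt_mn em; lia.
have [f00|f00] := eqVneq f 0.
  by exists 0; rewrite f00 expr0n eqn0Ngt p0 subr0; left.
have h1 : p%:Z * n <= ord Q f + (`|(p%:Z * n - ord Q f)%R|%N)%:Z by lia.
have h2 : exists a, ordge Q (ord Q f) (f - a ^+ p).
  by exists 0; rewrite expr0n eqn0Ngt p0 subr0; right.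
exact: (step _ _ h1 h2).
Qed.

End SectionsOnCurve.

(** * The function field of the ruled surface *)

Lemma frac_repr (R : idomainType) (x : {fraction R}) :
  exists p q : R, q != 0 /\ x = FracField.tofrac p / FracField.tofrac q.
Proof.
pose r := repr x.
exists (frac r).1, (frac r).2; split; first by case: r.
have r0 : (frac r).2 != 0 by case: (r).
have d0 : FracField.tofrac (frac r).2 != 0 by rewrite tofrac_eq0.
apply: (mulIf d0); rewrite divfK // -[x in LHS]reprK -/r.
rewrite [FracField.tofrac (frac r).2]piE [FracField.tofrac (frac r).1]piE [LHS]piE.
apply/eqmodP; rewrite /= FracField.equivfE /FracField.mulf.
by rewrite !numden_Ratio ?mulf_neq0 ?oner_neq0 // !mulr1 mulrC.
Qed.

HB.instance Definition _ (K : fieldType) :=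
  GRing.RMorphism.copy (@ratC K) (@FracField.tofrac {poly K} \o @polyC K).

(** * Principal stalks of the sheaf constructions *)

Section Sheaves.
Variable F : fieldType.
Implicit Types (R : set F) (L M : set F -> set F).

Definition prin R (g : F) : set F := [set r * g | r in R].

Lemma prin_subB R g x y : subr R -> prin R g x -> prin R g y -> prin R g (x - y).
Proof. by move=> hR [r Rr <-] [q Rq <-]; exists (r - q); [exact: subrB'|rewrite mulrBl]. Qed.

Lemma prin0 R g : subr R -> prin R g 0.
Proof. by move=> hR; exists 0; [exact: subr0'|rewrite mul0r]. Qed.

Lemma prin_gen R g : subr R -> prin R g g.
Proof. by move=> hR; exists 1; [exact: subr1|rewrite mul1r]. Qed.

Lemma prinM R g r x : subr R -> R r -> prin R g x -> prin R g (r * x).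
Proof. by move=> hR Rr [q Rq <-]; exists (r * q); [exact: subrM'|rewrite mulrA]. Qed.

Lemma prin1 R : prin R 1 = R.
Proof.
by apply/seteqP; split=> [_ [r Rr <-]|r Rr]; [rewrite mulr1|exists r => //; rewrite mulr1].
Qed.

Lemma addgen_sub (S : set F) : S `<=` addgen S.
Proof. by move=> x Sx B [_]; exact. Qed.

Lemma addgen_min (S B : set F) : B 0 -> (forall x y, B x -> B y -> B (x - y)) ->
  S `<=` B -> addgen S `<=` B.
Proof.
move=> B0 BB SB x; apply; split=> //; split=> [|x' y]; rewrite ?in_setE //; exact: BB.
Qed.

Lemma addgenB (S : set F) x y : addgen S x -> addgen S y -> addgen S (x - y).
Proof.
move=> hx hy B [[B0 BB] hB]; have := BB x y; rewrite !in_setE; apply; [exact: hx|exact: hy].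
Qed.

Lemma addgenD (S : set F) x y : addgen S x -> addgen S y -> addgen S (x + y).
Proof.
move=> hx hy; rewrite -[y]opprK; apply: addgenB => //; rewrite -sub0r; apply: addgenB => //.
by move=> B [[B0 BB] hB]; rewrite in_setE in B0.
Qed.

Lemma addgen_prin R (S : set F) g : subr R -> S `<=` prin R g ->
  (forall r, R r -> S (r * g)) -> addgen S = prin R g.
Proof.
move=> hR h1 h2; apply/seteqP; split.
  apply: addgen_min => //; [exact: prin0|by move=> x y; exact: prin_subB].
by move=> _ [r Rr <-]; apply: addgen_sub; exact: h2.
Qed.

Lemma tensor_prin R L M g h : subr R -> L R = prin R g -> M R = prin R h ->
  tensorS L M R = prin R (g * h).
Proof.
move=> hR eL eM; rewrite /tensorS eL eM; apply: addgen_prin => //.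
  move=> _ [_ [r Rr <-] [_ [q Rq <-] <-]]; exists (r * q); first exact: subrM'.
  by rewrite mulrACA.
move=> r Rr; exists (r * g); first by exists r.
by exists h; [exact: prin_gen|rewrite mulrA].
Qed.

Lemma dual_prin R L g : subr R -> g != 0 -> L R = prin R g -> dualS L R = prin R g^-1.
Proof.
move=> hR g0 eL; rewrite /dualS eL; apply/seteqP; split.
  move=> x /(_ g (prin_gen _ hR)) h; exists (x * g) => //; by rewrite mulfK.
move=> _ [r Rr <-] _ [q Rq <-].
by rewrite -mulrA mulrCA [g^-1 * _]mulrC mulrA mulfK // mulrC; exact: subrM'.
Qed.

Lemma exp_prin R L g n : subr R -> L R = prin R g -> expS L n R = prin R (g ^+ n).
Proof.
move=> hR eL; elim: n => [|n IH]; first by rewrite expr0 prin1.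
by rewrite exprS; exact: tensor_prin.
Qed.

Lemma prin_unit R g h : subr R -> h != 0 -> unit_in R (g / h) -> prin R g = prin R h.
Proof.
move=> hR h0 [u0 Ru Ru']; have g0 : g != 0 by apply: contraNneq u0 => ->; rewrite mul0r.
apply/seteqP; split=> _ [r Rr <-].
  by exists (r * (g / h)); [exact: subrM'|rewrite mulrA divfK].
exists (r * (g / h)^-1); first exact: subrM'.
by field; rewrite g0 h0.
Qed.

Lemma prin_eq_unit R g h : subr R -> g != 0 -> h != 0 -> prin R g = prin R h -> unit_in R (g / h).
Proof.
move=> hR g0 h0 e; split; first by rewrite mulf_neq0 ?invr_eq0.
  by have [r Rr <-] : prin R h g; [rewrite -e; exact: prin_gen|rewrite mulfK].
have [r Rr eh] : prin R g h by rewrite e; exact: prin_gen.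
by rewrite invfM invrK mulrC -eh mulfK.
Qed.

Lemma extend_prin (K : fieldType) (j : {rmorphism K -> F}) (C : set (set K))
    (G : set K -> set F) R Q g : subr R -> C Q -> dominates j R Q ->
  (forall Q', C Q' -> dominates j R Q' -> Q' = Q) ->
  (forall w, G Q w -> prin R g w) -> G Q g -> extendS j C G R = prin R g.
Proof.
move=> hR CQ dQ uQ h1 h2; apply: addgen_prin => //.
  by move=> _ [r Rr [w [Q' [CQ' dQ' Gw]] <-]]; apply: prinM => //; apply: h1; rewrite -(uQ Q').
by move=> r Rr; exists r => //; exists g => //; exists Q.
Qed.
End Sheaves.

Lemma inv_ratio (F : fieldType) (y s : F) : y != 0 -> s != 0 -> y^-1 = (1 / s) * (y / s)^-1.
Proof. by move=> y0 s0; field; rewrite y0 s0. Qed.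

Lemma ratio_ratio (F : fieldType) (w y s : F) : y != 0 -> s != 0 -> w / s = (w / y) / (s / y).
Proof. by move=> y0 s0; field; rewrite y0 s0. Qed.

(** * Local description of the extension and of the ruled surface *)

Section RuledSurface.
Variables (k : closedFieldType) (K : fieldType) (iota : {rmorphism k -> K}).
Variable C : set (set K).
Hypothesis hC : smooth_projective_curve (range iota) C.
Notation k0 := (range iota).
Variables (p : nat).
Hypothesis hp : p \in [pchar k].
Variables (D G : set K -> int) (f0 : K) (e l : nat).
Notation E := (raynaud_E p C D f0).
Notation L := (OD C D).
Notation Nl := (expS (OD C G) (e %/ l)).
Notation P := (raynaud_P C E).
Notation X := (ratX K).

(* Local generators [v] of [L] and [nu] of [N_l], and the p-th root [a] of [f0]
   modulo L^-p. *)
Definition local_data (Q : set K) (v a nu : K) : Prop :=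
  [/\ v != 0, nu != 0 & dvr Q ->
   [/\ ord Q v = - D Q, ord Q nu = - ((e %/ l)%N%:Z * G Q) & ordge Q (p%:Z * D Q) (f0 - a ^+ p)]].

Definition fib (v a : K) : ruled_field K := ratC v * (X + ratC a).

Lemma OD_point (A : set K -> int) Q : prime_divisor C Q -> OD C A Q = [set h | ordge Q (- A Q) h].
Proof.
move=> [CQ dQ]; apply/seteqP; split=> h.
  by move=> /(_ Q (conj CQ dQ) (fun _ => id)) [->|h']; [left|right; lia].
move=> h' W [CW dW] QW; rewrite (dvr_eq dQ dW QW).
by case: h' => [->|h']; [left|right; lia].
Qed.

Lemma OD_generic (A : set K -> int) : OD C A [set: K] = [set: K].
Proof.
apply/seteqP; split=> // h _ W [CW dW] TW; exfalso; apply: (dvr_neqT dW).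
by apply/seteqP; split.
Qed.

Lemma prin_point (A : set K -> int) Q g : C Q -> g != 0 -> (dvr Q -> ord Q g = - A Q) ->
  OD C A Q = prin Q g.
Proof.
move=> CQ g0 og; have [eQ|dQ] := C_cases hC CQ.
  rewrite eQ OD_generic; apply/seteqP; split=> // h _; exists (h / g) => //; exact: divfK.
rewrite OD_point //; apply/seteqP; split=> h.
  move=> /= hh; exists (h / g); last exact: divfK.
  apply/(ordge0P _ dQ); have hg : ordge Q (A Q) g^-1 by right; rewrite ordV // og // opprK.
  by have := ordgeM dQ hh hg; rewrite addNr.
move=> [r /(ordge0P _ dQ) hr <-] /=; have hg : ordge Q (- A Q) g by right; rewrite og.
by have := ordgeM dQ hr hg; rewrite add0r.
Qed.

Lemma L_prin Q v a nu : C Q -> local_data Q v a nu -> L Q = prin Q v.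
Proof. by move=> CQ [v0 _ h]; apply: prin_point => // /h []. Qed.

Lemma Nl_prin Q v a nu : C Q -> local_data Q v a nu -> Nl Q = prin Q nu.
Proof.
move=> CQ [v0 nu0 h]; have hQ := C_subr hC CQ.
have [g [g0 og]] : exists g, g != 0 /\ (dvr Q -> ord Q g = - G Q).
  have [[t ht]|nd] := pselect (dvr Q); last by exists 1; rewrite oner_neq0.
  by exists (t ^ (- G Q)); rewrite (ord_expz _ ht) expfz_neq0 //; exact: unif_neq0 ht.
rewrite (exp_prin (e %/ l) hQ (prin_point CQ g0 og)).
have gn0 : g ^+ (e %/ l) != 0 by rewrite expf_neq0.
apply: prin_unit => //; have [eQ|dQ] := C_cases hC CQ.
  by rewrite eQ; split=> //; rewrite mulf_neq0 ?invr_eq0.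
apply/(ord_unit _ dQ); split; first by rewrite mulf_neq0 ?invr_eq0.
have [_ onu _] := h dQ; rewrite ordM ?invr_eq0 // ordX // ordV // og // onu; lia.
Qed.

Lemma root_mem Q v a nu : C Q -> local_data Q v a nu ->
  OD C (fun W => - (p%:Z * D W)) Q (f0 - a ^+ p) /\ Q (v ^+ p * (f0 - a ^+ p)).
Proof.
move=> CQ [v0 _ h]; have [eQ|dQ] := C_cases hC CQ; first by rewrite eQ OD_generic.
have [ov _ hr] := h dQ; rewrite OD_point //= opprK; split=> //.
apply/(ordge0P _ dQ); have hv : ordge Q (- (p%:Z * D Q)) (v ^+ p).
  by right; rewrite ordX // ov; lia.
by have := ordgeM dQ hv hr; rewrite addNr.
Qed.

(** By additivity of Frobenius (a' - a)^p is the difference of the two remainders, so its order is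
    at least p n. Hence the cocycle of the roots takes values in L^-1. *)
Lemma root_sub Q n a a' : dvr Q -> ordge Q (p%:Z * n) (f0 - a ^+ p) ->
  ordge Q (p%:Z * n) (f0 - a' ^+ p) -> ordge Q n (a' - a).
Proof.
move=> dQ ha ha'; have [->|aa0] := eqVneq (a' - a) 0; first by left.
have haa : ordge Q (p%:Z * n) ((a' - a) ^+ p).
  rewrite (exprBp (pchar_K iota hp)).
  have -> : a' ^+ p - a ^+ p = (f0 - a ^+ p) - (f0 - a' ^+ p) by ring.
  by apply: ordgeD => //; exact: ordgeN.
case: haa => [/eqP|]; first by rewrite expf_eq0 (negPf aa0) andbF.
rewrite ordX // (ler_pM2l (x := p%:Z)) => [haa|]; first by right.
exact: pchar_gt0 hp.
Qed.

Lemma E_local Q v a nu w : C Q -> local_data Q v a nu ->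
  E Q w <-> exists u u', [/\ Q u, Q u' & w = ratC u + ratC u' * fib v a].
Proof.
move=> CQ hd; have hQ := C_subr hC CQ; case: (hd) => v0 _ h; split.
  move=> [a' [u [v' [ha' Qu]]]]; rewrite (L_prin CQ hd) => -[r Qr <-] ->.
  exists (u + r * v * (a' - a)), r; split=> //; last by rewrite /fib !rmorphD !rmorphM rmorphB; ring.
  rewrite -mulrA; apply: subrD' => //; apply: subrM' => //.
  have [eQ|dQ] := C_cases hC CQ; first by rewrite eQ.
  have [ov _ ha] := h dQ; rewrite OD_point //= opprK in ha'.
  apply/(ordge0P _ dQ); have hv : ordge Q (- D Q) v by right; rewrite ov.
  by have := ordgeM dQ hv (root_sub dQ ha ha'); rewrite addNr.
move=> [u [u' [Qu Qu' ->]]]; exists a, u, (u' * v); split=> //.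
- by have [] := root_mem CQ hd.
- by rewrite (L_prin CQ hd); exists u'.
- by rewrite rmorphM /fib mulrA.
Qed.

Lemma E1 Q v a nu : C Q -> local_data Q v a nu -> E Q 1.
Proof.
move=> CQ hd; apply/(E_local _ CQ hd); exists 1, 0; rewrite rmorph1 rmorph0 mul0r addr0.
by split=> //; [exact: subr1 (C_subr hC CQ)|exact: subr0' (C_subr hC CQ)].
Qed.

Lemma E_fib Q v a nu : C Q -> local_data Q v a nu -> E Q (fib v a).
Proof.
move=> CQ hd; apply/(E_local _ CQ hd); exists 0, 1; rewrite rmorph1 rmorph0 mul1r add0r.
by split=> //; [exact: subr0' (C_subr hC CQ)|exact: subr1 (C_subr hC CQ)].
Qed.

Lemma X_neqC c : X != ratC c.
Proof.
rewrite /ratX /ratC tofrac_eq; apply/eqP => h.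
have := congr1 (fun q : {poly K} => size q) h; rewrite size_polyX size_polyC; by case: eqP.
Qed.

Lemma fib_neq0 v a : v != 0 -> fib v a != 0.
Proof.
move=> v0; rewrite mulf_neq0 ?fmorph_eq0 // addr_eq0 -rmorphN; exact: X_neqC.
Qed.

Definition chart0 Q (v a : K) := gen_ring (@ratC K @` Q `|` [set fib v a]).
Definition chart1 Q (v a : K) := gen_ring (@ratC K @` Q `|` [set (fib v a)^-1]).

Lemma P_point Q v a nu R : C Q -> local_data Q v a nu ->
  locz (chart0 Q v a) R \/ locz (chart1 Q v a) R -> P R.
Proof.
move=> CQ hd hR; have y0 := fib_neq0 a (let: And3 h _ _ := hd in h).
have e0 : gen_ring (@ratC K @` Q `|` [set w / 1 | w in E Q]) = chart0 Q v a.
  have hA := @gen_subr _ (@ratC K @` Q `|` [set fib v a]).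
  apply/seteqP; split; last first.
    apply: gen_mono => z [Qz|->]; first by left.
    by right; exists (fib v a); [exact: E_fib CQ hd|rewrite divr1].
  apply: gen_min; first exact: hA.
  move=> z [Qz|[w /(E_local _ CQ hd) [u [u' [Qu Qu' ->]]] <-]]; first by apply: gen_sub; left.
  rewrite divr1; apply: (subrD' hA); last apply: (subrM' hA); apply: gen_sub.
  + by left; exists u.
  + by left; exists u'.
  + by right.
have e1 : gen_ring (@ratC K @` Q `|` [set w / fib v a | w in E Q]) = chart1 Q v a.
  have hA := @gen_subr _ (@ratC K @` Q `|` [set (fib v a)^-1]).
  apply/seteqP; split; last first.
    apply: gen_mono => z [Qz|->]; first by left.
    by right; exists 1; [exact: E1 CQ hd|rewrite div1r].
  apply: gen_min; first exact: hA.
  move=> z [Qz|[w /(E_local _ CQ hd) [u [u' [Qu Qu' ->]]] <-]]; first by apply: gen_sub; left.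
  rewrite mulrDl mulfK //; apply: (subrD' hA); first apply: (subrM' hA); apply: gen_sub.
  + by left; exists u.
  + by right.
  + by left; exists u'.
case: hR => hR.
  exists Q, 1; split; [exact: CQ|exact: E1 CQ hd|exact: oner_neq0|].
  by apply/SpecP; [exact: gen_subr|rewrite e0].
exists Q, (fib v a); split; [exact: CQ|exact: E_fib CQ hd|exact: y0|].
by apply/SpecP; [exact: gen_subr|rewrite e1].
Qed.

Hypothesis data_exists : forall Q, C Q -> exists v a nu, local_data Q v a nu.

Lemma generic_data v a nu : v != 0 -> nu != 0 -> local_data [set: K] v a nu.
Proof. by move=> v0 nu0; split=> // /dvr_neqT. Qed.

(** A discrete valuation ring has no proper overring except the field. So a point on a chart over
    [Q] lies over [Q] or over the generic point of [C]. *)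
Lemma dominated_or_generic (F : fieldType) (j : {rmorphism K -> F}) (R : set F) Q :
  subr R -> C Q -> (forall a, Q a -> R (j a)) -> dominates j R Q \/ (forall a, R (j a)).
Proof.
move=> hR CQ QR; have [h|h] := pselect (dominates j R Q); [by left|right].
have [x [Qx Rx nQx]] : exists x, [/\ Q x, R (j x)^-1 & ~ Q x^-1].
  apply: contrapT => n; apply: h; split=> // x Qx Rx; apply: contrapT => nQ; apply: n.
  by exists x.
have [eQ|dQ] := C_cases hC CQ; first by case: nQx; rewrite eQ.
have hV : subr [set c | R (j c)].
  split=> /=; first by rewrite rmorph1; exact: subr1.
  - by move=> u w hu hw; rewrite rmorphB; exact: subrB'.
  - by move=> u w hu hw; rewrite rmorphM; exact: subrM'.
have QV : Q `<=` [set c | R (j c)] by [].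
have [eV|eV] := dvr_overring dQ hV QV; last first.
  move=> c; have : [set: K] c by []. by rewrite -eV.
by case: nQx; rewrite -eV /= fmorphV.
Qed.

Lemma generic_dominates (F : fieldType) (j : {rmorphism K -> F}) (R : set F) :
  (forall a, R (j a)) -> dominates j R [set: K].
Proof. by move=> h; split. Qed.

(** A chart of P is given by any section s0 = u + u' y of the extension. At a local ring one summand
    of 1 = u/s0 + u' y/s0 is a unit, so s0 may be replaced by 1 or by y. *)
Lemma P_chart R : P R -> exists Q v a nu, [/\ C Q, dominates (@ratC K) R Q, local_data Q v a nu
  & locz (chart0 Q v a) R \/ locz (chart1 Q v a) R].
Proof.
move=> [Q [s0 [CQ Es s00 hR]]]; have hQ := C_subr hC CQ.
have [v [a [nu hd]]] := data_exists CQ.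
have y0 := fib_neq0 a (let: And3 h _ _ := hd in h); set y := fib v a in y0.
have {}hR := (SpecP R (@gen_subr _ _)).1 hR; set B := gen_ring _ in hR.
have hB : subr B by exact: gen_subr.
have [lR BR _] := hR; have sR := local_subr lR.
have QB c : Q c -> B (ratC c) by move=> Qc; apply: gen_sub; left; exists c.
have EB w : E Q w -> B (w / s0) by move=> Ew; apply: gen_sub; right; exists w.
have B1 : B (1 / s0) by apply: EB; exact: E1 CQ hd.
have By : B (y / s0) by apply: EB; exact: E_fib CQ hd.
have [u [u' [Qu Qu' es]]] := (E_local _ CQ hd).1 Es.
suff main : locz (chart0 Q v a) R \/ locz (chart1 Q v a) R.
  have QR c : Q c -> R (ratC c) by move=> Qc; exact: BR (QB _ Qc).
  have [dQ|dK] := dominated_or_generic sR CQ QR; first by exists Q, v, a, nu.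
  exists [set: K], v, a, nu; split; [exact: C_generic hC|exact: generic_dominates| |].
    by case: hd => v0 nu0 _; exact: generic_data.
  have QT S' : gen_ring (@ratC K @` Q `|` S') `<=` R ->
      gen_ring (@ratC K @` [set: K] `|` S') `<=` R.
    move=> h; apply: gen_min => // z [[c _ <-]|Sz]; first exact: dK.
    by apply: h; apply: gen_sub; right.
  have QT' S' : gen_ring (@ratC K @` Q `|` S') `<=` gen_ring (@ratC K @` [set: K] `|` S').
    by apply: gen_mono => z [[c Qc <-]|Sz]; [left; exists c|right].
  case: main => h; [left|right]; apply: (locz_mono h (QT' _)); apply: QT; by case: h.
have [|||h|h] := lR.2 (ratC u * (1 / s0)) (ratC u' * (y / s0)).
- by apply: (subrM' sR); apply: BR => //; exact: QB.
- by apply: (subrM' sR); apply: BR => //; exact: QB.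
- rewrite (_ : _ + _ = 1); first exact: unit1.
  by rewrite mul1r mulrA -mulrDl -es divff.
- left.
  have u1 : unit_in R (1 / s0) by exact (unitMr sR (BR _ (QB _ Qu)) (BR _ B1) h).
  have us : unit_in R s0 by have := unitV u1; rewrite div1r invrK.
  have Ry : R y by rewrite -[y](divfK s00); apply: (subrM' sR); [exact: BR|case: us].
  have hA : subr (chart0 Q v a) by exact: gen_subr.
  have Ay : chart0 Q v a y by apply: gen_sub; right.
  have AC c : Q c -> chart0 Q v a (ratC c) by move=> Qc; apply: gen_sub; left; exists c.
  have As w : E Q w -> chart0 Q v a w.
    by move=> /(E_local _ CQ hd) [x [x' [Qx Qx' ->]]]; apply: (subrD' hA); [exact: AC|apply: (subrM' hA) => //; exact: AC].
  have AR : chart0 Q v a `<=` R.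
    by apply: (gen_min sR) => z [[c Qc <-]|->]; [exact: BR (QB _ Qc)|].
  apply: (locz_trans hA hR AR); apply: (frac_gen hA sR AR) => z [[c Qc <-]|[w Ew <-]].
    by exists (ratC c), 1; split; [exact: AC|exact: (subr1 hA)|exact: unit1|rewrite divr1].
  by exists w, s0; split; [exact: As|exact: As|exact: us|].
- right.
  have u1 : unit_in R (y / s0) by exact (unitMr sR (BR _ (QB _ Qu')) (BR _ By) h).
  have Ry : R y^-1.
    rewrite (inv_ratio y0 s00).
    by apply: (subrM' sR); [exact: BR|case: (u1)].
  have hA : subr (chart1 Q v a) by exact: gen_subr.
  have Ay : chart1 Q v a y^-1 by apply: gen_sub; right.
  have AC c : Q c -> chart1 Q v a (ratC c) by move=> Qc; apply: gen_sub; left; exists c.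
  have As w : E Q w -> chart1 Q v a (w / y).
    move=> /(E_local _ CQ hd) [x [x' [Qx Qx' ->]]]; rewrite mulrDl mulfK //.
    by apply: (subrD' hA); [apply: (subrM' hA) => //; exact: AC|exact: AC].
  have AR : chart1 Q v a `<=` R.
    by apply: (gen_min sR) => z [[c Qc <-]|->]; [exact: BR (QB _ Qc)|].
  apply: (locz_trans hA hR AR); apply: (frac_gen hA sR AR) => z [[c Qc <-]|[w Ew <-]].
    by exists (ratC c), 1; split; [exact: AC|exact: (subr1 hA)|exact: unit1|rewrite divr1].
  exists (w / y), (s0 / y); split; [exact: As|exact: As| |exact: ratio_ratio].
  by have := unitV u1; rewrite invfM invrK mulrC.
Qed.

End RuledSurface.

Lemma branch_ratio (F : fieldType) (s g nu th v : F) (b l p : nat) : g != 0 -> v != 0 -> th != 0 ->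
  (b * l)%N = p.+1 ->
  s * (g ^- b * nu) ^+ l / (g^-1 * (th * v * g ^- p)) = s * (nu ^+ l / v) / th.
Proof.
move=> g0 v0 th0 hb; rewrite exprMn -exprVn -exprM hb exprVn exprS.
by field; rewrite g0 v0 th0 expf_neq0.
Qed.

(** * Uniqueness of the splitting and stalks of the branch sheaves *)

Section BranchSection.
Variables (k : closedFieldType) (K : fieldType) (iota : {rmorphism k -> K}).
Variable C : set (set K).
Hypothesis hC : smooth_projective_curve (range iota) C.
Notation k0 := (range iota).
Variables (p : nat).
Hypothesis hp : p \in [pchar k].
Variables (D G : set K -> int) (f0 : K) (e l : nat).
Notation E := (raynaud_E p C D f0).
Notation L := (OD C D).
Notation Nl := (expS (OD C G) (e %/ l)).
Notation P := (raynaud_P C E).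
Notation X := (ratX K).
Notation local_data := (local_data p D G f0 e l).
Hypothesis data_exists : forall Q, C Q -> exists v a nu, local_data Q v a nu.
Lemma pchar_ruled : p \in [pchar (ruled_field K)].
Proof. exact: (rmorph_pchar (@ratC K) (pchar_K iota hp)). Qed.

Lemma frob_local Q v a nu w : C Q -> local_data Q v a nu ->
  frob_pullback p E Q w <-> exists u u', [/\ Q u, Q u' & w = ratC u + ratC u' * fib v a ^+ p].
Proof.
move=> CQ hd; have hQ := C_subr hC CQ; have hE := pchar_ruled; split.
  move=> hw; suff : addgen [set ratC c * w ^+ p | c in Q & w in E Q] `<=`
     [set w | exists u u', [/\ Q u, Q u' & w = ratC u + ratC u' * fib v a ^+ p]] by move=> /(_ w hw).
  apply: addgen_min.
  - exists 0, 0; split; [exact: subr0'|exact: subr0'|by rewrite rmorph0 mul0r addr0].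
  - move=> _ _ [u [u' [Qu Qu' ->]]] [x [x' [Qx Qx' ->]]]; exists (u - x), (u' - x').
    split; [exact: subrB'|exact: subrB'|by rewrite !rmorphB; ring].
  - move=> _ [c Qc [x /(E_local hC hp x CQ hd) [u [u' [Qu Qu' ->]]] <-]].
    exists (c * u ^+ p), (c * u' ^+ p); split.
    + by apply: (subrM' hQ) => //; exact: subrX'.
    + by apply: (subrM' hQ) => //; exact: subrX'.
    + by rewrite (exprDp hE) exprMn !rmorphM !rmorphXn mulrDr mulrA.
move=> [u [u' [Qu Qu' ->]]]; apply: addgenD; apply: addgen_sub.
  exists u => //; exists 1; first exact: (E1 hC hp CQ hd).
  by rewrite expr1n mulr1.
exists u' => //; exists (fib v a) => //; exact: (E_fib hC hp CQ hd).
Qed.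

(** Comparing the coefficients of x^p and 1 in the two expressions for v^p theta shows that c - f0
    is a section of L^-p, so it vanishes because D has positive degree. *)
Lemma theta_eq theta : ample k0 C D -> frob_splitting p C E L theta ->
  theta = X ^+ p + ratC f0.
Proof.
move=> hA [[c ->] hth]; congr (_ + ratC _).
apply/eqP; rewrite -subr_eq0; apply/eqP; apply: contrapT => /eqP h0.
have p0 := pchar_gt0 hp.
apply: (no_negative_section hC hp hA h0) => Q [CQ dQ].
have [v [a [nu hd]]] := data_exists CQ; have hQ := C_subr hC CQ.
have hv : expS L p Q (v ^+ p).
  rewrite (exp_prin p hQ (L_prin hC hp CQ hd)); exact: prin_gen.
have /(frob_local _ CQ hd) [u [u' [Qu Qu' eq1]]] := hth Q CQ _ hv.
have eq2 : (v ^+ p)%:P * ('X ^+ p + c%:P) = u%:P + u'%:P * ((v ^+ p)%:P * ('X ^+ p + (a ^+ p)%:P)).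
  apply/eqP; rewrite -tofrac_eq; apply/eqP.
  rewrite /fib exprMn (exprDp pchar_ruled) -!rmorphXn in eq1.
  rewrite !(tofracM, tofracD); exact: eq1.
have v0 : v != 0 by case: hd.
have vp0 : v ^+ p != 0 by rewrite expf_neq0.
have cp := congr1 (fun q : {poly K} => q`_p) eq2.
have c0 := congr1 (fun q : {poly K} => q`_0) eq2.
rewrite /= !coefCM !coefD !coefCM !coefD !coefXn !coefC eqxx eqn0Ngt p0 /= !addr0 !mulr1 add0r in cp.
rewrite /= !coefCM !coefD !coefCM !coefD !coefXn !coefC !eqxx eq_sym eqn0Ngt p0 /= !add0r in c0.
have u1 : u' = 1 by apply: (mulIf vp0); rewrite mul1r -cp.
have hz : Q (v ^+ p * (c - f0)).
  have -> : v ^+ p * (c - f0) = u - v ^+ p * (f0 - a ^+ p) by rewrite mulrBr c0 u1; ring.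
  apply: (subrB' hQ) => //; exact: (root_mem hC hp CQ hd).2.
have [ov _ _] : [/\ ord Q v = - D Q, ord Q nu = - ((e %/ l)%N%:Z * G Q)
   & ordge Q (p%:Z * D Q) (f0 - a ^+ p)] by case: hd => _ _; apply.
move: hz; rewrite (ord_ge0 dQ) ?mulf_neq0 // ordM // ordX // ov => hz; rewrite mulrN in hz; clear -hz.
by rewrite addrC subr_ge0 in hz.
Qed.

Section Stalks.
Variables (R : set (ruled_field K)) (Q : set K) (v a nu : K) (g : ruled_field K).
Hypotheses (hR : subr R) (CQ : C Q) (dRQ : dominates (@ratC K) R Q) (hd : local_data Q v a nu).
Let y := fib v a.
Hypothesis hg : g = 1 /\ R y \/ g = y /\ R y^-1.
Variable theta : ruled_field K.
Hypothesis th0 : theta != 0.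

Lemma stalk_uniq Q' : C Q' -> dominates (@ratC K) R Q' -> Q' = Q.
Proof. by move=> CQ' dQ'; rewrite (dominatesE hC CQ' dQ') -(dominatesE hC CQ dRQ). Qed.

Lemma v_neq0 : v != 0. Proof. by case: hd. Qed.
Lemma nu_neq0 : nu != 0. Proof. by case: hd. Qed.
Lemma y_neq0 : y != 0. Proof. exact: fib_neq0 v_neq0. Qed.
Lemma g_neq0 : g != 0.
Proof. by case: hg => -[-> _]; [exact: oner_neq0|exact: y_neq0]. Qed.
Lemma QR c : Q c -> R (ratC c). Proof. by move=> Qc; exact: dRQ.1. Qed.

(** Where y is regular the generator [g] is 1, where 1/y is regular it is y. In the second case the
    section 1 equals (1/y) y, so E has local equation 1/y. *)
Lemma stalk_OP1 : OP1 C E R = prin R g.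
Proof.
apply: (extend_prin hR CQ dRQ stalk_uniq).
  move=> _ /(E_local hC hp _ CQ hd) [u [u' [Qu Qu' ->]]].
  case: hg => -[-> Ry].
    rewrite prin1; apply: (subrD' hR); [exact: QR|apply: (subrM' hR); [exact: QR|exact: Ry]].
  exists (ratC u * y^-1 + ratC u').
    apply: (subrD' hR); last exact: QR.
    by apply: (subrM' hR); [exact: QR|exact: Ry].
  by rewrite mulrDl (divfK y_neq0).
by case: hg => -[-> _]; [exact: (E1 hC hp CQ hd)|exact: (E_fib hC hp CQ hd)].
Qed.

Lemma stalk_E : ideal_E C E R = prin R g^-1.
Proof.
rewrite /ideal_E /zero_ideal (dual_prin hR g_neq0 stalk_OP1).
by apply/seteqP; split=> [_ [x hx <-]|x hx]; [rewrite mul1r|exists x; rewrite ?mul1r].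
Qed.

Lemma stalk_M : raynaud_M p l C E Nl R = prin R (g ^- (p.+1 %/ l) * ratC (nu ^+ p)).
Proof.
apply: (tensor_prin hR).
  apply: (dual_prin hR); first exact: expf_neq0 g_neq0.
  exact: (exp_prin _ hR stalk_OP1).
rewrite rmorphXn; apply: (exp_prin _ hR).
apply: (extend_prin hR CQ dRQ stalk_uniq).
  move=> _ [x + <-]; rewrite (Nl_prin hC hp CQ hd) => -[q Qq <-].
  by rewrite rmorphM; exists (ratC q) => //; exact: QR.
exists nu => //; rewrite (Nl_prin hC hp CQ hd); apply: prin_gen; exact: C_subr hC _ CQ.
Qed.

Lemma stalk_C'' : ideal_C'' p C E L theta R = prin R (theta * ratC (v ^+ p) * g ^- p).
Proof.
have hQ := C_subr hC CQ; have v0 := v_neq0.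
have vp0 : v ^+ p != 0 by rewrite expf_neq0.
have gv0 : ratC (v ^+ p)^-1 * g ^+ p != 0.
  apply: mulf_neq0; last exact: expf_neq0 g_neq0.
  by rewrite fmorph_eq0 invr_eq0.
have dualL : dualS (expS L p) Q = prin Q (v ^+ p)^-1.
  apply: (dual_prin hQ vp0); exact: (exp_prin _ hQ (L_prin hC hp CQ hd)).
have ext : extendS (@ratC K) C (fun Q =>
       addgen [set w * ratC a | w in frob_pullback p E Q
                              & a in dualS (expS L p) Q]) R = prin R (ratC (v ^+ p)^-1 * g ^+ p).
  apply: (extend_prin hR CQ dRQ stalk_uniq).
    move=> z hz; suff : addgen [set w * ratC a | w in frob_pullback p E Q
                    & a in dualS (expS L p) Q] `<=` prin R (ratC (v ^+ p)^-1 * g ^+ p) by move=> /(_ z hz).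
    apply: addgen_min; [exact: prin0|by move=> x' y'; exact: prin_subB|].
    move=> _ [w /(frob_local _ CQ hd) [u [u' [Qu Qu' ->]]] [x + <-]].
    rewrite dualL => -[q Qq <-].
    have : prin R (g ^+ p) (ratC u + ratC u' * y ^+ p).
      case: hg => -[-> Ry].
        rewrite expr1n prin1; apply: (subrD' hR); first exact: QR.
        by apply: (subrM' hR); [exact: QR|exact: subrX'].
      exists (ratC u * y^-1 ^+ p + ratC u').
        apply: (subrD' hR); last exact: QR.
        by apply: (subrM' hR); [exact: QR|exact: subrX'].
      by rewrite mulrDl exprVn (divfK (expf_neq0 _ y_neq0)).
    move=> [r Rr <-]; exists (r * ratC q); first by apply: (subrM' hR) => //; exact: QR.
    by rewrite rmorphM [_ * g ^+ p]mulrC mulrACA.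
  apply: addgen_sub; exists (g ^+ p); last first.
    exists (v ^+ p)^-1; last by rewrite mulrC.
    by rewrite dualL; exact: prin_gen.
  apply/(frob_local _ CQ hd); case: hg => -[-> _].
    by exists 1, 0; split; [exact: subr1|exact: subr0'|rewrite expr1n rmorph1 rmorph0 mul0r addr0].
  by exists 0, 1; split; [exact: subr0'|exact: subr1|rewrite rmorph1 rmorph0 mul1r add0r].
rewrite /ideal_C'' /zero_ideal (dual_prin hR gv0 ext).
have -> : theta * ratC (v ^+ p) * g ^- p = theta * (ratC (v ^+ p)^-1 * g ^+ p)^-1.
  by rewrite invfM -fmorphV invrK mulrA.
apply/seteqP; split=> [_ [_ [r Rr <-] <-]|_ [r Rr <-]].
  by exists r => //; rewrite mulrCA.
by exists (r * (ratC (v ^+ p)^-1 * g ^+ p)^-1); [exists r|rewrite mulrCA].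
Qed.

(** [M] contributes the power -b l of [g], and the ideals of E and C'' together the power -(p + 1).
    These cancel as b l = p + 1, so the unit has the same form on both charts. *)
Lemma branch_unit s : (l %| p.+1)%N -> P R ->
  branch_section l P (raynaud_M p l C E Nl) (ideal_E C E) (ideal_C'' p C E L theta) s ->
  unit_in R (s * (ratC (nu ^+ p) ^+ l / ratC (v ^+ p)) / theta).
Proof.
move=> hl PR /(_ R PR); rewrite (exp_prin l hR stalk_M) (tensor_prin hR stalk_E stalk_C'') => es.
have v0 : ratC (v ^+ p) != 0 by rewrite fmorph_eq0 (expf_neq0 _ v_neq0).
have nu0 : ratC (nu ^+ p) != 0 by rewrite fmorph_eq0 (expf_neq0 _ nu_neq0).
have g0 := g_neq0.
rewrite -(branch_ratio _ _ g0 v0 th0 (divnK hl)).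
set m := (_ * ratC (nu ^+ p)) ^+ l in es *; set w := _^-1 * _ in es *.
have m0 : m != 0 := expf_neq0 l (mulf_neq0 (invr_neq0 (expf_neq0 _ g0)) nu0).
have w0 : w != 0 := mulf_neq0 (invr_neq0 g0) (mulf_neq0 (mulf_neq0 th0 v0) (invr_neq0 (expf_neq0 _ g0))).
have e2 : prin R (s * m) = prin R w.
  rewrite -es; apply/seteqP; split=> [_ [r Rr <-]|_ [_ [r Rr <-] <-]].
    by exists (r * m); [exists r|rewrite mulrCA].
  by exists r => //; rewrite mulrCA.
have s0 : s != 0.
  apply/eqP => s0; have [r _] : prin R (s * m) w by rewrite e2; exact: prin_gen.
  by rewrite s0 mul0r mulr0 => /esym w1; move/eqP: w0; apply.
exact: (prin_eq_unit hR (mulf_neq0 s0 m0) w0 e2).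
Qed.
End Stalks.

End BranchSection.

(** The denominators of [w] form an ideal of [A], and at the center of each valuation ring [w] has a
    denominator that is a unit. *)
Lemma local_global (F : fieldType) (A : set F) w : subr A -> (forall R, locz A R -> R w) -> A w.
Proof.
move=> hA h; have hI : ideal A [set b | A b /\ A (b * w)].
  split.
  - by move=> b [].
  - by split; rewrite ?mul0r; exact: subr0'.
  - by move=> x y [h1 h2] [h3 h4]; split; rewrite ?mulrBl; exact: subrB'.
  - by move=> a x Aa [h1 h2]; split; rewrite -?mulrA; exact: subrM'.
have [_] : [set b | A b /\ A (b * w)] 1; last by rewrite mul1r.
apply: (ideal_unit hA hI) => V hV AV.
have [hl hd] := centerP hA (val_local hV) AV.
have [_ _ hfr] := hl; have [a [b [Aa Ab ub ew]]] := hfr _ (h _ hl).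
exists b; last exact: unit_sub hd.1 ub.
by split=> //; rewrite ew mulrC divfK //; case: ub.
Qed.

Lemma branch_unit_change (F : fieldType) (s hh nu v th : F) l p : v != 0 -> nu != 0 ->
  s * hh ^+ p / th = s * ((nu ^+ p) ^+ l / v ^+ p) / th * (hh * v / nu ^+ l) ^+ p.
Proof.
move=> v0 nu0; rewrite !exprMn exprVn -!exprM [(l * p)%N]mulnC.
have [->|th0] := eqVneq th 0; first by rewrite invr0 !mulr0 mul0r.
by field; rewrite th0 !expf_neq0.
Qed.

Lemma solve_branch (F : fieldType) (s hh th u : F) p : th != 0 -> hh != 0 ->
  s * hh ^+ p / th = u -> s = u * th / hh ^+ p.
Proof. by move=> th0 h0 <-; field; rewrite th0 expf_neq0. Qed.

(** * The branch section up to a constant *)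

Section BranchFormula.
Variables (k : closedFieldType) (K : fieldType) (iota : {rmorphism k -> K}).
Variable C : set (set K).
Hypothesis hC : smooth_projective_curve (range iota) C.
Notation k0 := (range iota).
Variables (p : nat).
Hypothesis hp : p \in [pchar k].
Variables (D G : set K -> int) (f0 : K) (e l : nat).
Notation E := (raynaud_E p C D f0).
Notation L := (OD C D).
Notation Nl := (expS (OD C G) (e %/ l)).
Notation P := (raynaud_P C E).
Notation X := (ratX K).
Notation local_data := (local_data p D G f0 e l).
Hypothesis data_exists : forall Q, C Q -> exists v a nu, local_data Q v a nu.
Variables (theta s : ruled_field K) (hh : K).
Hypothesis theta_def : theta = X ^+ p + ratC f0.
Hypothesis hl : (l %| p.+1)%N.
Hypothesis hle : (l %| e)%N.
Hypothesis hs : branch_section l P (raynaud_M p l C E Nl) (ideal_E C E) (ideal_C'' p C E L theta) s.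
Hypothesis hh0 : hh != 0.
Hypothesis ord_hh : forall Q, prime_divisor C Q -> ord Q hh = D Q - e%:Z * G Q.

Lemma theta_neq0 : theta != 0.
Proof.
rewrite theta_def /ratX /ratC -rmorphXn -tofracD tofrac_eq0.
apply/eqP => /(congr1 (fun q : {poly K} => q`_p)).
rewrite coefD coefXn coefC coef0 eqxx eqn0Ngt (pchar_gt0 hp) /= addr0 => /eqP.
by rewrite oner_eq0.
Qed.

Lemma nu_over_v Q v a nu : C Q -> local_data Q v a nu -> unit_in Q (hh * v / nu ^+ l).
Proof.
move=> CQ [v0 nu0 h]; have n0 : hh * v / nu ^+ l != 0.
  by rewrite !mulf_neq0 // invr_eq0 expf_neq0.
have [eQ|dQ] := C_cases hC CQ; first by rewrite eQ.
have [ov onu _] := h dQ; apply/(ord_unit _ dQ); split=> //.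
rewrite !ordM ?mulf_neq0 ?invr_eq0 ?expf_neq0 // ordV // ordX // ov onu ord_hh //.
have -> : e%:Z = l%:Z * (e %/ l)%N%:Z by rewrite -PoszM mulnC divnK.
by ring.
Qed.

Let u := s * ratC hh ^+ p / theta.

Lemma u_unit R Q v a nu : P R -> subr R -> C Q -> dominates (@ratC K) R Q -> local_data Q v a nu ->
  R (fib v a) -> unit_in R u.
Proof.
move=> PR hR CQ dR hd Ry.
have := branch_unit hC hp hR CQ dR hd (or_introl (conj erefl Ry)) theta_neq0 hl PR hs.
have [w0 Qw Qw'] := nu_over_v CQ hd.
have v0 : ratC v != 0 by rewrite fmorph_eq0; case: hd.
have nu0 : ratC nu != 0 by rewrite fmorph_eq0; case: hd.
rewrite !rmorphXn /u (branch_unit_change s (ratC hh) theta l p v0 nu0) => h1.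
apply: (unitM hR h1); apply: (unitX hR).
have -> : ratC hh * ratC v / ratC nu ^+ l = ratC (hh * v / nu ^+ l).
  by rewrite -rmorphXn -fmorphV -!rmorphM.
split; first by rewrite fmorph_eq0.
  exact: dR.1.
by rewrite -fmorphV; exact: dR.1.
Qed.

Lemma poly_chart w : chart0 [set: K] 1 0 w -> exists q, w = FracField.tofrac q.
Proof.
move: w; apply: gen_min.
  split.
  - by exists 1; rewrite tofrac1.
  - by move=> _ _ [q ->] [q' ->]; exists (q - q'); rewrite tofracB.
  - by move=> _ _ [q ->] [q' ->]; exists (q * q'); rewrite tofracM.
move=> w [[c _ <-]|->]; first by exists c%:P.
by exists 'X; rewrite /fib rmorph1 rmorph0 mul1r addr0.
Qed.

Lemma generic1 : local_data [set: K] 1 0 1.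
Proof. by apply: generic_data; exact: oner_neq0. Qed.

(** On the affine line over [K], the generic fibre of P without E, both [u] and its inverse are
    regular, i.e. polynomials in x; so [u] has degree 0. *)
Lemma u_scalar : exists u0, u = ratC u0.
Proof.
have hA : subr (chart0 [set: K] 1 0) by exact: gen_subr.
have ul R : locz (chart0 [set: K] 1 0) R -> unit_in R u.
  move=> hR; have [lR AR _] := hR; have sR := local_subr lR.
  apply: (u_unit _ sR (C_generic hC) _ generic1).
  - by apply: (P_point hC hp (C_generic hC) generic1); left.
  - by apply: generic_dominates => c; apply: AR; apply: gen_sub; left; exists c.
  - by apply: AR; apply: gen_sub; right.
have Au : chart0 [set: K] 1 0 u by apply: (local_global hA) => R /ul [].
have Au' : chart0 [set: K] 1 0 u^-1 by apply: (local_global hA) => R /ul [].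
have [q eq] := poly_chart Au; have [q' eq'] := poly_chart Au'.
have valT : valring [set: ruled_field K] by split; [exact: subrT|left].
have [hT _] := centerP hA (val_local valT) (fun _ _ => I).
have [u0 _ _] := ul _ hT.
have qq : q * q' = 1.
  by apply/eqP; rewrite -tofrac_eq tofracM -eq -eq' tofrac1 (mulfV u0).
have q0 : q != 0 by rewrite -tofrac_eq0 -eq.
have q0' : q' != 0 by rewrite -tofrac_eq0 -eq' invr_neq0.
have := congr1 (fun r : {poly K} => size r) qq; rewrite size_mul // size_poly1 => sz.
have /eqP/size_poly1P [c c0 ec] : size q = 1%N.
  have := size_poly_gt0 q; have := size_poly_gt0 q'; rewrite q0 q0'; clear -sz; lia.
by exists c; rewrite eq ec.
Qed.

(** Evaluation at x = -a, the section y = 0, maps Q[y] to Q and shows that t is no unit in Q[y]. A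
    valuation ring with t in its maximal ideal then has its center over Q. *)
Lemma point_over Q v a nu : C Q -> dvr Q -> local_data Q v a nu ->
  exists R, [/\ P R, subr R, dominates (@ratC K) R Q & R (fib v a)].
Proof.
move=> CQ dQ hd; have [t ht] := dQ; have t0 := unif_neq0 ht; have hQ := C_subr hC CQ.
pose A := chart0 Q v a; have hA : subr A by exact: gen_subr.
have AC c : Q c -> A (ratC c) by move=> Qc; apply: gen_sub; left; exists c.
have hev w : A w -> exists q : {poly K}, w = FracField.tofrac q /\ Q q.[- a].
  move: w; apply: gen_min.
    split.
    - by exists 1; rewrite tofrac1 hornerC; split=> //; exact: subr1.
    - move=> _ _ [q [-> h]] [q' [-> h']]; exists (q - q'); rewrite tofracB hornerD hornerN.
      by split=> //; exact: subrB'.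
    - move=> _ _ [q [-> h]] [q' [-> h']]; exists (q * q'); rewrite tofracM hornerM.
      by split=> //; exact: subrM'.
  move=> w [[c Qc <-]|->]; first by exists c%:P; rewrite hornerC.
  exists (v%:P * ('X + a%:P)); rewrite tofracM tofracD; split=> //.
  by rewrite hornerM hornerD hornerX !hornerC addNr mulr0; exact: subr0'.
pose J := [set w | exists2 x, A x & w = ratC t * x].
have At : A (ratC t) by apply: AC; case: ht.
have hJ : ideal A J.
  split.
  - by move=> _ [x Ax ->]; exact: (subrM' hA).
  - by exists 0; [exact: (subr0' hA)|rewrite mulr0].
  - by move=> _ _ [x Ax ->] [x' Ax' ->]; exists (x - x'); [exact: (subrB' hA)|rewrite mulrBr].
  - by move=> w _ Aw [x Ax ->]; exists (w * x); [exact: (subrM' hA)|rewrite mulrCA].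
have J1 : ~ J 1.
  move=> [x /hev [q [-> Qq]] /eqP]; rewrite /ratC -tofracM -tofrac1 tofrac_eq => /eqP e1.
  have := congr1 (fun r : {poly K} => r.[- a]) e1; rewrite hornerM !hornerC => e2.
  case: (ht) => _ _ _ nt _; apply: nt.
  by rewrite -[t^-1]mulr1 e2 mulrA mulVf // mul1r.
have [V [hV AV nV]] := val_exists hA hJ J1.
have [hloc hdom] := centerP hA (val_local hV) AV.
exists (center A V); have [lR AR _] := hloc; have hR := local_subr lR; split=> //.
- by apply: (P_point hC hp CQ hd); left.
- split=> [c Qc|c Qc Rc]; first by apply: AR; exact: AC.
  have [->|c0] := eqVneq c 0; first by rewrite invr0; exact: subr0'.
  apply: contrapT => nc.
  have oc : 1 <= ord Q c.
    have h1 : 0 <= ord Q c by rewrite -(ord_ge0 dQ).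
    have h2 : ~ (ord Q c = 0).
      by move=> oc; apply: nc; have [] := (ord_unit c dQ).2 (conj c0 oc).
    by clear -h1 h2; lia.
  have Qct : Q (c / t).
    rewrite (ord_ge0 dQ) ?mulf_neq0 ?invr_eq0 // ordM ?invr_eq0 // ordV // (ord_unif ht).
    by rewrite subr_ge0.
  apply: (nV (ratC t)).
    by exists 1; [exact: (subr1 hA)|rewrite mulr1].
  have rc0 : ratC c != 0 by rewrite fmorph_eq0.
  have e1 : ratC t * (ratC (c / t) * (ratC c)^-1) = 1.
    by rewrite mulrA -rmorphM [t * _]mulrC divfK // mulfV.
  apply: (@unitMl _ V hV.1 _ (ratC (c / t) * (ratC c)^-1)).
  - exact: AV.
  - by apply: (subrM' hV.1); [apply: AV; exact: AC|exact: hdom.1].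
  - by rewrite e1; exact: unit1 hV.1.
- by apply: AR; apply: gen_sub; right.
Qed.

(** The function of [u_scalar] is regular at every point of [C], as is seen at some point of P above
    it; so it is a constant. *)
Lemma branch_formula : exists c, s = ratC (iota c) * theta / ratC hh ^+ p.
Proof.
have [u0 eu] := u_scalar.
have hu : forall Q, C Q -> Q u0.
  move=> Q CQ; have [->//|dQ] := C_cases hC CQ.
  have [v [a [nu hd]]] := data_exists CQ.
  have [R [PR hR dR Ry]] := point_over CQ dQ hd.
  have [u00 Ru Ru'] := u_unit PR hR CQ dR hd Ry; rewrite eu in Ru Ru'.
  have [//|Qu'] := (C_valring hC CQ).2 u0.
  by rewrite -[u0]invrK; apply: dR.2 => //; rewrite fmorphV invrK.
have [c _ ec] := global_const hC hu; exists c.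
have h0 : ratC hh != 0 by rewrite fmorph_eq0.
by apply: (solve_branch theta_neq0 h0); rewrite ec.
Qed.

End BranchFormula.

(** * Charts of the cyclic cover *)

Section ChangeOfChart.
Variable F : fieldType.
Implicit Types A S : set F.

Lemma nonunit_inv S y : subr S -> y != 0 -> S y^-1 -> ~ S y -> ~ unit_in S y^-1.
Proof. by move=> hS y0 h n [_ _]; rewrite invrK. Qed.

Definition ring2 A (x x' : F) := gen_ring (A `|` ([set x] `|` [set x'])).

Lemma ring2_subr A x x' : subr (ring2 A x x'). Proof. exact: gen_subr. Qed.
Lemma ring2_base A x x' c : A c -> ring2 A x x' c.
Proof. by move=> Ac; apply: gen_sub; left. Qed.
Lemma ring2_l A x x' : ring2 A x x' x.
Proof. by apply: gen_sub; right; left. Qed.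
Lemma ring2_r A x x' : ring2 A x x' x'.
Proof. by apply: gen_sub; right; right. Qed.
Lemma ring2_min A x x' S : subr S -> A `<=` S -> S x -> S x' -> ring2 A x x' `<=` S.
Proof. by move=> hS AS Sx Sx'; apply: (gen_min hS) => w [/AS//|[->|->]]. Qed.

Lemma ring2_frac A x x' B S : subr A -> subr B -> subr S -> A `<=` B -> B `<=` S ->
  locz (ring2 A x x') S ->
  (exists a c, [/\ B a, B c, unit_in S c & x = a / c]) ->
  (exists a c, [/\ B a, B c, unit_in S c & x' = a / c]) -> locz B S.
Proof.
move=> hA hB hS AB BS hl hx hx'; apply: (locz_trans hB hl BS).
apply: (frac_gen hB hS BS) => w [Aw|[->//|->//]].
by exists w, 1; split; [exact: AB|exact: subr1|exact: unit1|rewrite divr1].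
Qed.

(** If y is regular at [S], only the generators change. Otherwise 1/y is a non-unit, so al + be/y is
    a unit, and the new generators at infinity are unit multiples of the old ones. The clause that
    the new coordinate is not regular keeps the two cases disjoint. *)
Lemma change_of_chart A S (y xi al be ga : F) b : subr A -> islocal S -> A `<=` S ->
  y != 0 -> al * y + be != 0 -> unit_in A al -> A be -> unit_in A ga ->
  locz (ring2 A y xi) S \/ locz (ring2 A y^-1 (y ^- b * xi)) S ->
  locz (ring2 A (al * y + be) (ga * xi)) S \/
  (locz (ring2 A (al * y + be)^-1 ((al * y + be) ^- b * (ga * xi))) S /\ ~ S (al * y + be)).
Proof.
move=> hA lS AS y0 y0' [al0 Aal Aal'] Abe [ga0 Aga Aga'] hl.
have hS := local_subr lS.
have hB := @ring2_subr A (al * y + be) (ga * xi).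
have [Sy|nSy] := pselect (S y).
  left; have hl0 : locz (ring2 A y xi) S.
    case: hl => // hl; have [_ BS _] := hl.
    have Sy' : S y^-1 by apply: BS; exact: ring2_l.
    have Sxi : S xi.
      have -> : xi = y ^+ b * (y ^- b * xi) by rewrite mulrA divff ?mul1r ?expf_neq0.
      by apply: (subrM' hS); [exact: subrX'|apply: BS; exact: ring2_r].
    have h0 : subr (ring2 A y xi) by exact: ring2_subr.
    apply: (ring2_frac hA h0 hS _ _ hl).
    - by move=> c; exact: ring2_base.
    - exact: ring2_min.
    - exists 1, y; split; [exact: (subr1 h0)|exact: ring2_l|by split|by rewrite div1r].
    - exists xi, (y ^+ b); split; [exact: ring2_r|apply: (subrX' h0); exact: ring2_l| |by rewrite mulrC].
      by apply: (unitX hS); split.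
  have [_ BS _] := hl0; apply: (ring2_frac hA hB hS _ _ hl0).
  - by move=> c; exact: ring2_base.
  - apply: (ring2_min hS AS).
      by apply: (subrD' hS); [apply: (subrM' hS)|]; [exact: AS|exact: Sy|exact: AS].
    by apply: (subrM' hS); [exact: AS|apply: BS; exact: ring2_r].
  - exists (al^-1 * (al * y + be - be)), 1; split; [|exact: (subr1 hB)|exact: unit1|by rewrite addrK mulKf // divr1].
    apply: (subrM' hB); first exact: ring2_base.
    by apply: (subrB' hB); [exact: ring2_l|exact: ring2_base].
  - exists (ga^-1 * (ga * xi)), 1; split; [|exact: (subr1 hB)|exact: unit1|by rewrite mulKf // divr1].
    by apply: (subrM' hB); [exact: ring2_base|exact: ring2_r].
have {}hl : locz (ring2 A y^-1 (y ^- b * xi)) S.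
  by case: hl => // -[_ BS _]; case: nSy; apply: BS; exact: ring2_l.
have [_ BS _] := hl.
have Sy' : S y^-1 by apply: BS; exact: ring2_l.
have Sxi : S (y ^- b * xi) by apply: BS; exact: ring2_r.
set y' := al * y + be in y0' hB *.
have nSy' : ~ S y'.
  move=> h; apply: nSy; have -> : y = al^-1 * (y' - be) by rewrite /y' addrK mulKf.
  by apply: (subrM' hS); [exact: AS|apply: (subrB' hS) => //; exact: AS].
pose om := al + be * y^-1.
have Sbe : S (be * y^-1) by apply: (subrM' hS) => //; exact: AS.
have uom : unit_in S om.
  have ual : unit_in S (om + - (be * y^-1)) by rewrite /om addrK; split=> //; exact: AS.
  have Som : S om by apply: (subrD' hS) => //; exact: AS.
  case: (lS.2 _ _ Som (subrN' hS Sbe) ual) => // /(unitN hS); rewrite opprK => h; exfalso.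
  by apply: (nonunit_inv hS y0 Sy' nSy); apply: unitMr h => //; exact: AS.
have eom : y' = y * om by rewrite /om /y' mulrDr mulrCA mulfV // mulr1 mulrC.
have om0 : om != 0 by case: uom.
have ew : 1 - be * y'^-1 = al * y * y'^-1.
  by rewrite -[X in X - _](divff y0') -mulrBl /y' addrK.
have uw : unit_in S (1 - be * y'^-1).
  have -> : 1 - be * y'^-1 = al / om by rewrite ew eom; field; rewrite y0 om0.
  by apply: (unitM hS); [split=> //; exact: AS|exact: unitV].
right; split=> //.
have hB1 := @ring2_subr A y'^-1 (y' ^- b * (ga * xi)).
have Bw : ring2 A y'^-1 (y' ^- b * (ga * xi)) (1 - be * y'^-1).
  apply: (subrB' hB1); first exact: (subr1 hB1).
  by apply: (subrM' hB1); [exact: ring2_base|exact: ring2_l].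
have w0 : 1 - be * y'^-1 != 0 by case: uw.
apply: (ring2_frac hA hB1 hS _ _ hl).
- by move=> c; exact: ring2_base.
- apply: (ring2_min hS AS).
    by rewrite eom invfM; apply: (subrM' hS) => //; case: uom.
  have -> : y' ^- b * (ga * xi) = ga * ((om^-1) ^+ b * (y ^- b * xi)).
    by rewrite eom exprMn exprVn; field; rewrite !expf_neq0.
  by apply: (subrM' hS); [exact: AS|apply: (subrM' hS) => //; apply: (subrX' hS); case: uom].
- exists (al * y'^-1), (1 - be * y'^-1); split.
  + by apply: (subrM' hB1); [exact: ring2_base|exact: ring2_l].
  + exact: Bw.
  + exact: uw.
  + by rewrite ew; field; rewrite al0 y0 y0'.
- exists (ga^-1 * al ^+ b * (y' ^- b * (ga * xi))), ((1 - be * y'^-1) ^+ b); split.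
  + apply: (subrM' hB1); last exact: ring2_r.
    by apply: ring2_base; apply: (subrM' hA) => //; exact: subrX'.
  + exact: (subrX' hB1).
  + exact: (unitX hS).
  + by rewrite ew !exprMn exprVn; field; rewrite ga0 !expf_neq0.
Qed.
End ChangeOfChart.

Lemma equation_identity (F : fieldType) (A c th ih vp : F) : vp != 0 ->
  A * (c * th * ih) = c * (A * (ih * vp^-1)) * (vp * th).
Proof. by move=> h; field. Qed.

Section CoverCharts.
Variables (k : closedFieldType) (K : fieldType) (iota : {rmorphism k -> K}).
Variable C : set (set K).
Hypothesis hC : smooth_projective_curve (range iota) C.
Notation k0 := (range iota).
Variables (p : nat).
Hypothesis hp : p \in [pchar k].
Variables (D G : set K -> int) (f0 : K) (e l : nat).
Notation E := (raynaud_E p C D f0).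
Notation L := (OD C D).
Notation Nl := (expS (OD C G) (e %/ l)).
Notation P := (raynaud_P C E).
Notation X := (ratX K).
Notation local_data := (local_data p D G f0 e l).
Hypothesis data_exists : forall Q, C Q -> exists v a nu, local_data Q v a nu.
Variables (F : fieldType) (kappa : {rmorphism ruled_field K -> F}) (z : F).
Notation J := (kappa \o @ratC K).
Notation M := (raynaud_M p l C E Nl).
Notation Xs := (cyclic_cover kappa P M z).
Notation b := (p.+1 %/ l)%N.
Notation yy v a := (kappa (fib v a)).
Notation xi nu := (kappa (ratC (nu ^+ p)) * z).

Definition cover_chart0 Q v a nu := ring2 (J @` Q) (yy v a) (xi nu).
Definition cover_chart1 Q v a nu := ring2 (J @` Q) (yy v a)^-1 ((yy v a) ^- b * xi nu).

Lemma image_subr Q : subr Q -> subr (J @` Q).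
Proof.
move=> hQ; split; first by exists 1; [exact: subr1|rewrite rmorph1].
- by move=> _ _ [x Qx <-] [x' Qx' <-]; exists (x - x'); [exact: subrB'|rewrite rmorphB].
- by move=> _ _ [x Qx <-] [x' Qx' <-]; exists (x * x'); [exact: subrM'|rewrite rmorphM].
Qed.

Lemma preim_local (S : set F) : islocal S -> islocal (kappa @^-1` S).
Proof.
move=> [hS hl]; have un x : unit_in (kappa @^-1` S) x <-> unit_in S (kappa x).
  by rewrite /unit_in /= fmorph_eq0 fmorphV.
split; last first.
  move=> x y /= Sx Sy /un; rewrite rmorphD => /(hl _ _ Sx Sy) [] h; [left|right]; exact/un.
split; rewrite /= ?rmorph1; first exact: subr1.
- by move=> x y /= hx hy; rewrite rmorphB; exact: subrB'.
- by move=> x y /= hx hy; rewrite rmorphM; exact: subrM'.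
Qed.

Lemma chart_image Q (g : ruled_field K) (T : set F) : subr T ->
  (forall c, Q c -> T (kappa (ratC c))) -> T (kappa g) ->
  forall w, gen_ring (@ratC K @` Q `|` [set g]) w -> T (kappa w).
Proof.
move=> hT TQ Tg; apply: gen_min.
  split; rewrite ?rmorph1; first exact: subr1.
  - by move=> x y hx hy; rewrite rmorphB; exact: subrB'.
  - by move=> x y hx hy; rewrite rmorphM; exact: subrM'.
by move=> w [[c Qc <-]|->//]; exact: TQ.
Qed.

(* [gg] is the coordinate of one of the two charts of P over Q, and [g] the
   local generator of O_P(1) there. *)
Section OneChart.
Variables (Q : set K) (v a nu : K) (gg g : ruled_field K).
Hypotheses (CQ : C Q) (hd : local_data Q v a nu).
Hypothesis hg : (gg = fib v a /\ g = 1) \/ (gg = (fib v a)^-1 /\ g = fib v a).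
Let xg := kappa (g ^- b * ratC (nu ^+ p)) * z.

Lemma chart_gg : gen_ring (@ratC K @` Q `|` [set gg]) = chart0 Q v a \/
  gen_ring (@ratC K @` Q `|` [set gg]) = chart1 Q v a.
Proof. by case: hg => -[-> _]; [left|right]. Qed.

(** The point of P below [S] is the center of the preimage of [S]. There [M] is principal, so
    adjoining [M z] amounts to adjoining the single element [xg]. *)
Lemma locz_cover (S : set F) : dominates J S Q ->
  locz (ring2 (J @` Q) (kappa gg) xg) S -> Xs S.
Proof.
move=> dS hl; have [lS BS _] := hl; have hS := local_subr lS; have hQ := C_subr hC CQ.
set A := gen_ring (@ratC K @` Q `|` [set gg]).
have hA : subr A by exact: gen_subr.
have AS : A `<=` kappa @^-1` S.
  apply: chart_image => //; first by move=> c Qc; exact: dS.1.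
  by apply: BS; exact: ring2_l.
have [hR [RS Rinv]] := centerP hA (preim_local lS) AS; set R := center A _ in hR RS Rinv.
have [lR AR _] := hR; have sR := local_subr lR.
have PR : P R.
  apply: (P_point hC hp CQ hd); rewrite /A in hR; case: chart_gg => ech; rewrite ech in hR; [by left|by right].
have dR : dominates (@ratC K) R Q.
  split=> c Qc; first by apply: AR; apply: gen_sub; left; exists c.
  by move=> /RS /=; rewrite fmorphV; exact: dS.2.
have Rg : g = 1 /\ R (fib v a) \/ g = fib v a /\ R (fib v a)^-1.
  have Rgg : R gg by apply: AR; apply: gen_sub; right.
  by case: hg => -[e1 e2]; [left|right]; rewrite -e1.
have eM := stalk_M hC hp sR CQ dR hd Rg.
exists R => //; apply/SpecP; first exact: gen_subr.
set T := gen_ring _.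
have hT : subr T by exact: gen_subr.
apply: (locz_mono hl).
  apply: (ring2_min hT).
  - by move=> _ [c Qc <-]; apply: gen_sub; left; exists (ratC c) => //; exact: dR.1.
  - by apply: gen_sub; left; exists gg => //; apply: AR; apply: gen_sub; right.
  - apply: gen_sub; right; exists (g ^- b * ratC (nu ^+ p)) => //; rewrite eM; exact: prin_gen.
apply: (gen_min hS) => w [[r Rr <-]|[m + <-]]; first exact: RS.
rewrite eM => -[r Rr <-]; rewrite rmorphM -mulrA; apply: (subrM' hS); first exact: RS.
by apply: BS; exact: ring2_r.
Qed.

Lemma cover_locz (R : set (ruled_field K)) (S : set F) :
  subr R -> dominates (@ratC K) R Q -> locz (gen_ring (@ratC K @` Q `|` [set gg])) R ->
  locz (gen_ring (kappa @` R `|` [set kappa m * z | m in M R])) S ->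
  locz (ring2 (J @` Q) (kappa gg) xg) S.
Proof.
move=> sR dR hR hl; have [lS TS _] := hl; have hS := local_subr lS; have hQ := C_subr hC CQ.
have [_ AR hfr] := hR.
have Rg : g = 1 /\ R (fib v a) \/ g = fib v a /\ R (fib v a)^-1.
  have Rgg : R gg by apply: AR; apply: gen_sub; right.
  by case: hg => -[e1 e2]; [left|right]; rewrite -e1.
have eM := stalk_M hC hp sR CQ dR hd Rg.
have hB : subr (ring2 (J @` Q) (kappa gg) xg) by exact: ring2_subr.
have kS r : R r -> S (kappa r) by move=> Rr; apply: TS; apply: gen_sub; left; exists r.
have Sx : S xg.
  by apply: TS; apply: gen_sub; right; exists (g ^- b * ratC (nu ^+ p)) => //; rewrite eM; exact: prin_gen.
have BS : ring2 (J @` Q) (kappa gg) xg `<=` S.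
  apply: (ring2_min hS) => //; first by move=> _ [c Qc <-]; apply: kS; exact: dR.1.
  by apply: kS; apply: AR; apply: gen_sub; right.
have AB w : gen_ring (@ratC K @` Q `|` [set gg]) w -> ring2 (J @` Q) (kappa gg) xg (kappa w).
  apply: chart_image => //; last exact: ring2_l.
  by move=> c Qc; apply: ring2_base; exists c.
have fr r : R r -> exists x c, [/\ ring2 (J @` Q) (kappa gg) xg x,
     ring2 (J @` Q) (kappa gg) xg c, unit_in S c & kappa r = x / c].
  move=> /hfr [x [c [Ax Ac [c0 Rc Rc'] ->]]]; exists (kappa x), (kappa c); split; [exact: AB|exact: AB| |].
    by split; [rewrite fmorph_eq0|exact: kS|rewrite -fmorphV; exact: kS].
  by rewrite fmorph_div.
apply: (locz_trans hB hl BS); apply: (frac_gen hB hS BS) => w [[r Rr <-]|[m + <-]]; first exact: fr.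
rewrite eM => -[r Rr <-]; have [x [c [Bx Bc uc e1]]] := fr r Rr.
exists (x * xg), c; split=> //; first by apply: (subrM' hB) => //; exact: ring2_r.
by rewrite rmorphM e1 -(mulrA (x / c)) mulrAC.
Qed.
End OneChart.

Lemma xg1 nu : kappa ((1 : ruled_field K) ^- b * ratC (nu ^+ p)) * z = xi nu.
Proof. by rewrite expr1n invr1 mul1r. Qed.

Lemma xg2 v a nu : kappa ((fib v a) ^- b * ratC (nu ^+ p)) * z = (yy v a) ^- b * xi nu.
Proof. by rewrite rmorphM fmorphV rmorphXn mulrA. Qed.

Lemma ring2_base_mono (A B : set F) x x' : A `<=` B -> ring2 A x x' `<=` ring2 B x x'.
Proof. by move=> AB; apply: gen_mono => w [/AB|]; [left|right]. Qed.

Lemma data_change Q v a nu v' a' nu' : C Q -> local_data Q v a nu -> local_data Q v' a' nu' ->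
  [/\ unit_in Q (v' / v), Q (v' * (a' - a)) & unit_in Q ((nu' / nu) ^+ p)].
Proof.
move=> CQ [v0 nu0 h] [v0' nu0' h']; have hQ := C_subr hC CQ.
have vv0 : v' / v != 0 by rewrite mulf_neq0 ?invr_eq0.
have nn0 : nu' / nu != 0 by rewrite mulf_neq0 ?invr_eq0.
have [eQ|dQ] := C_cases hC CQ.
  by rewrite eQ; split=> //; split=> //; rewrite expf_neq0.
have [ov onu ha] := h dQ; have [ov' onu' ha'] := h' dQ; split.
- by apply/(ord_unit _ dQ); split=> //; rewrite ordM ?invr_eq0 // ordV // ov ov' subrr.
- apply/(ordge0P _ dQ); have hv : ordge Q (- D Q) v' by right; rewrite ov'.
  by have := ordgeM dQ hv (root_sub iota hp dQ ha ha'); rewrite addNr.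
- apply: (unitX hQ); apply/(ord_unit _ dQ); split=> //.
  by rewrite ordM ?invr_eq0 // ordV // onu onu' subrr.
Qed.

(** Any local data at the point of [C] below [S] may be used, by [change_of_chart]. A point whose
    chart lies over [Q] but which does not dominate [Q] is moved to the generic point of [C]
    first. *)
Lemma cover_charts S : Xs S -> islocal S /\ exists Q, [/\ C Q, dominates J S Q &
  forall v a nu, local_data Q v a nu ->
    locz (cover_chart0 Q v a nu) S \/ (locz (cover_chart1 Q v a nu) S /\ ~ S (yy v a))].
Proof.
move=> [R PR] /(SpecP _ (@gen_subr _ _)) hl; have [lS TS _] := hl.
have hS := local_subr lS; split=> //.
have [Q [v [a [nu [CQ dR hd hch]]]]] := P_chart hC hp data_exists PR.
have sR : subr R by case: hch => -[[]].
have h1 : locz (cover_chart0 Q v a nu) S \/ locz (cover_chart1 Q v a nu) S.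
  case: hch => hch; [left|right].
    have := cover_locz CQ hd (or_introl (conj erefl erefl)) sR dR hch hl.
    by rewrite xg1.
  have := cover_locz CQ hd (or_intror (conj erefl erefl)) sR dR hch hl.
  by rewrite xg2 fmorphV.
have [Q' [v' [a' [nu' [CQ' dS hd' h2]]]]] : exists Q v a nu, [/\ C Q, dominates J S Q,
    local_data Q v a nu & locz (cover_chart0 Q v a nu) S \/ locz (cover_chart1 Q v a nu) S].
  have QS c : Q c -> S (J c).
    by move=> Qc; apply: TS; apply: gen_sub; left; exists (ratC c) => //; exact: dR.1.
  have [dQ|dK] := dominated_or_generic hC hS CQ QS; first by exists Q, v, a, nu.
  exists [set: K], v, a, nu; split; [exact: C_generic hC|exact: generic_dominates| |].
    by case: hd => v0 nu0 _; exact: generic_data.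
  have sub x x' : ring2 (J @` Q) x x' `<=` S -> ring2 (J @` [set: K]) x x' `<=` S.
    move=> h; apply: (ring2_min hS); first by move=> _ [c _ <-]; exact: dK.
      by apply: h; exact: ring2_l.
    by apply: h; exact: ring2_r.
  have inc : J @` Q `<=` J @` [set: K] by move=> _ [c _ <-]; exists c.
  case: h1 => h; [left|right]; apply: (locz_mono h (ring2_base_mono inc)); apply: sub; by case: h.
exists Q'; split=> // v1 a1 nu1 hd1.
have [uv Qva [n0 Qn Qn']] := data_change CQ' hd' hd1.
have hQ' := C_subr hC CQ'; case: uv => vv0 Qv Qv'.
have JQ c : Q' c -> (J @` Q') (J c) by exists c.
have ey : yy v1 a1 = J (v1 / v') * yy v' a' + J (v1 * (a1 - a')).
  have v0 : v' != 0 by case: hd'.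
  rewrite /= -rmorphM -rmorphD; congr (kappa _).
  rewrite /fib mulrA -rmorphM divfK // rmorphM rmorphB; ring.
have ex : xi nu1 = J ((nu1 / nu') ^+ p) * xi nu'.
  have nu0 : nu' != 0 by case: hd'.
  by rewrite mulrA /= -rmorphM -rmorphM -exprMn divfK.
have y0 : yy v' a' != 0 by rewrite fmorph_eq0; apply: fib_neq0; case: hd'.
have y01 : yy v1 a1 != 0 by rewrite fmorph_eq0; apply: fib_neq0; case: hd1.
rewrite /cover_chart0 /cover_chart1 ex ey; rewrite ey in y01.
apply: (change_of_chart (image_subr hQ') lS _ y0 y01 _ _ _ h2).
- by move=> _ [c Qc <-]; exact: dS.1.
- by split; [rewrite fmorph_eq0|exact: JQ|rewrite -fmorphV; exact: JQ].
- exact: JQ.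
- by split; [rewrite fmorph_eq0|exact: JQ|rewrite -fmorphV; exact: JQ].
Qed.

Variables (theta s : ruled_field K) (hh : K) (c0 : k).
Hypothesis theta_def : theta = X ^+ p + ratC f0.
Hypothesis hl : (l %| p.+1)%N.
Hypothesis l0 : (0 < l)%N.
Hypothesis s_def : s = ratC (iota c0) * theta / ratC hh ^+ p.
Hypothesis hh0 : hh != 0.
Hypothesis zl : z ^+ l = kappa s.

Definition beta v a := v ^+ p * (f0 - a ^+ p).
(** The unit u in x'^l = u (y^p + beta). It is a p-th power up to a constant, and for this reason
    all derivations kill it. *)
Definition unit_coef v nu := iota c0 * (nu ^+ l / (hh * v)) ^+ p.

Lemma theta_fib v a : ratC (v ^+ p) * theta = fib v a ^+ p + ratC (beta v a).
Proof.
rewrite theta_def /fib /beta exprMn (exprDp (pchar_ruled iota hp)) rmorphM rmorphB !rmorphXn; ring.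
Qed.

Lemma cover_equation v a nu : v != 0 ->
  xi nu ^+ l = J (unit_coef v nu) * (yy v a ^+ p + J (beta v a)).
Proof.
move=> v0.
have h : ratC (nu ^+ p) ^+ l * s = ratC (unit_coef v nu) * (fib v a ^+ p + ratC (beta v a)).
  rewrite -theta_fib s_def /unit_coef exprMn exprVn exprMn invfM !rmorphM !fmorphV !rmorphXn -!exprM [(l * p)%N]mulnC.
  have rv0 : ratC v ^+ p != 0 by apply: expf_neq0; rewrite fmorph_eq0.
  exact: equation_identity.
by rewrite exprMn zl; have := congr1 kappa h; rewrite rmorphM [X in X * _]rmorphXn rmorphM rmorphD [X in X + _]rmorphXn.
Qed.

End CoverCharts.

Lemma cover_identity (F : fieldType) (y u be : F) p : y != 0 ->
  y ^- p.+1 * (u * (y ^+ p + be)) = u * (1 + be * y^-1 ^+ p) * y^-1.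
Proof. by move=> y0; rewrite exprVn exprS; field; rewrite y0 expf_neq0. Qed.

(** * Properness and function field of the cyclic cover *)

Section CoverPoints.
Variables (k : closedFieldType) (K : fieldType) (iota : {rmorphism k -> K}).
Variable C : set (set K).
Hypothesis hC : smooth_projective_curve (range iota) C.
Notation k0 := (range iota).
Variables (p : nat).
Hypothesis hp : p \in [pchar k].
Variables (D G : set K -> int) (f0 : K) (e l : nat).
Notation E := (raynaud_E p C D f0).
Notation L := (OD C D).
Notation Nl := (expS (OD C G) (e %/ l)).
Notation P := (raynaud_P C E).
Notation X := (ratX K).
Notation local_data := (local_data p D G f0 e l).
Hypothesis data_exists : forall Q, C Q -> exists v a nu, local_data Q v a nu.
Variables (F : fieldType) (kappa : {rmorphism ruled_field K -> F}) (z : F).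
Notation J := (kappa \o @ratC K).
Notation M := (raynaud_M p l C E Nl).
Notation Xs := (cyclic_cover kappa P M z).
Notation b := (p.+1 %/ l)%N.
Notation yy v a := (kappa (fib v a)).
Notation xi nu := (kappa (ratC (nu ^+ p)) * z).
Variables (theta s : ruled_field K) (hh : K) (c0 : k).
Hypothesis theta_def : theta = X ^+ p + ratC f0.
Hypothesis hl : (l %| p.+1)%N.
Hypothesis l1 : (1 < l)%N.
Hypothesis s_def : s = ratC (iota c0) * theta / ratC hh ^+ p.
Hypothesis hh0 : hh != 0.
Hypothesis hz : radical_extension kappa l s z.
Hypothesis unit_ratio : forall Q v a nu, C Q -> local_data Q v a nu -> unit_in Q (hh * v / nu ^+ l).
Notation uc v nu := (unit_coef iota p l hh c0 v nu).
Notation bt v a := (beta p f0 v a).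

Let l0 : (0 < l)%N := ltnW l1.

Lemma cover_eq v a nu : v != 0 -> xi nu ^+ l = J (uc v nu) * (yy v a ^+ p + J (bt v a)).
Proof. exact: (cover_equation hp theta_def s_def hz.1). Qed.

Lemma bl : (b * l)%N = p.+1.
Proof. by rewrite divnK. Qed.

(** Dividing x'^l by y^(p+1) = (y^b)^l leaves exactly one factor 1/y, which reflects that E is a
    simple component of the branch divisor. *)
Lemma cover_eq1 v a nu : v != 0 -> (yy v a ^- b * xi nu) ^+ l =
  J (uc v nu) * (1 + J (bt v a) * (yy v a)^-1 ^+ p) * (yy v a)^-1.
Proof.
move=> v0; rewrite exprMn (cover_eq a nu v0) [_ ^- b ^+ l]exprVn -exprM bl.
apply: cover_identity; by rewrite fmorph_eq0 fib_neq0.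
Qed.

(** If s were 0, then z = 0, and 0 would have two expansions in 1, z, ..., z^(l-1), because l >=
    2. *)
Lemma radical_neq0 : s != 0.
Proof.
apply/eqP => s0; have z0 : z = 0.
  by apply/eqP; have := expf_eq0 z l; rewrite hz.1 s0 rmorph0 eqxx l0 => /esym.
have [c [_ un]] := hz.2 0.
have e1 := un [ffun=> 0] _; have e2 := un [ffun i : 'I_l => (val i == 1%N)%:R] _.
have : c (Ordinal l1) = 1.
  rewrite e2; first by rewrite ffunE.
  by rewrite big1 // => i _; rewrite ffunE z0; case: eqP => [->|_]; rewrite ?expr1 ?mulr0 ?rmorph0 ?mul0r.
rewrite e1; first by rewrite ffunE => /esym/eqP; rewrite oner_eq0.
by rewrite big1 // => i _; rewrite ffunE rmorph0 mul0r.
Qed.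

Lemma c0_neq0 : c0 != 0.
Proof.
apply/eqP => e0; have := radical_neq0; by rewrite s_def e0 !rmorph0 !mul0r eqxx.
Qed.

Lemma uc_unit Q v a nu : C Q -> local_data Q v a nu -> unit_in Q (uc v nu).
Proof.
move=> CQ hd; have hQ := C_subr hC CQ; apply: (unitM hQ).
  apply: (unit_sub (C_k0 hC CQ)); exact: const_unit c0_neq0.
apply: (unitX hQ); have := unitV (unit_ratio CQ hd); by rewrite invf_div.
Qed.

Lemma bt_mem Q v a nu : C Q -> local_data Q v a nu -> Q (bt v a).
Proof. by move=> CQ hd; have [] := root_mem hC hp CQ hd. Qed.

Lemma z_neq0 : z != 0.
Proof.
by have := radical_neq0; rewrite -(fmorph_eq0 kappa) -hz.1 expf_eq0 l0.
Qed.

(** Over the point of [C] below [V], either y or 1/y is in [V]; the matching generator x' or y^-b x'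
    is integral over the rest, so it is in [V] as well. *)
Lemma cover_proper (V : set F) : valring V -> (forall c, V (J (iota c))) ->
  exists2 S, Xs S & dom V S.
Proof.
move=> hV kV; have [Q CQ dQ] := C_center hC hV kV; have [v [a [nu hd]]] := data_exists CQ.
have lV := val_local hV; have sV := hV.1; have v0 : v != 0 by case: hd.
have ldef : l = l.-1.+1 by rewrite prednK.
have Ju : V (J (uc v nu)) by apply: dQ.1; case: (uc_unit CQ hd).
have Jb : V (J (bt v a)) by apply: dQ.1; exact: bt_mem hd.
have fin gg g : (gg = fib v a /\ g = 1) \/ (gg = (fib v a)^-1 /\ g = fib v a) ->
    V (kappa gg) -> V (kappa (g ^- b * ratC (nu ^+ p)) * z) -> exists2 S, Xs S & dom V S.
  move=> hg Vg Vx; set A := ring2 (J @` Q) (kappa gg) (kappa (g ^- b * ratC (nu ^+ p)) * z).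
  have AV : A `<=` V by apply: ring2_min => // _ [c Qc <-]; exact: dQ.1.
  have [hS [SV Sinv]] := centerP (@ring2_subr _ _ _ _) lV AV.
  exists (center A V) => //; apply: (locz_cover hC hp CQ hd hg) => //.
  split=> c Qc; last by move=> /SV; exact: dQ.2.
  by case: hS => _ AS _; apply: AS; apply: ring2_base; exists c.
have [Vy|Vy] := hV.2 (yy v a).
  apply: (fin (fib v a) 1); [by left|by []|]; rewrite xg1.
  apply: (valring_root (n := l.-1) hV (a := J (uc v nu) * (yy v a ^+ p + J (bt v a)))).
    by apply: (subrM' sV) => //; apply: (subrD' sV) => //; exact: subrX'.
  by rewrite -ldef; exact: cover_eq.
apply: (fin (fib v a)^-1 (fib v a)); [by right|by rewrite fmorphV|]; rewrite xg2.
apply: (valring_root (n := l.-1) hV (a := J (uc v nu) * (1 + J (bt v a) * (yy v a)^-1 ^+ p) * (yy v a)^-1)).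
  apply: (subrM' sV) => //; apply: (subrM' sV) => //; apply: (subrD' sV); first exact: subr1.
  by apply: (subrM' sV) => //; exact: subrX'.
by rewrite -ldef; exact: cover_eq1.
Qed.

Lemma field_full (T : set F) : subr T -> (forall x, T x -> T x^-1) ->
  (forall q, T (J q)) -> T (kappa X) -> T z -> T = [set: F].
Proof.
move=> hT Ti TJ TX Tz; apply/seteqP; split=> // w _.
have Tp (q : {poly K}) : T (kappa (FracField.tofrac q)).
  elim/poly_ind: q => [|q c ih]; first by rewrite !rmorph0; exact: subr0'.
  rewrite !rmorphD !rmorphM; apply: (subrD' hT); last exact: TJ.
  exact: subrM'.
have [c [-> _]] := hz.2 w; apply: (subr_sum hT) => i _; apply: (subrM' hT); last exact: subrX'.
have [n [q [q0 ->]]] := frac_repr (c i).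
by rewrite rmorphM fmorphV; apply: (subrM' hT) => //; exact: Ti.
Qed.

(** The center of the trivial valuation ring is closed under inverses, hence a field, and it
    contains [K], x and z. *)
Lemma cover_generic : Xs [set: F].
Proof.
have hV : valring [set: F] by split; [exact: subrT|left].
have [S XS [_ hS]] := cover_proper hV (fun _ => I).
have [lS [Q [CQ dS hch]]] := cover_charts hC hp data_exists XS.
have sS := local_subr lS.
have Si x : S x -> S x^-1 by move=> Sx; exact: hS.
have [v [a [nu hd]]] := data_exists CQ; case: (hd) => v0 nu0 _.
have SJ q : S (J q).
  have [Qq|Qq] := (C_valring hC CQ).2 q; first exact: dS.1.
  have -> : J q = (J q^-1)^-1 by rewrite /= !fmorphV invrK.
  by apply: Si; exact: dS.1.
have [Sy Sx] : S (yy v a) /\ S (xi nu).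
  case: (hch _ _ _ hd) => [h|[h _]].
    by case: h => _ h _; split; apply: h; [exact: ring2_l|exact: ring2_r].
  have Sy : S (yy v a) by case: h => _ h _; rewrite -[yy v a]invrK; apply: Si; apply: h; exact: ring2_l.
  split=> //; have y0 : yy v a != 0 by rewrite fmorph_eq0 fib_neq0.
  have -> : xi nu = yy v a ^+ b * (yy v a ^- b * xi nu) by rewrite mulVKf // expf_neq0.
  apply: (subrM' sS); first exact: subrX'.
  by case: h => _ h _; apply: h; exact: ring2_r.
rewrite -(field_full sS Si SJ) //.
  have -> : kappa X = J v^-1 * yy v a - J a.
    rewrite /fib rmorphM rmorphD /= mulrA -!rmorphM mulVf // !rmorph1 mul1r; ring.
  by apply: (subrB' sS) => //; apply: (subrM' sS).
have -> : z = J (nu ^- p) * xi nu.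
  by rewrite /= mulrA -!rmorphM mulVf ?expf_neq0 // !rmorph1 mul1r.
by apply: (subrM' sS).
Qed.
End CoverPoints.

(** * The canonical divisor of the cover *)

Section LocalForms.
Variables (F : fieldType) (k0 W : set F).
Hypothesis lW : islocal W.
Let hW := local_subr lW.
Variables (x1 x2 : F).

(** The condition that dh lies in W dx1 + W dx2, tested on derivations. It is stable under ring
    operations and inverses of units, so it need only be checked on generators. *)
Definition dgen h := exists a b, [/\ W a, W b &
  forall d : der k0, sval d h = a * sval d x1 + b * sval d x2].

Lemma dgen_unit h : unit_in W h -> dgen h -> dgen h^-1.
Proof.
move=> [h0 Wh Wh'] [a [b [Wa Wb e]]]; exists (- h^-1 ^+ 2 * a), (- h^-1 ^+ 2 * b).
have Wi : W (- h^-1 ^+ 2) by apply: subrN' => //; exact: subrX'.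
split; [exact: subrM'|exact: subrM'|] => d; rewrite (jderV (j := idfun) (svalP d)) e /= -exprVn; ring.
Qed.

Lemma dgen_subr : subr [set h | W h /\ dgen h].
Proof.
split=> [|x y [Wx [a [b [Wa Wb e]]]] [Wy [a' [b' [Wa' Wb' e']]]]|x y [Wx [a [b [Wa Wb e]]]] [Wy [a' [b' [Wa' Wb' e']]]]].
- split; first exact: subr1.
  exists 0, 0; split; try exact: subr0'; move=> d; rewrite (jder1 (j := idfun) (svalP d)); ring.
- split; first exact: subrB'.
  exists (a - a'), (b - b'); split; try exact: subrB'.
  move=> d; rewrite (jderB (j := idfun) (svalP d)) e e'; ring.
- split; first exact: subrM'.
  exists (x * a' + y * a), (x * b' + y * b); split; try (by apply: (subrD' hW); exact: subrM').
  move=> d; rewrite (jderM (j := idfun) (svalP d)) e e' /=; ring.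
Qed.

Lemma dgen_locz T : locz (gen_ring T) W -> (forall h, T h -> dgen h) -> forall h, W h -> dgen h.
Proof.
move=> [_ TW fr] hT h Wh.
have gT x : gen_ring T x -> W x /\ dgen x.
  by apply: (gen_min dgen_subr) => w Tw; split; [apply: TW; exact: gen_sub|exact: hT].
have [x [c [/gT[Wx dx] /gT[Wc dc] uc ->]]] := fr h Wh.
have Wci : W c^-1 by case: uc.
by have [] := subrM' dgen_subr (conj Wx dx) (conj Wci (dgen_unit uc dc)).
Qed.

Lemma Omega2_gen : W x1 -> W x2 -> (forall h, W h -> dgen h) ->
  Omega2 W = [set q *: (wedge x1 x2 : der k0 -> der k0 -> F^o) | q in W].
Proof.
move=> W1 W2 hg; apply/seteqP; split=> w.
  apply: span_min => [|x y [q Wq <-] [q' Wq' <-]|r _ Wr [a Wa [b Wb <-]]].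
  - by exists 0; [exact: subr0'|rewrite scale0r].
  - by exists (q - q'); [exact: subrB'|rewrite scalerBl].
  - have [a1 [a2 [Wa1 Wa2 ea]]] := hg a Wa; have [b1 [b2 [Wb1 Wb2 eb]]] := hg b Wb.
    exists (r * (a1 * b2 - a2 * b1)).
      apply: subrM' => //; by apply: subrB' => //; apply: subrM'.
    apply/funext => d; apply/funext => d'; rewrite !fctE /wedge ea eb !ea !eb.
    rewrite /GRing.scale /=; ring.
move=> [q Wq <-]; apply: span_gen => //; exists x1 => //; by exists x2.
Qed.
End LocalForms.

Section CoverForms.
Variables (k : closedFieldType) (K : fieldType) (iota : {rmorphism k -> K}).
Variable C : set (set K).
Hypothesis hC : smooth_projective_curve (range iota) C.
Notation k0 := (range iota).
Variables (p : nat).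
Hypothesis hp : p \in [pchar k].
Variables (D G : set K -> int) (f0 : K) (e l : nat).
Notation E := (raynaud_E p C D f0).
Notation L := (OD C D).
Notation Nl := (expS (OD C G) (e %/ l)).
Notation P := (raynaud_P C E).
Notation X := (ratX K).
Notation local_data := (local_data p D G f0 e l).
Hypothesis data_exists : forall Q, C Q -> exists v a nu, local_data Q v a nu.
Variables (F : fieldType) (kappa : {rmorphism ruled_field K -> F}) (z : F).
Notation J := (kappa \o @ratC K).
Notation M := (raynaud_M p l C E Nl).
Notation Xs := (cyclic_cover kappa P M z).
Notation b := (p.+1 %/ l)%N.
Notation yy v a := (kappa (fib v a)).
Notation xi nu := (kappa (ratC (nu ^+ p)) * z).
Variables (theta s : ruled_field K) (hh : K) (c0 : k).
Hypothesis theta_def : theta = X ^+ p + ratC f0.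
Hypothesis hl : (l %| p.+1)%N.
Hypothesis l1 : (1 < l)%N.
Hypothesis s_def : s = ratC (iota c0) * theta / ratC hh ^+ p.
Hypothesis hh0 : hh != 0.
Hypothesis hz : radical_extension kappa l s z.
Hypothesis unit_ratio : forall Q v a nu, C Q -> local_data Q v a nu -> unit_in Q (hh * v / nu ^+ l).
Notation uc v nu := (unit_coef iota p l hh c0 v nu).
Notation bt v a := (beta p f0 v a).
Notation kF := (range (fun c => kappa (ratC (iota c)))).
Variable dK : K -> K.
Hypothesis hdK : jder idfun k0 dK.
Hypothesis dKf0 : dK f0 = 1.
Let JJ : {rmorphism K -> F} := J.

(** The derivation [dK] is normalized by [dK f0 = 1], so on functions of [C] every derivation of [F]
    is its value at f0 times [dK]. *)
Lemma der_base (d : der kF) q : sval d (J q) = J (dK q) * sval d (J f0).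
Proof.
have hd : jder JJ k0 (sval d \o J).
  case: (svalP d) => dD dM dc; split=> [a a'|a a'|c [c' _ <-]]; rewrite /= ?rmorphD ?rmorphM //.
  by apply: dc; exists c'.
have := der_comp hC hd hdK _ q (f := f0); rewrite dKf0 oner_neq0 => /(_ isT) /= ->.
by rewrite !rmorph1 divr1 mulrC.
Qed.

Lemma pchar_cover : p \in [pchar F].
Proof. exact: (rmorph_pchar kappa (pchar_ruled iota hp)). Qed.

Lemma der_y v a : exists A, forall d : der kF,
  sval d (yy v a) = A * sval d (J f0) + J v * sval d (kappa X).
Proof.
exists (J v * J (dK a) + (kappa X + J a) * J (dK v)) => d.
have -> : yy v a = J v * (kappa X + J a) by rewrite /fib rmorphM rmorphD.
move: (kappa X) => x.
rewrite (jderM (j := idfun) (svalP d)) (jderD (j := idfun) (svalP d)) (der_base d v) (der_base d a) /=; ring.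
Qed.

Lemma der_beta v a (d : der kF) : sval d (J (bt v a)) = J v ^+ p * sval d (J f0).
Proof.
have hpK := pchar_K iota hp.
rewrite der_base /beta (jderM (j := idfun) hdK) (jderB (j := idfun) hdK) !(jder_pX (j := idfun) hdK) // dKf0.
by rewrite mulr0 addr0 subr0 mulr1 /= !rmorphXn.
Qed.

Lemma der_unit_coef v nu (d : der kF) : sval d (J (uc v nu)) = 0.
Proof.
rewrite /unit_coef /= !rmorphM !rmorphXn (jderM (j := idfun) (svalP d)) (jder_pX (j := idfun) (svalP d) _ pchar_cover).
rewrite mulr0 add0r; case: (svalP d) => _ _ dc; by rewrite dc ?mulr0 //; exists c0.
Qed.

Lemma der_xi v nu (d : der kF) : v != 0 ->
  l%:R * xi nu ^+ l.-1 * sval d (xi nu) = J (uc v nu) * J v ^+ p * sval d (J f0).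
Proof.
move=> v0; rewrite -(jderXn (j := idfun) (svalP d)) (cover_eq hp theta_def s_def hz 0 nu v0).
rewrite (jderM (j := idfun) (svalP d)) der_unit_coef (jderD (j := idfun) (svalP d)) der_beta.
rewrite (jder_pX (j := idfun) (svalP d) _ pchar_cover) /=; ring.
Qed.

Lemma der_xi1 v a nu (d : der kF) : v != 0 -> let h := (yy v a)^-1 in
  l%:R * (yy v a ^- b * xi nu) ^+ l.-1 * sval d (yy v a ^- b * xi nu) =
  J (uc v nu) * ((1 + J (bt v a) * h ^+ p) * sval d h + h ^+ p.+1 * J v ^+ p * sval d (J f0)).
Proof.
move=> v0 h; rewrite -(jderXn (j := idfun) (svalP d)) (cover_eq1 hp theta_def hl s_def hz a nu v0) -/h -mulrA.
rewrite (jderM (j := idfun) (svalP d)) der_unit_coef [X in _ * X](jderM (j := idfun) (svalP d)) (jderD (j := idfun) (svalP d)).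
rewrite (jderM (j := idfun) (svalP d) (J _)) der_beta (jder_pX (j := idfun) (svalP d) _ pchar_cover).
rewrite (jder1 (j := idfun) (svalP d)) exprS /=; ring.
Qed.

(** l divides p + 1, which equals 1 in [F]. *)
Lemma l_neq0 : l%:R != 0 :> F.
Proof.
have p0 := (pcharf0 pchar_cover).
apply/eqP => e0; have : (p.+1)%:R = 0 :> F by rewrite -(divnK hl) natrM e0 mulr0.
by rewrite -natr1 p0 add0r => /eqP; rewrite oner_eq0.
Qed.

(** The elements whose differential is a combination of df0 and dx form a subfield; it contains [K]
    and x, and also z, by the differentiated equation with v = nu = 1. *)
Lemma diff_cover h : exists A B, forall d : der kF,
  sval d h = A * sval d (J f0) + B * sval d (kappa X).
Proof.
have lT : islocal [set: F] by apply: val_local; split; [exact: subrT|left].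
set T := [set h | [set: F] h /\ dgen kF [set: F] (J f0) (kappa X) h].
have hT : subr T by exact: dgen_subr.
have inT x : dgen kF [set: F] (J f0) (kappa X) x -> T x by [].
suff e1 : T = [set: F].
  have [_ [A [B [_ _ h1]]]] : T h by rewrite e1.
  by exists A, B.
apply: (field_full hz hT).
- move=> x [_ dx]; apply: inT; have [->|x0] := eqVneq x 0; first by rewrite invr0; case: (subr0' hT).
  exact: (dgen_unit lT).
- move=> q; apply: inT; exists (J (dK q)), 0; split=> // d; rewrite der_base; ring.
- apply: inT; exists 0, 1; split=> // d; ring.
apply: inT; have z0 := z_neq0 l1 hz.
exists ((J (uc 1 1) * J 1 ^+ p) / (l%:R * z ^+ l.-1)), 0; split=> // d.
have := der_xi 1 d (oner_neq0 K).
rewrite expr1n [ratC 1]rmorph1 [kappa 1]rmorph1 mul1r => e1.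
have c1 : l%:R * z ^+ l.-1 != 0 by apply: mulf_neq0; [exact: l_neq0|exact: expf_neq0].
by apply: (mulfI c1); rewrite e1 mul0r addr0 mulrA [_ * (_ / _)]mulrC divfK.
Qed.

Notation w0 := (wedge (J f0) (kappa X) : der kF -> der kF -> F^o).

Lemma wedge_scalar a b A B A' B' :
  (forall d : der kF, sval d a = A * sval d (J f0) + B * sval d (kappa X)) ->
  (forall d : der kF, sval d b = A' * sval d (J f0) + B' * sval d (kappa X)) ->
  wedge a b = (A * B' - B * A') *: w0.
Proof.
move=> ha hb; apply/funext => d; apply/funext => d'; rewrite !fctE /wedge !ha !hb.
rewrite /GRing.scale /=; ring.
Qed.

Lemma Omega2_scalar w : Omega2 [set: F] w -> exists c, w = c *: w0.
Proof.
apply: (@span_min _ _ _ _ [set w | exists c, w = c *: w0]) => [|x y [c ->] [c' ->]|r _ _ [a _ [a' _ <-]]].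
- by exists 0; rewrite scale0r.
- by exists (c - c'); rewrite scalerBl.
have [A [B ha]] := diff_cover a; have [A' [B' hb]] := diff_cover a'.
by exists (r * (A * B' - B * A')); rewrite (wedge_scalar ha hb) scalerA.
Qed.
End CoverForms.

(** * Normal forms over Q[y] and fibre components outside the branch locus *)

Section PolynomialCoefficients.
Variables (K : fieldType) (Q : set K).
Hypothesis hQ : subr Q.

Definition coef_in (q : {poly K}) := forall i, Q q`_i.

Lemma coef_inB q q' : coef_in q -> coef_in q' -> coef_in (q - q').
Proof. by move=> h h' i; rewrite coefB; exact: subrB'. Qed.

Lemma coef_inD q q' : coef_in q -> coef_in q' -> coef_in (q + q').
Proof. by move=> h h' i; rewrite coefD; exact: subrD'. Qed.

Lemma coef_inM q q' : coef_in q -> coef_in q' -> coef_in (q * q').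
Proof. by move=> h h' i; rewrite coefM; apply: subr_sum => // j _; exact: subrM'. Qed.

Lemma coef_inC c : Q c -> coef_in c%:P.
Proof. by move=> h i; rewrite coefC; case: ifP => // _; exact: subr0'. Qed.

Lemma coef_inXn n : coef_in 'X^n.
Proof. by move=> i; rewrite coefXn; exact: subr_nat. Qed.

(** Division by a monic polynomial needs no denominators: the coefficients of [q] are recovered from
    the top downwards. *)
Lemma coef_in_monic m q : m \is monic -> coef_in m -> coef_in (m * q) -> coef_in q.
Proof.
move=> /monicP mm hm hmq; set d := (size m).-1.
have m0 : m != 0 by rewrite -lead_coef_eq0 mm oner_neq0.
have sm : size m = d.+1 by rewrite /d prednK // lt0n size_poly_eq0.
have h n i : (size q <= i + n)%N -> Q q`_i.
  elim: n i => [|n ih] i.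
    by rewrite addn0 => si; rewrite nth_default //; exact: subr0'.
  move=> si; have := hmq (d + i)%N; rewrite coefM -(subnKC (leq_addr i d)) in hmq *.
  rewrite addKn -addnS big_split_ord /= big_ord_recl /= addn0 addKn.
  have -> : m`_d = 1 by rewrite -mm.
  rewrite mul1r [X in _ + (_ + X)]big1 ?addr0 => [hh|j _]; last first.
    by rewrite /bump leq0n [m`_ _]nth_default ?mul0r // sm addnA addn1 leq_addr.
  set S := \sum_(_ < _) _ in hh; have -> : q`_i = S + q`_i - S by rewrite addrAC subrr add0r.
  apply: (subrB' hQ hh); apply: (subr_sum hQ) => j _; apply: (subrM' hQ); first exact: hm.
  apply: ih; apply: (leq_trans si); have := ltn_ord j; clear; lia.
by move=> i; apply: (h (size q)); exact: leq_addl.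
Qed.
End PolynomialCoefficients.

Lemma ratio_cross (F : fieldType) (a x g1 g2 : F) : x != 0 -> g2 != 0 ->
  a / x = g1 / g2 -> a * g2 = x * g1.
Proof. by move=> x0 g0 h; rewrite -[a](divfK x0) h; field. Qed.

Lemma move_factor (F : fieldType) (t u m d : F) : t != 0 -> u * m * d = t * (m * (u / t * d)).
Proof. by move=> t0; field. Qed.

Lemma cancel_factor (F : fieldType) (u a b w : F) : u != 0 ->
  a * b * w = u * a * (u^-1 * (b * w)).
Proof. by move=> u0; field. Qed.

Section CoverPolynomials.
Variables (k : closedFieldType) (K : fieldType) (iota : {rmorphism k -> K}).
Variable C : set (set K).
Hypothesis hC : smooth_projective_curve (range iota) C.
Notation k0 := (range iota).
Variables (p : nat).
Hypothesis hp : p \in [pchar k].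
Variables (D G : set K -> int) (f0 : K) (e l : nat).
Notation E := (raynaud_E p C D f0).
Notation L := (OD C D).
Notation Nl := (expS (OD C G) (e %/ l)).
Notation P := (raynaud_P C E).
Notation X := (ratX K).
Notation local_data := (local_data p D G f0 e l).
Hypothesis data_exists : forall Q, C Q -> exists v a nu, local_data Q v a nu.
Variables (F : fieldType) (kappa : {rmorphism ruled_field K -> F}) (z : F).
Notation J := (kappa \o @ratC K).
Notation M := (raynaud_M p l C E Nl).
Notation Xs := (cyclic_cover kappa P M z).
Notation b := (p.+1 %/ l)%N.
Notation yy v a := (kappa (fib v a)).
Notation xi nu := (kappa (ratC (nu ^+ p)) * z).
Variables (theta s : ruled_field K) (hh : K) (c0 : k).
Hypothesis theta_def : theta = X ^+ p + ratC f0.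
Hypothesis hl : (l %| p.+1)%N.
Hypothesis l1 : (1 < l)%N.
Hypothesis s_def : s = ratC (iota c0) * theta / ratC hh ^+ p.
Hypothesis hh0 : hh != 0.
Hypothesis hz : radical_extension kappa l s z.
Hypothesis unit_ratio : forall Q v a nu, C Q -> local_data Q v a nu -> unit_in Q (hh * v / nu ^+ l).
Notation uc v nu := (unit_coef iota p l hh c0 v nu).
Notation bt v a := (beta p f0 v a).
Let l0 : (0 < l)%N := ltnW l1.

Variables (Q : set K) (v a nu : K).
Hypotheses (CQ : C Q) (hd : local_data Q v a nu).
Let hQ := C_subr hC CQ.
Let v0 : v != 0. Proof. by case: hd. Qed.
Let nu0 : nu != 0. Proof. by case: hd. Qed.
Let y := yy v a.
Let x := xi nu.

(** [ev q] is q(y), since v x + v a = y. *)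
Let ev (q : {poly K}) : ruled_field K := FracField.tofrac (q \Po (v *: 'X + (v * a)%:P)).

Lemma evM q q' : ev (q * q') = ev q * ev q'.
Proof. by rewrite /ev rmorphM /= rmorphM. Qed.

Lemma evB q q' : ev (q - q') = ev q - ev q'.
Proof. by rewrite /ev rmorphB /= rmorphB. Qed.

Lemma evC c : ev c%:P = ratC c.
Proof. by rewrite /ev comp_polyC. Qed.

Lemma evX : ev 'X = fib v a.
Proof.
rewrite /ev comp_polyX /fib /ratC /ratX -!rmorphD -rmorphM; congr (FracField.tofrac _).
by rewrite mulrDr -polyCM mul_polyC.
Qed.

Lemma evE q : ev q = \sum_(i < size q) ratC q`_i * fib v a ^+ i.
Proof.
rewrite /ev comp_polyE rmorph_sum; apply: eq_bigr => i _.
by rewrite -mul_polyC rmorphM rmorphXn /= -evX /ev comp_polyX.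
Qed.

Lemma ev_inj : injective ev.
Proof.
move=> q q' /eqP; rewrite tofrac_eq => /eqP e1; apply/eqP; rewrite -subr_eq0.
have sL : (1 < size (v *: 'X + (v * a)%:P)%R)%N.
  rewrite size_polyDl size_scale // ?size_polyX // (leq_ltn_trans (size_polyC_leq1 _)) //.
by rewrite -(comp_poly_eq0 _ sL) rmorphB /= e1 subrr.
Qed.

Let eqn : {poly K} := 'X^p + (bt v a)%:P.

Lemma cover_eqn : x ^+ l = J (uc v nu) * kappa (ev eqn).
Proof.
rewrite (cover_eq hp theta_def s_def hz a nu v0); congr (_ * _).
have -> : ev eqn = fib v a ^+ p + ratC (bt v a); last by rewrite rmorphD rmorphXn.
rewrite -evC -evX /ev /eqn rmorphD rmorphXn /= rmorphD rmorphXn; reflexivity.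
Qed.

Lemma eqn_monic : eqn \is monic.
Proof.
have p0 := pchar_gt0 hp; apply/monicP.
by rewrite /eqn lead_coefDl ?lead_coefXn // size_polyXn (leq_ltn_trans (size_polyC_leq1 _)).
Qed.

Lemma eqn_coef : coef_in Q eqn.
Proof.
apply: (coef_inD hQ); first exact: coef_inXn; apply: (coef_inC hQ); exact: (bt_mem hC hp CQ hd).
Qed.

Definition cover_module w := exists c : nat -> {poly K},
  (forall i, coef_in Q (c i)) /\ w = \sum_(i < l) kappa (ev (c i)) * x ^+ i.

Lemma cover_module1 : cover_module 1.
Proof.
exists (fun i => if i == 0%N then 1%:P else 0%:P); split.
  move=> i; case: ifP => _; apply: (coef_inC hQ); [exact: subr1|exact: subr0'].
case: l l0 => // n _; rewrite big_ord_recl big1 /= => [|i _]; rewrite evC; first by rewrite !rmorph1 mulr1 addr0.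
by rewrite !rmorph0 mul0r.
Qed.

Lemma cover_moduleB w w' : cover_module w -> cover_module w' -> cover_module (w - w').
Proof.
move=> [c [hc ->]] [c' [hc' ->]]; exists (fun i => c i - c' i); split.
  by move=> i; apply: coef_inB.
by rewrite -sumrB; apply: eq_bigr => i _; rewrite evB rmorphB mulrBl.
Qed.

Lemma cover_moduleZ q w : coef_in Q q -> cover_module w -> cover_module (kappa (ev q) * w).
Proof.
move=> hq [c [hc ->]]; exists (fun i => q * c i); split; first by move=> i; apply: coef_inM.
by rewrite mulr_sumr; apply: eq_bigr => i _; rewrite evM rmorphM mulrA.
Qed.

Lemma cover_moduleX w : cover_module w -> cover_module (x * w).
Proof.
move=> [c [hc ->]].
exists (fun i => if i is j.+1 then c j else (uc v nu)%:P * eqn * c l.-1); split.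
  case=> [|i]; last exact: hc.
  apply: (coef_inM hQ) => //; apply: (coef_inM hQ); last exact: eqn_coef.
  by apply: (coef_inC hQ); case: (uc_unit hC l1 s_def hz unit_ratio CQ hd).
have := cover_eqn; rewrite mulr_sumr; case: l l0 => // n _ e1.
rewrite big_ord_recr big_ord_recl /= !evM evC expr0 mulr1 addrC; congr (_ + _).
  by rewrite mulrCA -exprS e1 !rmorphM mulrC.
by apply: eq_bigr => i _; rewrite mulrCA -exprS.
Qed.

(** The module contains 1, so it suffices that it is stable under multiplication by the generators
    of the ring; for x' the power x'^l is rewritten by the equation of the cover. *)
Lemma cover_ring_module w : cover_chart0 p kappa z Q v a nu w -> cover_module w.
Proof.
move=> hw; suff h : forall m, cover_module m -> cover_module (w * m) by rewrite -[w]mulr1; apply: h; exact: cover_module1.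
move: w hw; apply: (@gen_min _ _ [set w | forall m, cover_module m -> cover_module (w * m)]).
  split=> [m|w w' hw hw' m hm|w w' hw hw' m hm] /=.
  - by rewrite mul1r.
  - by rewrite mulrBl; apply: cover_moduleB; [exact: hw|exact: hw'].
  - by rewrite -mulrA; apply: hw; exact: hw'.
move=> w [[c Qc <-]|[->|->]] m hm.
- by rewrite /= -evC; apply: cover_moduleZ => //; exact: coef_inC.
- by rewrite -evX; apply: cover_moduleZ => //; exact: (coef_inXn hQ 1).
- exact: cover_moduleX.
Qed.

Lemma cover_unique (c c' : nat -> ruled_field K) :
  \sum_(i < l) kappa (c i) * x ^+ i = \sum_(i < l) kappa (c' i) * x ^+ i ->
  forall i : 'I_l, c i = c' i.
Proof.
have r0 : ratC (nu ^+ p) != 0 by rewrite fmorph_eq0 expf_neq0.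
pose ff (d : nat -> ruled_field K) := [ffun i : 'I_l => d i * ratC (nu ^+ p) ^+ i].
have ex (d : nat -> ruled_field K) : \sum_(i < l) kappa (d i) * x ^+ i = \sum_(i < l) kappa (ff d i) * z ^+ i.
  by apply: eq_bigr => i _; rewrite ffunE rmorphM rmorphXn exprMn mulrA.
rewrite !ex => e1 i; have [d [_ un]] := hz.2 (\sum_(i < l) kappa (ff c i) * z ^+ i).
have e2 : ff c = ff c' by rewrite -(un (ff c) erefl) -(un (ff c') e1).
have := congr1 (fun g : {ffun 'I_l -> ruled_field K} => g i) e2; rewrite !ffunE => e3.
by apply: (mulIf (expf_neq0 i r0)); exact: e3.
Qed.

(* Otherwise a power of t is divisible by x^l in W, say t^N g2 = x^l g1 with g2 a
   unit of W; comparing coefficients over Q[y] and dividing by the monic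
   polynomial x^l / u shows that x divides g2. *)
Lemma exclusion (W : set F) t : dvr W -> locz (cover_chart0 p kappa z Q v a nu) W ->
  t != 0 -> Q t -> ~ W (J t)^-1 -> unit_in W x.
Proof.
move=> dW hlW t0 Qt nt; have [lW AW fr] := hlW; have hW := local_subr lW.
have Wx : W x by apply: AW; exact: ring2_r.
have Wt : W (J t) by apply: AW; apply: ring2_base; exists t.
have WJ q : Q q -> W (J q) by move=> Qq; apply: AW; apply: ring2_base; exists q.
have evW q : coef_in Q q -> W (kappa (ev q)).
  move=> hq; rewrite evE rmorph_sum; apply: (subr_sum hW) => i _; rewrite rmorphM rmorphXn.
  apply: (subrM' hW); first exact: WJ.
  by apply: (subrX' hW); apply: AW; exact: ring2_l.
have x0 : x != 0 by rewrite mulf_neq0 ?fmorph_eq0 ?expf_neq0 // (z_neq0 l1 hz).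
have Jt0 : J t != 0 by rewrite !fmorph_eq0.
have Wxl := subrX' hW l Wx; have xl0 : x ^+ l != 0 by rewrite expf_neq0.
have [N eN] : exists N : nat, ord W (x ^+ l) = N%:Z.
  by exists `|ord W (x ^+ l)|%N; rewrite gez0_abs //; apply/(ord_ge0 dW xl0).
have ot : 1 <= ord W (J t).
  have := (ord_ge0 dW Jt0).1 Wt; rewrite -gtz0_ge1 lt_def => ->; rewrite andbT.
  apply/eqP => e0; apply: nt; by case: ((ord_unit (J t) dW).2 (conj Jt0 e0)).
(* [J t] has order at least 1 in [W], so its N-th power has order at least [N], the order of
   [x ^+ l]. *)
have Wu : W (J t ^+ N / x ^+ l).
  apply/(ord_ge0 dW); first by rewrite mulf_neq0 ?invr_eq0 ?expf_neq0.
  rewrite ordM ?invr_eq0 ?expf_neq0 // ordV // ordX // eN subr_ge0.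
  by rewrite -{1}[N%:Z]mulr1 ler_wpM2l.
have [g1 [g2 [A1 A2 u2 e12]]] := fr _ Wu.
have [d [hd1 ed]] := cover_ring_module A1; have [c [hc1 ec]] := cover_ring_module A2.
have g20 : g2 != 0 by case: u2.
have e3 : J t ^+ N * g2 = x ^+ l * g1 by rewrite (ratio_cross xl0 g20 e12).
have e4 : forall i : 'I_l, ratC (t ^+ N) * ev (c i) = ratC (uc v nu) * ev eqn * ev (d i).
  apply: (cover_unique (c := fun i => ratC (t ^+ N) * ev (c i)) (c' := fun i => ratC (uc v nu) * ev eqn * ev (d i))).
  transitivity (J t ^+ N * g2).
    by rewrite ec mulr_sumr; apply: eq_bigr => i _; rewrite [ratC (t ^+ N)]rmorphXn rmorphM rmorphXn mulrA.
  by rewrite e3 cover_eqn ed mulr_sumr; apply: eq_bigr => i _; rewrite !rmorphM mulrA.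
pose q i := (uc v nu / t ^+ N) *: d i.
have tN0 : t ^+ N != 0 by rewrite expf_neq0.
have e5 : forall i : 'I_l, c i = eqn * q i.
  move=> i; apply: ev_inj; apply: (mulfI (_ : ratC (t ^+ N) != 0)); first by rewrite fmorph_eq0.
  rewrite e4 /q -mul_polyC !evM evC [ratC (_ / _)]fmorph_div; apply: move_factor; by rewrite fmorph_eq0.
have hq (i : 'I_l) : coef_in Q (q i).
  by apply: (coef_in_monic hQ eqn_monic eqn_coef); rewrite -e5.
have eg2 : g2 = x * (x ^+ l.-1 * (J (uc v nu)^-1 * \sum_(i < l) kappa (ev (q i)) * x ^+ i)).
  rewrite mulrA -exprS prednK // cover_eqn ec mulr_sumr mulr_sumr; apply: eq_bigr => i _.
  rewrite e5 evM rmorphM.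
  have u0 : J (uc v nu) != 0 by rewrite !fmorph_eq0; case: (uc_unit hC l1 s_def hz unit_ratio CQ hd).
  have -> : J (uc v nu)^-1 = (J (uc v nu))^-1 by rewrite /= !fmorphV.
  exact: cancel_factor.
rewrite eg2 in u2; apply: (unitMl hW Wx _ u2); apply: (subrM' hW); first exact: subrX'.
apply: (subrM' hW); first by apply: WJ; case: (uc_unit hC l1 s_def hz unit_ratio CQ hd).
by apply: (subr_sum hW) => i _; apply: (subrM' hW); [apply: evW|exact: subrX'].
Qed.
End CoverPolynomials.

Lemma one_add_unit (F : fieldType) (S : set F) (B h : F) p : islocal S -> S B -> S h -> ~ S h^-1 ->
  (0 < p)%N -> unit_in S (1 + B * h ^+ p).
Proof.
move=> lS SB Sh nh p0; have hS := local_subr lS.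
have Sx : S (B * h ^+ p) by apply: (subrM' hS) => //; exact: subrX'.
have : unit_in S (1 + B * h ^+ p + - (B * h ^+ p)) by rewrite addrK; exact: unit1.
case/(lS.2 _ _ (subrD' hS (subr1 hS) Sx) (subrN' hS Sx)) => //.
move/(unitN hS); rewrite opprK => /(unitMr hS SB (subrX' hS p Sh)).
by rewrite -(prednK p0) exprS => /(unitMl hS Sh (subrX' hS _ Sh)) [_ _ /nh].
Qed.

Lemma unit_chart_generic (F : fieldType) (u v d l x r : F) : x != 0 -> l != 0 -> v != 0 -> d != 0 ->
  u * r / (l * x) * v * (x / (v * d)) = u * (r / d) * l^-1.
Proof. by move=> x0 l0 v0 d0; field; rewrite x0 l0 v0 d0. Qed.

Lemma unit_chart1 (F : fieldType) (u v d l x ep h xl ha : F) : x != 0 -> l != 0 -> v != 0 -> d != 0 ->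
  xl != 0 -> h != 0 -> xl * ha * h ^+ 2 = x ->
  d * - (u * ep * h ^+ 2 * v / (l * x)) * (xl * ha / (v * d)) = - (u * ep * l^-1).
Proof.
move=> x0 l0 v0 d0 xl0 h0 e.
have -> : xl * ha = x / h ^+ 2 by rewrite -e mulfK // expf_neq0.
by field; rewrite x0 l0 v0 d0 h0.
Qed.

Lemma cancel_two (F : fieldType) (a f B B' : F) : B' != 0 -> B != 0 ->
  a * f = a * B' * B^-1 * (B / B' * f).
Proof. by move=> h h'; field; rewrite h h'. Qed.

Lemma regroup (F : fieldType) (a r l d f : F) : a * r / l * (d^-1 * f) = a * (r / d) / l * f.
Proof. by rewrite -!mulrA; congr (_ * (_ * _)); rewrite mulrCA. Qed.

Lemma regroup1 (F : fieldType) (a r d f : F) : a * (r * (d^-1 * f)) = a * (r / d) * f.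
Proof. by rewrite !mulrA. Qed.

Lemma cancel_denominator (F : fieldType) (d v x : F) : d != 0 -> v != 0 ->
  d * v * (x / (v * d)) = x.
Proof. by move=> d0 v0; field; rewrite d0 v0. Qed.

Lemma solve_eta (F : fieldType) (l x dx u ep h dh f vp : F) : u != 0 -> ep != 0 ->
  l * x * dx = u * (ep * dh + h * vp * f) -> dh = l * x / (u * ep) * dx - h / ep * (vp * f).
Proof.
move=> u0 e0 e; have -> : l * x / (u * ep) * dx = (l * x * dx) / (u * ep) by ring.
by rewrite e; field; rewrite u0 e0.
Qed.

Lemma solve_xi1 (F : fieldType) (l x dx u ep h A B f g vp hp : F) : l != 0 -> x != 0 ->
  l * x * dx = u * (ep * (- h ^+ 2 * (A * f + B * g)) + hp * vp * f) ->
  dx = u * (hp * vp - ep * h ^+ 2 * A) / (l * x) * f + - (u * ep * h ^+ 2 * B / (l * x)) * g.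
Proof.
move=> l0 x0 e; have c0 : l * x != 0 by rewrite mulf_neq0.
by apply: (mulfI c0); rewrite e; field; rewrite l0 x0.
Qed.

(** * Order of the 2-form along a prime divisor of the cover *)

Section CanonicalOrder.
Variables (k : closedFieldType) (K : fieldType) (iota : {rmorphism k -> K}).
Variable C : set (set K).
Hypothesis hC : smooth_projective_curve (range iota) C.
Notation k0 := (range iota).
Variables (p : nat).
Hypothesis hp : p \in [pchar k].
Variables (D G : set K -> int) (f0 : K) (e l : nat).
Notation E := (raynaud_E p C D f0).
Notation L := (OD C D).
Notation Nl := (expS (OD C G) (e %/ l)).
Notation P := (raynaud_P C E).
Notation X := (ratX K).
Notation local_data := (local_data p D G f0 e l).
Hypothesis data_exists : forall Q, C Q -> exists v a nu, local_data Q v a nu.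
Variables (F : fieldType) (kappa : {rmorphism ruled_field K -> F}) (z : F).
Notation J := (kappa \o @ratC K).
Notation M := (raynaud_M p l C E Nl).
Notation Xs := (cyclic_cover kappa P M z).
Notation b := (p.+1 %/ l)%N.
Notation yy v a := (kappa (fib v a)).
Notation xi nu := (kappa (ratC (nu ^+ p)) * z).
Variables (theta s : ruled_field K) (hh : K) (c0 : k).
Hypothesis theta_def : theta = X ^+ p + ratC f0.
Hypothesis hl : (l %| p.+1)%N.
Hypothesis l1 : (1 < l)%N.
Hypothesis s_def : s = ratC (iota c0) * theta / ratC hh ^+ p.
Hypothesis hh0 : hh != 0.
Hypothesis hz : radical_extension kappa l s z.
Hypothesis unit_ratio : forall Q v a nu, C Q -> local_data Q v a nu -> unit_in Q (hh * v / nu ^+ l).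
Notation uc v nu := (unit_coef iota p l hh c0 v nu).
Notation bt v a := (beta p f0 v a).
Notation kF := (range (fun c => kappa (ratC (iota c)))).
Variable dK : K -> K.
Hypothesis hdK : jder idfun k0 dK.
Hypothesis dKf0 : dK f0 = 1.
Notation w0 := (wedge (J f0) (kappa X) : der kF -> der kF -> F^o).
Variable c : F.
Hypotheses (c_neq0 : c != 0) (w0_neq0 : w0 != 0).

Section AtDivisor.
Variables (W : set F) (Q : set K) (v a nu t : K).
Hypotheses (dW : dvr W) (lW : islocal W) (CQ : C Q) (dQ : dominates J W Q) (hd : local_data Q v a nu).
Hypotheses (ht : Q = [set: K] \/ uniformizer Q t) (t0 : dK t != 0) (hvt : Q (v ^+ p / dK t)).
Let hW := local_subr lW.
Let hQ := C_subr hC CQ.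
Let v0 : v != 0. Proof. by case: hd. Qed.
Let nu0 : nu != 0. Proof. by case: hd. Qed.
Let y := yy v a.
Let x := xi nu.
Let y0 : y != 0. Proof. by rewrite fmorph_eq0; exact: fib_neq0. Qed.
Let x0 : x != 0.
Proof. by rewrite mulf_neq0 ?(z_neq0 l1 hz) // fmorph_eq0 fmorph_eq0 expf_neq0. Qed.
Let Jv0 : J v != 0. Proof. by rewrite !fmorph_eq0. Qed.
Let Jt0 : J (dK t) != 0. Proof. by rewrite !fmorph_eq0. Qed.
Let L0 := l_neq0 iota hp kappa hl.

Lemma param_local h : Q h -> exists2 q, Q q & dK h = q * dK t.
Proof.
move=> Qh; case: ht => [->|ut]; first by exists (dK h / dK t) => //; rewrite divfK.
by have [q Qq e1] := der_local hC hdK CQ ut Qh; exists q.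
Qed.

Lemma der_param (d : der kF) : sval d (J f0) = (J (dK t))^-1 * sval d (J t).
Proof. by rewrite (der_base hC hdK dKf0 d t) mulKf. Qed.

Lemma der_image h : Q h -> exists2 q, Q q & forall d : der kF, sval d (J h) = J q * sval d (J t).
Proof.
move=> Qh; have [q Qq e1] := param_local Qh; exists q => // d.
by rewrite (der_base hC hdK dKf0) e1 der_param /= !rmorphM mulrA (mulfK Jt0).
Qed.

Lemma const_l : unit_in W l%:R.
Proof.
have lk : iota l%:R != 0.
  by apply: contra_neq L0 => e0; rewrite -[l%:R](rmorph_nat (kappa \o @ratC K : {rmorphism K -> F})) -(rmorph_nat iota) e0 rmorph0.
have hk c1 : W (J (iota c1)) by apply: dQ.1; apply: (C_k0 hC CQ); exact: const_mem.
have e1 : l%:R = J (iota l%:R) :> F by rewrite /= !rmorph_nat.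
by split; [exact: L0|rewrite e1|rewrite e1 /= -!fmorphV; exact: (hk l%:R^-1)].
Qed.

Lemma Junit q : unit_in Q q -> unit_in W (J q).
Proof.
move=> [q0 Qq Qq']; split; [by rewrite !fmorph_eq0|exact: dQ.1|].
by rewrite /= -!fmorphV; exact: dQ.1.
Qed.

(** [Omega2 W] is free on [wedge x1 x2], so the order is that of c / ga, and [g] equals 1 / ga up to
    a unit of [W]. *)
Lemma ord_form_wedge x1 x2 ga (g : F) : W x1 -> W x2 -> (forall h, W h -> dgen kF W x1 x2 h) ->
  wedge x1 x2 = ga *: w0 -> unit_in W (ga * g) -> ord_form W (Omega2 W) (c *: w0) = ord W (c * g).
Proof.
move=> W1 W2 hg e1 ug; rewrite (Omega2_gen lW W1 W2 hg) e1.
have /andP [ga0 g0] : (ga != 0) && (g != 0) by rewrite -negb_or -mulf_eq0; case: ug.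
have -> : [set q *: (ga *: w0) | q in W] = [set q *: w0 | q in [set q * ga | q in W]].
  apply/seteqP; split=> w [q].
    by move=> Wq <-; exists (q * ga); [exists q|rewrite scalerA].
  by move=> [q' Wq' <-] <-; exists q' => //; rewrite scalerA.
rewrite ord_form_gen // ordM //.
have [_] := (ord_unit _ dW).1 ug; rewrite ordM // => /eqP; rewrite addrC addr_eq0 => /eqP ->.
by [].
Qed.

Lemma order_chart0 : locz (cover_chart0 p kappa z Q v a nu) W ->
  ord_form W (Omega2 W) (c *: w0) = ord W (c * (x ^+ l.-1 / (J v * J (dK t)))).
Proof.
move=> hlW; have [_ AW _] := hlW.
have Wx : W x by apply: AW; exact: ring2_r.
have Wy : W y by apply: AW; exact: ring2_l.
have [A hA] := der_y hC kappa hdK dKf0 v a.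
have xl0 : x ^+ l.-1 != 0 by rewrite expf_neq0.
have uu := uc_unit hC l1 s_def hz unit_ratio CQ hd.
have hx (d : der kF) : sval d x = J (uc v nu) * J v ^+ p / (l%:R * x ^+ l.-1) * sval d (J f0) + 0 * sval d (kappa X).
  have := der_xi hC hp theta_def s_def hz hdK dKf0 nu d v0; rewrite -/x => e1.
  have c1 : l%:R * x ^+ l.-1 != 0 by rewrite mulf_neq0.
  by apply: (mulfI c1); rewrite e1 mul0r addr0 mulrA [_ * (_ / _)]mulrC divfK.
have ht' (d : der kF) : sval d (J t) = J (dK t) * sval d (J f0) + 0 * sval d (kappa X).
  by rewrite (der_base hC hdK dKf0 d t) mul0r addr0.
(* Over the generic point of [C] the divisor may lie in the branch locus. There dx' and dy generate,
   because df0 is a multiple of x'^(l-1) dx' with a coefficient from [K]. *)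
case: ht => [eQ|ut].
  have JW q : W (J q) by apply: dQ.1; rewrite eQ.
  apply: (ord_form_wedge Wx Wy).
  - apply: (dgen_locz lW hlW) => w [[q _ <-]|[->|->]].
    + exists (J (dK q) * (l%:R * x ^+ l.-1) * J (uc v nu * v ^+ p)^-1), 0; split.
      * apply: (subrM' hW); last exact: JW.
        apply: (subrM' hW); first exact: JW.
        by apply: (subrM' hW); [exact: subr_nat|exact: subrX'].
      * exact: subr0'.
      * move=> d; rewrite (der_base hC hdK dKf0) hx !mul0r !addr0.
        have c1 : l%:R * x ^+ l.-1 != 0 by rewrite mulf_neq0.
        have c2 : J (uc v nu) * J v ^+ p != 0.
          by apply: mulf_neq0; [case: (Junit uu)|exact: expf_neq0].
        have -> : J (uc v nu * v ^+ p)^-1 = (J (uc v nu) * J v ^+ p)^-1.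
          by rewrite /= !fmorphV !rmorphM !rmorphXn.
        move: (J (dK q)) (J f0) c1 c2 => A1 A2; move: (_ * _) (_ * _) (sval d A2) => B1 B2 B3 c1 c2.
        exact: cancel_two.
    + exists 0, 1; split; [exact: subr0'|exact: subr1|move=> d; rewrite mul0r mul1r add0r; exact: erefl].
    + exists 1, 0; split; [exact: subr1|exact: subr0'|move=> d; rewrite mul0r mul1r addr0; exact: erefl].
  - exact: (wedge_scalar hx hA).
  - rewrite mul0r subr0 unit_chart_generic //.
    apply: (unitM hW); last exact: unitV const_l.
    apply: (unitM hW); first exact: Junit.
    have -> : J v ^+ p / J (dK t) = J (v ^+ p / dK t) by rewrite /= !fmorph_div !rmorphXn.
    by apply: Junit; split; rewrite ?eQ // mulf_neq0 ?invr_eq0 // expf_neq0.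
(* Over a closed point x' is a unit, so dx' is a [W]-multiple of dt, by regularity of v^p / [dK t],
   and t, y serve as coordinates. *)
have ux : unit_in W x.
  have t00 := unif_neq0 ut; have [_ Qt _ nt _] := ut.
  apply: (exclusion hC hp theta_def l1 s_def hz unit_ratio CQ hd dW hlW t00 Qt).
  by move=> h; apply: nt; exact: dQ.2.
have Qt : Q t by case: ut.
apply: (ord_form_wedge (dQ.1 _ Qt) Wy).
- apply: (dgen_locz lW hlW) => w [[q Qq <-]|[->|->]].
  + have [q' Qq' h] := der_image Qq; exists (J q'), 0; split; [exact: dQ.1|exact: subr0'|].
    by move=> d; rewrite h mul0r addr0.
  + exists 0, 1; split; [exact: subr0'|exact: subr1|move=> d; rewrite mul0r mul1r add0r; exact: erefl].
  + exists (J (uc v nu) * J (v ^+ p / dK t) / (l%:R * x ^+ l.-1)), 0; split; [|exact: subr0'|].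
      apply: (subrM' hW); last first.
        have [] // : unit_in W (l%:R * x ^+ l.-1); by apply: (unitM hW const_l); exact: unitX.
      by apply: (subrM' hW); apply: dQ.1 => //; case: uu.
    move=> d; rewrite hx !mul0r !addr0 der_param.
    have -> : J (v ^+ p / dK t) = J v ^+ p / J (dK t) by rewrite /= !fmorph_div !rmorphXn.
    exact: regroup.
- exact: (wedge_scalar ht' hA).
by rewrite mul0r subr0 cancel_denominator //; exact: unitX.
Qed.

(** Near E the generators are dt and d(y^-b x'). With h = 1/y, dh is eliminated by the
    differentiated equation, in which its coefficient is a unit. Passing from y^-b x' to x' yields
    h^(b(l-1)) and dh = - h^2 dy removes two factors, which leaves h^n. *)
Lemma order_chart1 n : (b * l.-1)%N = n.+2 ->
  locz (cover_chart1 p l kappa z Q v a nu) W -> ~ W y ->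
  ord_form W (Omega2 W) (c *: w0) = ord W (c * (x ^+ l.-1 * y^-1 ^+ n / (J v * J (dK t)))).
Proof.
move=> en hlW ny; have [_ AW _] := hlW; set h := y^-1; set x' := y ^- b * x.
have Wx : W x' by apply: AW; exact: ring2_r.
have Wh : W h by apply: AW; exact: ring2_l.
have h0 : h != 0 by rewrite invr_eq0.
have x'0 : x' != 0 by rewrite mulf_neq0 ?invr_eq0 ?expf_neq0.
have [A hA] := der_y hC kappa hdK dKf0 v a.
have xl0 : x' ^+ l.-1 != 0 by rewrite expf_neq0.
have uu := uc_unit hC l1 s_def hz unit_ratio CQ hd.
have Wb := dQ.1 _ (bt_mem hC hp CQ hd).
set ep := 1 + J (bt v a) * h ^+ p.
have uep : unit_in W ep by apply: one_add_unit => //; [rewrite invrK|exact: (pchar_gt0 hp)].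
have eq1 (d : der kF) := der_xi1 hC hp theta_def hl s_def hz hdK dKf0 a nu d v0.
have dh (d : der kF) : sval d h = - h ^+ 2 * (A * sval d (J f0) + J v * sval d (kappa X)).
  by rewrite -hA (jderV (j := idfun) (svalP d)) /= -exprVn.
have hx (d : der kF) := solve_xi1 L0 xl0 (etrans (eq1 d) (congr1 (fun w => _ * (_ * w + _)) (dh d))).
have ht' (d : der kF) : sval d (J t) = J (dK t) * sval d (J f0) + 0 * sval d (kappa X).
  by rewrite (der_base hC hdK dKf0 d t) mul0r addr0.
have [_ WJu [_ _ Wuei]] : [/\ True, True & unit_in W (J (uc v nu) * ep)].
  by split=> //; apply: (unitM hW) => //; exact: Junit.
have Qt : Q t by case: ht => [->//|[]].
apply: (ord_form_wedge (dQ.1 _ Qt) Wx).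
- apply: (dgen_locz lW hlW) => w [[q Qq <-]|[->|->]].
  + have [q' Qq' e1] := der_image Qq; exists (J q'), 0; split; [exact: dQ.1|exact: subr0'|].
    by move=> d; rewrite e1 mul0r addr0.
  + exists (- (h ^+ p.+1 / ep * J (v ^+ p / dK t))), (l%:R * x' ^+ l.-1 / (J (uc v nu) * ep)); split.
    * apply: (subrN' hW); apply: (subrM' hW); last exact: dQ.1.
      by apply: (subrM' hW); [exact: subrX'|case: uep].
    * apply: (subrM' hW) => //; apply: (subrM' hW); [exact: subr_nat|exact: subrX'].
    * move=> d.
      have uu0 : J (uc v nu) != 0 by case: (Junit uu).
      have ep0 : ep != 0 by case: uep.
      rewrite [LHS](solve_eta uu0 ep0 (eq1 d)) der_param.
      have -> : J (v ^+ p / dK t) = J v ^+ p / J (dK t) by rewrite /= !fmorph_div !rmorphXn.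
      rewrite addrC; congr (_ + _); rewrite mulNr; congr (- _).
      exact: regroup1.
  + exists 0, 1; split; [exact: subr0'|exact: subr1|move=> d; rewrite mul0r mul1r add0r; exact: erefl].
- exact: (wedge_scalar ht' hx).
rewrite mul0r subr0 unit_chart1 ?expf_neq0 //.
  apply: (unitN hW); apply: (unitM hW); last exact: unitV const_l.
  by apply: (unitM hW) => //; exact: Junit.
have -> : x' = h ^+ b * x by rewrite /x' exprVn.
rewrite [(h ^+ b * x) ^+ _]exprMn -exprM en -mulrA -exprD addn2; exact: mulrC.
Qed.
End AtDivisor.
End CanonicalOrder.

(** * Pluricanonical sections *)

Section CanonicalCurve.
Variables (k : closedFieldType) (K : fieldType) (iota : {rmorphism k -> K}).
Variable C : set (set K).
Hypothesis hC : smooth_projective_curve (range iota) C.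
Notation k0 := (range iota).

(** If all coordinates were constant modulo the square of the maximal ideal, so would be all chart
    functions, and the chart contains a uniformizer. *)
Lemma coordinate_uniformizer n (f : 'I_n.+1 -> K) i Q : C Q -> dvr Q ->
  locz (chart k0 (range f) (f i)) Q -> exists m c, uniformizer Q (f m / f i - iota c).
Proof.
move=> CQ dQ hl; have [_ AQ _] := hl; have [c hc] := residues hC CQ dQ AQ.
have kQ e : e != 0 -> unit_in Q (iota e) by move=> e0; apply: (unit_sub (C_k0 hC CQ)); exact: const_unit.
have [[m e1]|no] := pselect (exists m, f m / f i - iota (c m) != 0 /\ ord Q (f m / f i - iota (c m)) = 1).
  by exists m, (c m); apply: unif_ord => //; case: e1.
exfalso; have h2 m : ordge Q 2 (f m / f i - iota (c m)).
  have [e0|n0] := eqVneq (f m / f i - iota (c m)) 0; [by left|right].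
  case: (hc m) => [e0|h1]; first by rewrite e0 eqxx in n0.
  move: h1; rewrite le_eqVlt => /orP [/eqP e1|//]; by case: no; exists m.
have [t At ut] := chart_unif dQ hl.
have [e he] : exists e, ordge Q 2 (t - iota e).
  apply: (coordinates_span (N := ordge Q 2) h2) => //; first by left.
    by move=> x y; exact: ordgeD.
  move=> a x /AQ Qa hx; by have := ordgeM dQ ((ordge0P a dQ).2 Qa) hx; rewrite add0r.
have t0 := unif_neq0 ut; have ot := ord_unif ut.
have [e0|e0] := eqVneq e 0.
  move: he; rewrite e0 rmorph0 subr0 => -[h|]; last by rewrite ot.
  by rewrite h eqxx in t0.
have [_ oe] := (ord_unit _ dQ).1 (kQ _ e0).
have : ordge Q 1 (iota e).
  have -> : iota e = t - (t - iota e) by rewrite subKr.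
  apply: ordgeD => //; first by right; rewrite ot.
  by apply: ordgeN => //; apply: ordge_le he.
by case=> [h|]; [move/eqP: h; rewrite fmorph_eq0 (negPf e0)|rewrite oe].
Qed.

(* At every point one of finitely many coordinates, minus its value, is a
   uniformizer. *)
Lemma finite_canonical (dK : K -> K) h : jder idfun k0 dK -> dK h != 0 ->
  finite_set [set Q | prime_divisor C Q /\ ord_form Q (Omega1 Q) (diff h : der k0 -> K^o) <> 0].
Proof.
move=> hdK h0; have [n [f eC]] := C_proj hC.
apply: (@sub_finite_set _ _ (\bigcup_(im in [set: 'I_n.+1 * 'I_n.+1])
   [set Q | prime_divisor C Q /\ ord Q (dK h / dK (f im.1 / f im.2)) <> 0])); last first.
  apply: bigcup_finite => [|[m i] _ /=]; first exact: finite_finset.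
  have [e0|n0] := eqVneq (dK h / dK (f m / f i)) 0; last exact: (finite_ord hC n0).
  by rewrite e0 (_ : [set _ | _] = set0) //; apply/seteqP; split=> // Q [_]; rewrite ord_zero.
move=> Q [[CQ dQ] oQ]; have /proj_modelP [i [fi0 hl]] : proj_model k0 f Q by rewrite -eC.
have [m [c ut]] := coordinate_uniformizer CQ dQ hl; set t := _ - _ in ut.
have dt0 : dK t != 0.
  by apply: contraNneq h0 => e0; apply/eqP; apply: (der_zero hC hdK CQ ut e0).
exists (m, i) => //=; split=> //; move: oQ; rewrite (ord_dform hC h hdK dt0 CQ ut).
have -> // : dK t = dK (f m / f i).
have [_ _ dc] := hdK; by rewrite /t (jderB (j := idfun) hdK) (dc (iota c)) ?subr0 //; exists c.
Qed.

End CanonicalCurve.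

(** * Families of local generators adapted to the local data *)

Section CurveSections.
Variables (k : closedFieldType) (K : fieldType) (iota : {rmorphism k -> K}).
Variable C : set (set K).
Hypothesis hC : smooth_projective_curve (range iota) C.
Notation k0 := (range iota).

Variables (p : nat).
Hypothesis hp : p \in [pchar k].
Variables (D G : set K -> int) (f0 : K) (e l : nat).
Notation local_data := (local_data p D G f0 e l).
Variable dK : K -> K.
Hypothesis hdK : jder idfun k0 dK.
Hypothesis dKf0 : dK f0 = 1.
Hypothesis hdf0 : div_form_ge k0 C f0 (fun Q => p%:Z * D Q).

Lemma dform_order Q t : C Q -> uniformizer Q t ->
  ord_form Q (Omega1 Q) (diff f0 : der k0 -> K^o) = - ord Q (dK t) /\ dK t != 0.
Proof.
move=> CQ ut; have dt0 : dK t != 0.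
  by apply/eqP => e0; have := der_zero hC hdK CQ ut e0 f0; rewrite dKf0 => /eqP; rewrite oner_eq0.
by rewrite (ord_dform hC f0 hdK dt0 CQ ut) dKf0 div1r ordV //; exists t.
Qed.

Lemma exists_data Q : C Q -> exists v a nu, local_data Q v a nu.
Proof.
move=> CQ; have [->|dQ] := C_cases hC CQ; first by exists 1, 0, 1; apply: generic_data; rewrite oner_neq0.
have [t ut] := dQ; have [eo dt0] := dform_order CQ ut; have t0 := unif_neq0 ut.
have f10 : dK f0 != 0 by rewrite dKf0 oner_neq0.
have [a ha] : exists a, ordge Q (p%:Z * D Q) (f0 - a ^+ p).
  apply: (local_root hC hp hdK CQ ut dt0 f10); rewrite dKf0 div1r ordV // -eo.
  exact: (hdf0 (conj CQ dQ)).
exists (t ^ (- D Q)), a, (t ^ (- ((e %/ l)%N%:Z * G Q))); split; rewrite ?expfz_neq0 // => _.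
by rewrite !ord_expz.
Qed.

Hypotheses (hD : is_divisor C D) (hG : is_divisor C G).

(** Away from the divisors of D, G and f0 the trivial data (1, 0, 1) are valid. Hence only finitely
    many different data occur and their disagreement is confined to finitely many points. *)
Lemma global_data : exists (vv aa nn : set K -> K) (B : set (set K)), [/\ finite_set B, B `<=` prime_divisor C,
  forall Q, C Q -> local_data Q (vv Q) (aa Q) (nn Q)
  & forall Q, ~ B Q -> [/\ vv Q = 1, aa Q = 0 & nn Q = 1]].
Proof.
have f00 : f0 != 0.
  by apply/eqP => e0; have := dKf0; rewrite e0 (jder0 (j := idfun) hdK) => /esym/eqP; rewrite oner_eq0.
set B := [set Q | prime_divisor C Q /\ D Q <> 0] `|` [set Q | prime_divisor C Q /\ G Q <> 0]
  `|` [set Q | prime_divisor C Q /\ ord Q f0 <> 0].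
have /choice [dat hdat] : forall Q, exists d : K * K * K,
    (C Q -> local_data Q d.1.1 d.1.2 d.2) /\ (~ B Q -> d = (1, 0, 1)).
  move=> Q; have [BQ|nB] := pselect (B Q).
    have CQ : C Q by case: BQ => [[|]|] [[]].
    by have [v [a [nu h]]] := exists_data CQ; exists (v, a, nu).
  exists (1, 0, 1); split=> // CQ; split; rewrite ?oner_neq0 // => dQ.
  have pQ : prime_divisor C Q by [].
  have z0 (x : int) : (x <> 0 -> False) -> x = 0 by move=> h; apply: contrapT.
  have D0 : D Q = 0 by apply: z0 => h; apply: nB; left; left.
  have G0 : G Q = 0 by apply: z0 => h; apply: nB; left; right.
  have o0 : ord Q f0 = 0 by apply: z0 => h; apply: nB; right.
  rewrite ord_one // D0 G0 !mulr0 oppr0 expr0n gtn_eqF ?(pchar_gt0 hp) // subr0; split=> //.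
  by right; rewrite o0.
exists (fun Q => (dat Q).1.1), (fun Q => (dat Q).1.2), (fun Q => (dat Q).2), B; split.
- rewrite !finite_setU; do !split=> //; exact: (finite_ord hC f00).
- by move=> Q [[|]|] [].
- by move=> Q; case: (hdat Q).
- by move=> Q; case: (hdat Q) => _ h /h ->.
Qed.

(** [tau] clears the denominators at [Q] of all transition factors from the data (v, a, nu) to (v',
    a', nu'). *)
Definition compat Q (v a nu v' a' nu' tau : K) := [/\ tau != 0, Q tau,
  Q (tau * (v' / v)) /\ Q (tau * (v' * (a' - a))), Q (tau * (nu' / nu) ^+ p) & Q (tau * (v / v') ^+ p)].

Variables (vv aa nn : set K -> K).
Hypothesis hdat : forall Q, C Q -> local_data Q (vv Q) (aa Q) (nn Q).

Definition same_data P Q := [/\ vv P = vv Q, aa P = aa Q & nn P = nn Q].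

(** A pair [(P, g)] records that the sections built from [g] use the data of the point [P]. The
    first clause provides a generator with the data of [Q], with enough companions to recover [Q]
    itself; the second lets [g] pay for up to p + 1 transition factors. *)
Definition generating (L : seq (set K * K)) Q tau0 :=
  (exists P g, [/\ (P, g) \in L, same_data P Q, unit_in Q (g * tau0)
    & locz (gen_ring (k0 `|` [set g' / g | g' in [set g' | (P, g') \in L]])) Q]) /\
  (forall P g, (P, g) \in L -> exists tau,
    compat Q (vv Q) (aa Q) (nn Q) (vv P) (aa P) (nn P) tau /\ Q (g * tau0 / tau ^+ p.+1)).

Lemma compat_one Q P : C Q -> same_data P Q -> compat Q (vv Q) (aa Q) (nn Q) (vv P) (aa P) (nn P) 1.
Proof.
move=> CQ [-> -> ->]; have hQ := C_subr hC CQ; have [v0 nu0 _] := hdat CQ.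
rewrite /compat !mul1r !divff // subrr mulr0 expr1n; split; rewrite ?oner_neq0 //; try exact: subr1.
by split; [exact: subr1|exact: subr0'].
Qed.

Definition discrepancy Q P := [:: vv P / vv Q; vv P * (aa P - aa Q); (nn P / nn Q) ^+ p; (vv Q / vv P) ^+ p].

Lemma compat_discrepancy Q P t (n : nat) : C Q -> uniformizer Q t ->
  (forall x, x \in discrepancy Q P -> ordge Q (- n%:Z) x) ->
  compat Q (vv Q) (aa Q) (nn Q) (vv P) (aa P) (nn P) (t ^+ n).
Proof.
move=> CQ ut h; have hQ := C_subr hC CQ; have t0 := unif_neq0 ut; have dQ : dvr Q by exists t.
have Qt : Q t by case: ut.
have m x : x \in discrepancy Q P -> Q (t ^+ n * x).
  move=> /h hx; apply/(ordge0P _ dQ); rewrite -[0](subrr n%:Z); apply: ordgeM => //.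
  by right; rewrite ordX // (ord_unif ut) mulr1.
split; rewrite ?expf_neq0 //; first exact: subrX'.
- by split; apply: m; rewrite !inE eqxx ?orbT.
- by apply: m; rewrite !inE eqxx ?orbT.
- by apply: m; rewrite !inE eqxx ?orbT.
Qed.

Variables (n : nat) (f : 'I_n.+1 -> K) (H : set K -> int).
Hypothesis hf : polar iota C f H.
Variable Dp : set K -> int.

(** The members of [L] generate at each point but need not separate anything; multiplication by all
    [f i] adds the chart functions and raises the degree from d to d + 1. The factor [w] realizes a
    linear equivalence. *)
Lemma twisted_family (B : set (set K)) (N0 d m : nat) (L : set (set K * K)) (w : K) :
  w != 0 -> B `<=` prime_divisor C -> finite_set L ->
  (forall P x, L (P, x) -> [/\ x != 0, B P \/ P = [set: K] &
        forall Q, prime_divisor C Q ->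
          ordge Q (- (d%:Z * H Q + m%:Z * Dp Q)) x /\
          (B Q -> Q <> P -> ordge Q ((p.+1 * N0)%N%:Z - (d%:Z * H Q + m%:Z * Dp Q)) x)]) ->
  (forall Q, C Q -> exists x, (B Q /\ L (Q, x) \/ ~ B Q /\ L ([set: K], x)) /\
        (dvr Q -> ord Q x = - (d%:Z * H Q + m%:Z * Dp Q))) ->
  (forall Q, C Q -> ~ B Q -> same_data [set: K] Q) ->
  (forall Q P, B Q -> B P \/ P = [set: K] -> forall x, x \in discrepancy Q P -> ordge Q (- N0%:Z) x) ->
  (forall Q P, prime_divisor C Q -> ~ B Q -> B P \/ P = [set: K] ->
     forall x, x \in discrepancy Q P -> ordge Q 0 x) ->
  exists Ls, forall Q t tau0, C Q -> (Q = [set: K] \/ uniformizer Q t) -> tau0 != 0 ->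
    (dvr Q -> ord Q (tau0 * w) = d.+1%:Z * H Q + m%:Z * Dp Q) -> generating Ls Q tau0.
Proof.
move=> w0 BC finL hL hhome hsame hin hout.
have [sL esL] : exists sL : seq (set K * K), L = [set` sL] by apply/finite_seqP.
have mL y : y \in sL <-> L y by rewrite esL.
pose Ls := [seq (Px.1, f i * Px.2 * w) | Px <- sL, i <- enum 'I_n.+1].
have mLs P g : (P, g) \in Ls <-> exists i x, L (P, x) /\ g = f i * x * w.
  split=> [/allpairsP [[[P' x] i] /= [h1 _ [-> ->]]]|[i [x [h ->]]]].
    by exists i, x; split=> //; apply/mL.
  by apply/allpairsP; exists ((P, x), i); split=> //=; [apply/mL|rewrite mem_enum].
exists Ls => Q t tau0 CQ hQt tau00 otau; have hQ := C_subr hC CQ.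
have hord i x (j : int) : dvr Q -> ordge Q (j - (d%:Z * H Q + m%:Z * Dp Q)) x -> ordge Q j (f i * x * w * tau0).
  move=> dQ hx; have [hfi _] := hf.2 Q (conj CQ dQ).
  have ht : ordge Q (d.+1%:Z * H Q + m%:Z * Dp Q) (tau0 * w) by right; rewrite otau.
  have := ordgeM dQ (ordgeM dQ (hfi i) hx) ht.
  have -> : - H Q + (j - (d%:Z * H Q + m%:Z * Dp Q)) + (d.+1%:Z * H Q + m%:Z * Dp Q) = j.
    by rewrite -addn1 PoszD mulrDl mul1r; ring.
  by rewrite [tau0 * w]mulrC mulrA.
split.
  have [x [hx ox]] := hhome Q CQ.
  have [P LP sPQ] : exists2 P, L (P, x) & same_data P Q.
    case: hx => -[h1 h2]; first by exists Q.
    by exists [set: K] => //; exact: hsame.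
  have [x0 _ _] := hL _ _ LP.
  have [i [fi0 hli oi]] : exists i, [/\ f i != 0, locz (chart k0 (range f) (f i)) Q & dvr Q -> ord Q (f i) = - H Q].
    have [eQ|dQ] := C_cases hC CQ.
      have /proj_modelP [i [fi0 hli]] : proj_model k0 f Q by rewrite -hf.1.
      by exists i; split=> // dQ; case: (dvr_neqT dQ).
    by have [_ [i [fi0 oi hli]]] := hf.2 Q (conj CQ dQ); exists i.
  have g0 : f i * x * w != 0 by rewrite !mulf_neq0.
  exists P, (f i * x * w); split=> //; first by apply/mLs; exists i, x.
    have gt0 : f i * x * w * tau0 != 0 by rewrite mulf_neq0.
    have [eQ|dQ] := C_cases hC CQ; first by rewrite eQ.
    apply/(ord_unit _ dQ); split=> //.
    have -> : f i * x * w * tau0 = f i * x * (tau0 * w) by rewrite [tau0 * w]mulrC mulrA.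
    rewrite ordM ?mulf_neq0 // ordM // oi // ox // otau // -addn1 PoszD mulrDl mul1r; ring.
  apply: (locz_mono hli).
    apply: gen_mono => y [h|[y' [j _ <-] <-]]; [by left|right].
    exists (f j * x * w); first by apply/mLs; exists j, x.
    by rewrite -(mulrA (f j)) -(mulrA (f i)) -mulf_div divff ?mulr1 // mulf_neq0.
  apply: (gen_min hQ) => y [/(C_k0 hC CQ)//|[g' /mLs [j [x' [Lx' ->]]] <-]].
  have [eQ|dQ] := C_cases hC CQ; first by rewrite eQ.
  have [_ _ h] := hL _ _ Lx'; have [h1 _] := h Q (conj CQ dQ).
  have h2 := hord j x' 0 dQ; rewrite sub0r in h2; have /(ordge0P _ dQ) h3 := h2 h1.
  have ug : unit_in Q (f i * x * w * tau0).
    apply/(ord_unit _ dQ); split; first by rewrite mulf_neq0.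
    have -> : f i * x * w * tau0 = f i * x * (tau0 * w) by rewrite [tau0 * w]mulrC mulrA.
    rewrite ordM ?mulf_neq0 // ordM // oi // ox // otau // -addn1 PoszD mulrDl mul1r; ring.
  have -> : f j * x' * w / (f i * x * w) = (f j * x' * w * tau0) / (f i * x * w * tau0).
    by rewrite -[RHS]mulf_div divff ?mulr1.
  by apply: subrM' => //; case: ug.
move=> P g /mLs [i [x [LP ->]]]; have [x0 BP hx] := hL _ _ LP.
have [eQ|dQ] := C_cases hC CQ.
  exists 1; split; last by rewrite eQ.
  by rewrite eQ; split; rewrite ?oner_neq0.
have ut : uniformizer Q t by case: hQt => // eQ; case: (dvr_neqT dQ).
have [h1 h2] := hx Q (conj CQ dQ).
have one : compat Q (vv Q) (aa Q) (nn Q) (vv P) (aa P) (nn P) 1 ->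
    exists tau, compat Q (vv Q) (aa Q) (nn Q) (vv P) (aa P) (nn P) tau /\ Q (f i * x * w * tau0 / tau ^+ p.+1).
  move=> hc; exists 1; split=> //; rewrite expr1n divr1; apply/(ordge0P _ dQ); apply: hord => //.
  by rewrite sub0r.
have [ePQ|nPQ] := pselect (Q = P); first by apply: one; rewrite -ePQ; apply: compat_one.
have [BQ|nB] := pselect (B Q); last first.
  apply: one; have := @compat_discrepancy Q P t 0 CQ ut; rewrite expr0 oppr0; apply.
  exact: (hout _ _ (conj CQ dQ)).
(* At a bad point other than [P] the vanishing of x to order (p + 1) N0 compensates the (p + 1)-st
   power of [t ^+ N0]. *)
exists (t ^+ N0); split; first exact: compat_discrepancy (hin _ _ BQ BP).
have t0 := unif_neq0 ut.
apply/(ordge0P _ dQ); have := ordgeM dQ (hord i x _ dQ (h2 BQ nPQ)) (_ : ordge Q (- (p.+1 * N0)%N%:Z) ((t ^+ N0) ^- p.+1)).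
rewrite subrr; apply; right; rewrite ordV // -exprM ordX // (ord_unif ut) mulr1 mulnC //.
Qed.
End CurveSections.

(** Replacing D by eG = l e1 G turns (p + 1) D - p (l - 1) e1 G, the part of [twist] coming from the
    sheaves, into (p + l) e1 G; what remains is m times div(df0) - pD. *)
Lemma twist_degree (m p l1 e1 q mG G D Dp ov : int) : ov = Dp + p * D -> m = p * mG * q ->
  m * (p * l1 * (- (e1 * G)) - (- D - ov)) - (p + 1) * m * (D - e1 * (l1 + 1) * G) =
  p * q * (p + (l1 + 1)) * e1 * (mG * G) + m * Dp.
Proof. by move=> -> ->; ring. Qed.

Section TwistedSections.
Variables (k : closedFieldType) (K : fieldType) (iota : {rmorphism k -> K}).
Variable C : set (set K).
Hypothesis hC : smooth_projective_curve (range iota) C.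
Notation k0 := (range iota).

Variables (p : nat).
Hypothesis hp : p \in [pchar k].
Variables (D G : set K -> int) (f0 : K) (e l : nat).
Notation local_data := (local_data p D G f0 e l).
Variable dK : K -> K.
Hypothesis hdK : jder idfun k0 dK.
Hypothesis dKf0 : dK f0 = 1.
Hypothesis hdf0 : div_form_ge k0 C f0 (fun Q => p%:Z * D Q).
Hypotheses (hD : is_divisor C D) (hG : is_divisor C G) (hGample : ample k0 C G).
Hypotheses (e0 : (0 < e)%N) (hle : (l %| e)%N) (l0 : (0 < l)%N).
Variable hh : K.
Hypothesis hh0 : hh != 0.
Hypothesis ord_hh : forall Q, prime_divisor C Q -> ord Q hh = D Q - e%:Z * G Q.

(** The part coming from [C] of the m-th power of x'^(l-1) / (v dt), the factor found in
    [order_chart0]. *)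
Definition twist (m : nat) (v nu dt : K) := (nu ^+ (p * l.-1) / (v * dt)) ^+ m.

(* Up to linear equivalence m K_X is the pull-back of a divisor on C with local
   equation tau0, plus a m times that of E; twisting by theta^r moves the latter to
   C, since theta has a pole of order p along E and p r = a m. *)
Lemma curve_sections (a b : nat) : (0 < a)%N -> exists (vv aa nn : set K -> K) (m r : nat) (L1 L2 : seq (set K * K)),
  [/\ (forall P, vv P != 0) /\ forall Q, C Q -> local_data Q (vv Q) (aa Q) (nn Q),
      (0 < m)%N, (p * r = a * m)%N /\ (0 < r)%N, (b <= p * r)%N &
   forall Q t, C Q -> (Q = [set: K] \/ uniformizer Q t) -> dK t != 0 ->
     let tau0 := twist m (vv Q) (nn Q) (dK t) in
     generating iota p vv aa nn L1 Q tau0 /\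
     generating iota p vv aa nn L2 Q (tau0 * vv Q ^- (p * r))].
Proof.
move=> a0; have p0 := pchar_gt0 hp; set e1 := (e %/ l)%N; have ee : e = (e1 * l)%N by rewrite divnK.
have e10 : (0 < e1)%N by move: e0; rewrite ee; case: (e1).
have [mG mG0 /very_ample_polar [n [f hf]]] := hGample; set H := (fun W : set K => _) in hf.
pose om Q := ord_form Q (Omega1 Q) (diff f0 : der k0 -> K^o).
pose Dp Q := om Q - p%:Z * D Q.
have Dp0 Q : prime_divisor C Q -> 0 <= Dp Q by move=> pQ; rewrite subr_ge0; exact: hdf0.
have f10 : dK f0 != 0 by rewrite dKf0 oner_neq0.
have finDp : finite_set [set Q | prime_divisor C Q /\ Dp Q <> 0].
  apply: (sub_finite_set _ (_ : finite_set ([set Q | prime_divisor C Q /\ om Q <> 0] `|` [set Q | prime_divisor C Q /\ D Q <> 0]))).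
    move=> Q [pQ h]; have [o0|] := eqVneq (om Q) 0; last by move/eqP=> ?; left.
    have [d0|] := eqVneq (D Q) 0; last by move/eqP=> ?; right.
    by case: h; rewrite /Dp o0 d0 mulr0 subr0.
  by rewrite finite_setU; split=> //; exact: (finite_canonical hC hdK f10).
have [vv [aa [nn [B0 [finB0 B0C hdat htriv]]]]] := global_data hC hp e l hdK dKf0 hdf0 hD hG.
pose supp P := [set Q | prime_divisor C Q /\ ord Q (vv P) <> 0] `|` [set Q | prime_divisor C Q /\ ord Q (aa P) <> 0]
  `|` [set Q | prime_divisor C Q /\ ord Q (nn P) <> 0].
have fin1 h : finite_set [set Q | prime_divisor C Q /\ ord Q h <> 0].
  have [->|h0] := eqVneq h 0; last exact: (finite_ord hC h0).
  by rewrite (_ : [set _ | _] = set0) //; apply/seteqP; split=> // Q [_]; rewrite ord_zero.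
have finB : finite_set (B0 `|` \bigcup_(P in B0) supp P).
  by rewrite finite_setU; split=> //; apply: bigcup_finite => // P _; rewrite !finite_setU; do !split.
have BC : B0 `|` \bigcup_(P in B0) supp P `<=` prime_divisor C.
  by move=> Q [/B0C//|[P _ [[|]|] []]].
have [B [finB' BB BC' hB]] := ample_sections hC hf Dp0 finDp finB BC.
have nB0T : ~ B0 [set: K] by move=> /B0C [_ /dvr_neqT].
have trT := htriv _ nB0T.
have hsame Q : C Q -> ~ B Q -> same_data vv aa nn [set: K] Q.
  move=> CQ nB; have [|e2 e3 e4] := htriv Q; first by move=> h; apply: nB; apply: BB; left.
  by case: trT => e5 e6 e7; split; rewrite ?e2 ?e3 ?e4.
have hout Q P : prime_divisor C Q -> ~ B Q -> B P \/ P = [set: K] ->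
    forall x, x \in discrepancy p vv aa nn Q P -> ordge Q 0 x.
  move=> [CQ dQ] nB hP x; have hQ := C_subr hC CQ.
  have [|v1 a1 n1] := htriv Q; first by move=> h; apply: nB; apply: BB; left.
  have [Qv Qv' Qa Qn] : [/\ Q (vv P), Q (vv P)^-1, Q (aa P) & Q (nn P)].
    have [BP|nBP] := pselect (B0 P); last first.
      have [-> -> ->] := htriv P nBP; rewrite invr1; split; try exact: subr1; exact: subr0'.
    have [CP _] := B0C _ BP; have [v0 n0 _] := hdat P CP.
    have nsupp : ~ supp P Q by move=> h; apply: nB; apply: BB; right; exists P.
    have z0 (h : K) : (ord Q h <> 0 -> False) -> ord Q h = 0 by move=> ?; apply: contrapT.
    have ov : ord Q (vv P) = 0 by apply: z0 => h; apply: nsupp; left; left.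
    have oa : ord Q (aa P) = 0 by apply: z0 => h; apply: nsupp; left; right.
    have on : ord Q (nn P) = 0 by apply: z0 => h; apply: nsupp; right.
    split; apply/(ordge0P _ dQ); right; by rewrite ?ordV ?ov ?oa ?on.
  move=> hx; apply/(ordge0P _ dQ); move: hx; rewrite !inE v1 a1 n1 !divr1 subr0 div1r.
  move=> /or4P [] /eqP -> //; [exact: subrM'|exact: subrX'|exact: subrX'].
have [sB esB] : exists sB : seq (set K), B = [set` sB] by apply/finite_seqP.
pose N0 := (\max_(Q <- sB) \max_(P <- [set: K] :: sB) \max_(x <- discrepancy p vv aa nn Q P) `|ord Q x|)%N.
have hin Q P : B Q -> B P \/ P = [set: K] -> forall x, x \in discrepancy p vv aa nn Q P -> ordge Q (- N0%:Z) x.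
  move=> BQ BP x hx; right.
  have sQ : Q \in sB by move: BQ; rewrite esB.
  have sP : P \in [set: K] :: sB.
    by rewrite inE; case: BP => [|->]; [rewrite esB => /= ->; rewrite orbT|rewrite eqxx].
  have h1 : (`|ord Q x| <= N0)%N.
    apply: leq_trans (leq_bigmax_seq _ sQ isT); apply: leq_trans (leq_bigmax_seq _ sP isT).
    exact: leq_bigmax_seq hx isT.
  by clear -h1; lia.
have [d0 hd0] := hB (p.+1 * N0)%N.
(* m is divisible by p, so that r is an integer, and by [mG], so that m G is a multiple of [H]; the
   free factor [q] makes all degrees large at once. *)
pose q := (d0 + b + 2)%N; pose m := (p * mG * q)%N; pose r := (a * mG * q)%N.
(* One degree is reserved for the factors [f i]. The increase in [d2] is the degree of v^-(p r),
   since p r D is equivalent to (p a q e) [H]. *)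
pose d := (p * q * (p + l) * e1).-1; pose d2 := (d + p * a * q * e)%N.
have dS : d.+1 = (p * q * (p + l) * e1)%N.
  by rewrite prednK // !muln_gt0 p0 e10 addn_gt0 p0 /q addn2.
have d0d : (d0 <= d)%N.
  rewrite -ltnS dS; apply: (@leq_trans q); first by rewrite /q; clear; lia.
  by rewrite -mulnA -mulnA mulnCA leq_pmulr // !muln_gt0 p0 e10 addn_gt0 p0.
have d0d2 : (d0 <= d2)%N by apply: leq_trans d0d _; exact: leq_addr.
have d0m : (d0 <= m)%N.
  apply: (@leq_trans q); first by rewrite /q; clear; lia.
  by rewrite /m leq_pmull // muln_gt0 p0.
have pr : (p * r = a * m)%N by rewrite /r /m; clear; lia.
have [L1 [finL1 hL1 home1]] := hd0 d m d0d d0m.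
have [L2 [finL2 hL2 home2]] := hd0 d2 m d0d2 d0m.
have w0 N : hh ^- N != 0 by rewrite invr_eq0 expf_neq0.
(* The divisor of [hh] is D - eG, so these powers of [hh] trade the (p + 1) m copies of D, and for
   the second family p r further ones, for multiples of G. *)
have [Ls1 g1] := twisted_family hC hdat hf (w0 (p.+1 * m)%N) BC' finL1 hL1 home1 hsame hin hout.
have [Ls2 g2] := twisted_family hC hdat hf (w0 (p.+1 * m + p * r)%N) BC' finL2 hL2 home2 hsame hin hout.
exists vv, aa, nn, m, r, Ls1, Ls2; split=> //.
- split=> // P; have [BP|/htriv [-> _ _]] := pselect (B0 P); last exact: oner_neq0.
  by have [CP _] := B0C _ BP; case: (hdat P CP).
- by rewrite /m !muln_gt0 p0 mG0 /q addn2.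
- by split=> //; rewrite /r !muln_gt0 a0 mG0 /q addn2.
- apply: (@leq_trans q); first by rewrite /q; clear; lia.
  by rewrite /r mulnA mulnA leq_pmull // !muln_gt0 p0 a0.
move=> Q t CQ hQt dt0 tau0; have [v0 n0 hloc] := hdat Q CQ.
have nz : nn Q ^+ (p * l.-1) / (vv Q * dK t) != 0 by rewrite mulf_neq0 ?expf_neq0 // invr_eq0 mulf_neq0.
have tau00 : tau0 != 0 by rewrite expf_neq0.
have otau : dvr Q -> ord Q (tau0 * hh ^- (p.+1 * m)) = d.+1%:Z * H Q + m%:Z * Dp Q.
  move=> dQ; have [ov on _] := hloc dQ.
  have ut : uniformizer Q t by case: hQt => // eQ; case: (dvr_neqT dQ).
  have [eo _] := dform_order hC hdK dKf0 CQ ut.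
  have hh0' N : hh ^- N != 0 by exact: w0.
  rewrite ordM // ordV // /tau0 /twist !ordX // ordM ?expf_neq0 ?invr_eq0 ?mulf_neq0 // ordV // ordM // ordX // ov on.
  rewrite ord_hh // -/e1 ee dS.
  have := @twist_degree m p l.-1 e1 q mG (G Q) (D Q) (Dp Q) (om Q).
  have -> : ord Q (dK t) = - om Q by rewrite /om eo opprK.
  have el : l%:Z = l.-1%:Z + 1 by rewrite -{1}(prednK l0) -addn1 PoszD.
  have ep : p.+1%:Z = p%:Z + 1 by rewrite -addn1 PoszD.
  rewrite /H !PoszM !PoszD ep el => <- //.
  exact: (esym (subrK (p%:Z * D Q) (om Q))).
split; first exact (g1 Q t tau0 CQ hQt tau00 otau).
apply: (g2 Q t _ CQ hQt); first by rewrite mulf_neq0 // invr_eq0 expf_neq0.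
move=> dQ; have [ov _ _] := hloc dQ.
have -> : tau0 * vv Q ^- (p * r) * hh ^- (p.+1 * m + p * r) =
    tau0 * hh ^- (p.+1 * m) * (vv Q ^- (p * r) * hh ^- (p * r)) by rewrite exprD invfM mulrACA -mulrA [hh ^- _ * _]mulrC mulrA.
rewrite ordM ?mulf_neq0 ?w0 // ?invr_eq0 ?expf_neq0 //; rewrite otau // ordM ?w0 ?invr_eq0 ?expf_neq0 // !ordV // !ordX // ov ord_hh //.
have -> : d2.+1 = (d.+1 + p * a * q * e)%N by rewrite /d2 addSn.
rewrite /r /H !PoszD !PoszM; ring.
Qed.
End TwistedSections.

(** [S] dominates the center of [A]. Once [B] lies in that center, so do all fractions of [B] whose
    denominators are units of [S]; hence the center is [S]. *)
Lemma locz_by_center (F : fieldType) (A B S : set F) : subr A -> A `<=` S -> locz B S ->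
  B `<=` center A S -> locz A S.
Proof.
move=> hA AS [lS BS fr] BR; have [hR [RS Rinv]] := centerP hA lS AS.
have [lR _ _] := hR; have sR := local_subr lR.
suff <- : center A S = S by [].
apply/seteqP; split=> // s /fr [x [c [/BR Rx /BR Rc [c0 _ Sc'] ->]]].
by apply: (subrM' sR) => //; exact: Rinv.
Qed.

(** Each factor [Y], [X] or [W] uses up one [t]. The longest products are W Y^(p-1), with p factors,
    and W X Y^(p-b), with p - b + 2 <= p + 1 because b >= 1; this explains the exponent p + 1. *)
Lemma section_members (F : fieldType) (S : set F) (h t Y X W ep q G : F) (p b r : nat) : subr S ->
  S h -> S t -> S (t * (Y * h)) -> S (t * (X * h ^+ b)) -> S (t * W) -> S ep -> S q ->
  G = q * t ^+ p.+1 -> (0 < b)%N -> (b <= p)%N -> (0 < r)%N -> (b <= p * r)%N ->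
  [/\ S (G * h ^+ (p * r)), S (G * Y * h ^+ (p * r)) & S (G * X * h ^+ (p * r))] /\
  [/\ S (G * ep ^+ r), S (G * ep ^+ r.-1 * W * h ^+ p),
      S (G * ep ^+ r.-1 * W * Y ^+ p.-1 * h ^+ p)
    & S (G * ep ^+ r.-1 * W * (X * Y ^+ (p - b)) * h ^+ p)].
Proof.
move=> hS Sh St SY SX SW Se Sq -> b0 bp r0 bpr; have p0 : (0 < p)%N by apply: leq_trans bp.
have X' n x : S x -> S (x ^+ n) by exact: subrX'.
have pr0 : (0 < p * r)%N by rewrite muln_gt0 p0.
split; split.
- by rewrite exprS; do !apply: (subrM' hS) => //; exact: X'.
- have -> : q * t ^+ p.+1 * Y * h ^+ (p * r) = q * t ^+ p * (t * (Y * h)) * h ^+ (p * r).-1.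
    have -> : h ^+ (p * r) = h * h ^+ (p * r).-1 by rewrite -exprS prednK.
    by rewrite exprS; move: (t ^+ p) (h ^+ _) => *; ring.
  by do !apply: (subrM' hS) => //; exact: X'.
- have -> : q * t ^+ p.+1 * X * h ^+ (p * r) = q * t ^+ p * (t * (X * h ^+ b)) * h ^+ (p * r - b).
    have -> : h ^+ (p * r) = h ^+ b * h ^+ (p * r - b) by rewrite -exprD subnKC.
    by rewrite exprS; move: (t ^+ p) (h ^+ (p * r - b)) (h ^+ b) => *; ring.
  by do !apply: (subrM' hS) => //; exact: X'.
- by do !apply: (subrM' hS) => //; exact: X'.
- have -> : q * t ^+ p.+1 * ep ^+ r.-1 * W * h ^+ p = q * t ^+ p * ep ^+ r.-1 * (t * W) * h ^+ p.
    by rewrite exprS; move: (t ^+ p) (h ^+ p) (ep ^+ _) => *; ring.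
  by do !apply: (subrM' hS) => //; exact: X'.
- have -> : q * t ^+ p.+1 * ep ^+ r.-1 * W * Y ^+ p.-1 * h ^+ p =
     q * ep ^+ r.-1 * t * (t * W) * (t * (Y * h)) ^+ p.-1 * h.
    case: p p0 {bp bpr pr0} => // p' _; rewrite !exprMn !exprS /=.
    by move: (t ^+ p') (h ^+ p') (ep ^+ _) (Y ^+ p') => *; ring.
  by do !apply: (subrM' hS) => //; exact: X'.
have -> : q * t ^+ p.+1 * ep ^+ r.-1 * W * (X * Y ^+ (p - b)) * h ^+ p =
   q * ep ^+ r.-1 * t ^+ b.-1 * (t * W) * (t * (X * h ^+ b)) * (t * (Y * h)) ^+ (p - b).
  have -> : h ^+ p = h ^+ b * h ^+ (p - b) by rewrite -exprD subnKC.
  have -> : t ^+ p.+1 = t * (t * t ^+ b.-1) * t ^+ (p - b) by rewrite -exprS prednK // -mulrA -exprD subnKC // exprS.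
  rewrite !exprMn; move: (h ^+ b) (h ^+ (p - b)) (t ^+ b.-1) (t ^+ (p - b)) (ep ^+ _) (Y ^+ _) => *; ring.
by do !apply: (subrM' hS) => //; exact: X'.
Qed.

Lemma section_ratio1 (F : fieldType) (j Ph w : F) : j != 0 -> Ph != 0 -> (j * w / Ph) / (j * 1 / Ph) = w.
Proof. by move=> h h'; field; rewrite h h'. Qed.

Lemma section_ratio2 (F : fieldType) (j j' T Ph : F) : j != 0 -> Ph != 0 -> T != 0 ->
  (j' * T / Ph) / (j * T / Ph) = j' / j.
Proof. by move=> h h' h2; field; rewrite h h' h2. Qed.

Lemma section_ratio3 (F : fieldType) (j V th y w ep Ph : F) p r : j != 0 -> Ph != 0 -> th != 0 -> V != 0 ->
  y != 0 -> (0 < r)%N -> V ^+ p * th * y^-1 ^+ p = ep ->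
  (j * (th ^+ r.-1 * V ^- p * w) / Ph) / (j * th ^+ r / Ph) = w / y ^+ p / ep.
Proof.
move=> h h' h2 V0 y0; case: r => // r _ /= <-; rewrite exprS exprVn.
have := expf_neq0 p V0; have := expf_neq0 p y0; have := expf_neq0 r h2.
by move: (V ^+ p) (y ^+ p) (th ^+ r) => A B D' D0 B0 A0; field; rewrite D0 B0 A0 h h' h2.
Qed.

Lemma one_sub_inv (F : fieldType) (ep B h : F) : ep != 0 -> ep = 1 + B * h -> ep^-1 = 1 - B * (h / ep).
Proof.
move=> e0 e; apply: (mulfI e0); rewrite divff // mulrBr mulr1 mulrCA [_ * (h / _)]mulrC divfK // e.
by rewrite addrK.
Qed.

Lemma section_scale (F : fieldType) (j w Ph T H : F) : Ph != 0 ->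
  j * w / Ph * (Ph * T * H) = j * T * w * H.
Proof. by move=> h; field. Qed.

Lemma section_scale_theta (F : fieldType) (j Ph T V th h : F) p r : Ph != 0 -> V != 0 ->
  j * th ^+ r / Ph * (Ph * T * h ^+ (p * r)) = j * T * V ^- (p * r) * (V ^+ p * th * h ^+ p) ^+ r.
Proof.
move=> h0 V0; rewrite section_scale // !exprMn -!exprM; have := expf_neq0 (p * r) V0.
by move: (V ^+ _) (th ^+ r) (h ^+ _) => A B C' A0; field.
Qed.

Lemma section_scale_local (F : fieldType) (j Ph T V U th h w : F) p r : Ph != 0 -> V != 0 -> U != 0 -> (0 < r)%N ->
  j * (th ^+ r.-1 * U ^- p * w) / Ph * (Ph * T * h ^+ (p * r)) =
  j * T * V ^- (p * r) * (V ^+ p * th * h ^+ p) ^+ r.-1 * (V / U) ^+ p * w * h ^+ p.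
Proof.
move=> h0 V0 U0; case: r => // r _ /=; rewrite section_scale // [(V / U) ^+ p]exprMn.
rewrite [(V ^+ p * th * h ^+ p) ^+ r]exprMn [(V ^+ p * th) ^+ r]exprMn exprVn -!exprM mulnSr !exprD.
have := expf_neq0 (p * r) V0; have := expf_neq0 p V0; have := expf_neq0 p U0.
move: (V ^+ (p * r)) (V ^+ p) (U ^+ p) (th ^+ r) (h ^+ (p * r)) (h ^+ p) => A B C' D' E' F' C0 B0 A0.
by field; rewrite A0 B0 C0.
Qed.

(** * Very ampleness of a multiple of the canonical divisor *)

Section CoverSections.
Variables (k : closedFieldType) (K : fieldType) (iota : {rmorphism k -> K}).
Variable C : set (set K).
Hypothesis hC : smooth_projective_curve (range iota) C.
Notation k0 := (range iota).
Variables (p : nat).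
Hypothesis hp : p \in [pchar k].
Variables (D G : set K -> int) (f0 : K) (e l : nat).
Notation E := (raynaud_E p C D f0).
Notation L := (OD C D).
Notation Nl := (expS (OD C G) (e %/ l)).
Notation P := (raynaud_P C E).
Notation X := (ratX K).
Notation local_data := (local_data p D G f0 e l).
Hypothesis data_exists : forall Q, C Q -> exists v a nu, local_data Q v a nu.
Variables (F : fieldType) (kappa : {rmorphism ruled_field K -> F}) (z : F).
Notation J := (kappa \o @ratC K).
Notation M := (raynaud_M p l C E Nl).
Notation Xs := (cyclic_cover kappa P M z).
Notation b := (p.+1 %/ l)%N.
Notation yy v a := (kappa (fib v a)).
Notation xi nu := (kappa (ratC (nu ^+ p)) * z).
Variables (theta s : ruled_field K) (hh : K) (c0 : k).
Hypothesis theta_def : theta = X ^+ p + ratC f0.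
Hypothesis hl : (l %| p.+1)%N.
Hypothesis l1 : (1 < l)%N.
Hypothesis s_def : s = ratC (iota c0) * theta / ratC hh ^+ p.
Hypothesis hh0 : hh != 0.
Hypothesis hz : radical_extension kappa l s z.
Hypothesis unit_ratio : forall Q v a nu, C Q -> local_data Q v a nu -> unit_in Q (hh * v / nu ^+ l).
Notation uc v nu := (unit_coef iota p l hh c0 v nu).
Notation bt v a := (beta p f0 v a).
Notation kF := (range (fun c => kappa (ratC (iota c)))).
Variable dK : K -> K.
Hypothesis hdK : jder idfun k0 dK.
Hypothesis dKf0 : dK f0 = 1.
Notation w0 := (wedge (J f0) (kappa X) : der kF -> der kF -> F^o).
Variable c : F.
Hypotheses (c_neq0 : c != 0) (w0_neq0 : w0 != 0).
Variables (vv aa nn : set K -> K) (m r n0 : nat) (L1 L2 : seq (set K * K)).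
Hypotheses (vv_neq0 : forall P, vv P != 0) (hdat : forall Q, C Q -> local_data Q (vv Q) (aa Q) (nn Q))
  (m0 : (0 < m)%N) (hpr : (p * r = n0 * m)%N) (r0 : (0 < r)%N) (hbr : (b <= p * r)%N) (hn0 : (b * l.-1)%N = n0.+2).
Hypothesis hgen : forall Q t, C Q -> (Q = [set: K] \/ uniformizer Q t) -> dK t != 0 ->
  let tau0 := twist p l m (vv Q) (nn Q) (dK t) in
  generating iota p vv aa nn L1 Q tau0 /\ generating iota p vv aa nn L2 Q (tau0 * vv Q ^- (p * r)).
Hypothesis hpar : forall Q, C Q -> exists t, [/\ Q = [set: K] \/ uniformizer Q t, dK t != 0 & Q (vv Q ^+ p / dK t)].
Variable KX : set F -> int.
Hypothesis hKX : forall W, prime_divisor Xs W -> KX W = ord_form W (Omega2 W) (c *: w0).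

Let th := kappa theta.
(** The part of the local equation of m K_X that is the same at all points of [C]; division by it
    makes the sections elements of [F]. *)
Let Phi := (c * z ^+ l.-1) ^+ m.
Let yP P := yy (vv P) (aa P).
Let xP P := xi (nn P).

(* The first family generates away from the section at infinity, the second one
   near it. *)
Definition sections1 (Pg : set K * K) : seq F :=
  [seq J Pg.2 * w / Phi | w <- [:: 1; yP Pg.1; xP Pg.1]].
Definition sections2 (Pg : set K * K) : seq F :=
  J Pg.2 * th ^+ r / Phi ::
  [seq J Pg.2 * (th ^+ r.-1 * J (vv Pg.1) ^- p * w) / Phi
    | w <- [:: 1; yP Pg.1 ^+ p.-1; xP Pg.1 * yP Pg.1 ^+ (p - b)]].
Definition cover_sections := [seq w | Pg <- L1, w <- sections1 Pg] ++ [seq w | Pg <- L2, w <- sections2 Pg].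

Lemma cover_sectionsP w : w \in cover_sections <->
  (exists2 Pg, Pg \in L1 & w \in sections1 Pg) \/ (exists2 Pg, Pg \in L2 & w \in sections2 Pg).
Proof.
rewrite mem_cat; split=> [/orP [] /allpairsPdep [Pg [w' [h1 h2 ->]]]|[] [Pg h1 h2]].
- by left; exists Pg.
- by right; exists Pg.
- by apply/orP; left; apply/allpairsPdep; exists Pg, w.
- by apply/orP; right; apply/allpairsPdep; exists Pg, w.
Qed.

Lemma bpos : (0 < b)%N /\ (b <= p)%N.
Proof.
have e1 := bl hl; have p0 := pchar_gt0 hp; split; first by move: e1; case: b.
have h : (b * 2 <= b * l)%N by rewrite leq_mul2l l1 orbT.
rewrite e1 in h.
by clear -h p0; lia.
Qed.

Lemma Phi_neq0 : Phi != 0.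
Proof. by rewrite expf_neq0 // mulf_neq0 // expf_neq0 // (z_neq0 l1 hz). Qed.

Lemma JM x y : J (x * y) = J x * J y. Proof. by rewrite /= !rmorphM. Qed.
Lemma JX x n : J (x ^+ n) = J x ^+ n. Proof. by rewrite /= !rmorphXn. Qed.
Lemma JV x : J (x^-1) = (J x)^-1. Proof. by rewrite /= !fmorphV. Qed.

Section AtPoint.
Variables (S : set F) (Q : set K) (t : K).
Hypotheses (lS : islocal S) (CQ : C Q) (dS : dominates J S Q).
Hypotheses (ht : Q = [set: K] \/ uniformizer Q t) (dt0 : dK t != 0).
Let hS := local_subr lS.
Let v := vv Q.
Let a := aa Q.
Let nu := nn Q.
Let tau0 := twist p l m v nu (dK t).
Variable h : F.
Hypotheses (Sh : S h) (Shy : S (yP Q * h)) (Shx : S (xP Q * h ^+ b)).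
Hypothesis Sep : S (J v ^+ p * th * h ^+ p).
Let v0 : v != 0. Proof. by case: (hdat CQ). Qed.
Let nu0 : nu != 0. Proof. by case: (hdat CQ). Qed.

Lemma tau0_neq0 : tau0 != 0.
Proof. by rewrite expf_neq0 // mulf_neq0 ?expf_neq0 // invr_eq0 mulf_neq0. Qed.

Lemma compat_members P g ep g' : (exists tau, compat p Q v a nu (vv P) (aa P) (nn P) tau /\ Q (g / tau ^+ p.+1)) ->
  S ep -> g' = J g ->
  [/\ S (g' * h ^+ (p * r)), S (g' * yP P * h ^+ (p * r)) & S (g' * xP P * h ^+ (p * r))] /\
  [/\ S (g' * ep ^+ r), S (g' * ep ^+ r.-1 * J (v / vv P) ^+ p * h ^+ p),
      S (g' * ep ^+ r.-1 * J (v / vv P) ^+ p * yP P ^+ p.-1 * h ^+ p)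
    & S (g' * ep ^+ r.-1 * J (v / vv P) ^+ p * (xP P * yP P ^+ (p - b)) * h ^+ p)].
Proof.
move=> [tau [[tau_0 Qt [Q1 Q2] Q3 Q4] Qg]] Sep' eG; have [b0 bp] := bpos.
apply: (@section_members _ S h (J tau) (yP P) (xP P) _ ep (J (g / tau ^+ p.+1)) _ p b r hS Sh) => //.
- exact: dS.1.
- have -> : yP P = J (vv P / v) * yP Q + J (vv P * (aa P - a)).
    by rewrite /yP /= -rmorphM -rmorphD; congr (kappa _); rewrite /fib mulrA -rmorphM divfK // rmorphM rmorphB; ring.
  have e4 (T A B y x : F) : T * ((A * y + B) * x) = T * A * (y * x) + T * B * x by ring.
  rewrite e4 -!JM.
  by apply: (subrD' hS); apply: (subrM' hS) => //; apply: dS.1.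
- have -> : xP P = J ((nn P / nu) ^+ p) * xP Q.
    by rewrite /xP mulrA /= -rmorphM -rmorphM -exprMn divfK.
  by rewrite -mulrA mulrA -JM; apply: (subrM' hS) => //; apply: dS.1.
- by rewrite -JX -JM; apply: dS.1.
- exact: dS.1.
by rewrite eG -JX -JM divfK // expf_neq0.
Qed.

(** A local equation of m K_X. Here [h] is 1 away from E and 1/y near E, where p r = n m gives the
    multiplicity of E. *)
Let sigma := Phi * J tau0 * h ^+ (p * r).

Lemma sections_members w : w \in cover_sections -> S (w * sigma).
Proof.
have [[_ g1] [_ g2]] := hgen CQ ht dt0; have F0 := Phi_neq0.
have Jv0 : J v != 0 by rewrite !fmorph_eq0.
case/cover_sectionsP => -[[P g] hL].
  have [[m1 m2 m3] _] := compat_members (g1 P g hL) Sep (erefl _).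
  have eG : J (g * tau0) = J g * J tau0 by exact: JM.
  by rewrite !inE => /or3P [] /eqP ->; rewrite section_scale // -eG ?mulr1.
have [_ [m1 m2 m3 m4]] := compat_members (g2 P g hL) Sep (erefl _).
have eG : J (g * (tau0 * v ^- (p * r))) = J g * J tau0 * J v ^- (p * r).
  by rewrite mulrA 2!JM JV JX.
rewrite eG in m1 m2 m3 m4.
have U0 : J (vv P) != 0 by rewrite !fmorph_eq0; exact: vv_neq0.
have eW : J (v / vv P) = J v / J (vv P) by rewrite JM JV.
rewrite eW in m2 m3 m4.
rewrite inE => /orP [/eqP ->|]; first by rewrite (section_scale_theta _ _ _ _ _ _ Phi_neq0 Jv0).
rewrite !inE => /or3P [] /eqP ->; rewrite (section_scale_local _ _ _ _ _ _ Phi_neq0 Jv0 U0 r0) //.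
by rewrite mulr1.
Qed.
End AtPoint.

(** As x' = nu^p z, the power x'^(l-1) splits into a factor from [C], which goes into [twist], and
    z^(l-1), which goes into [Phi]. The alternative h = 1 covers the chart away from E. *)
Lemma order_twist v nu dt n h : nu != 0 -> v != 0 -> dt != 0 -> (n * m)%N = (p * r)%N \/ h = 1 ->
  (c * (xi nu ^+ l.-1 * h ^+ n / (J v * J dt))) ^+ m = Phi * J (twist p l m v nu dt) * h ^+ (p * r).
Proof.
move=> nu0 v0 d0 hn; rewrite /twist JX JM JV !JM JX.
have -> : xi nu ^+ l.-1 = J nu ^+ (p * l.-1) * z ^+ l.-1.
  by rewrite exprMn -!rmorphXn exprM !rmorphXn.
have -> : h ^+ (p * r) = (h ^+ n) ^+ m by rewrite -exprM; case: hn => [->|->] //; rewrite !expr1n.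
rewrite /Phi -!exprMn; congr (_ ^+ m).
move: (J nu ^+ _) (J v * J dt) (z ^+ _) (h ^+ n) => A B Z N; ring.
Qed.

(** The ratios of the family members with the data of [P] generate a ring of which [Q] is a
    localization, so functions of [Q] are fractions of ratios of sections. *)
Lemma fraction_mem (S A : set F) Q P g (L : seq (set K * K)) : subr A -> islocal S -> C Q ->
  A `<=` S -> dominates J S Q -> kF `<=` A -> (forall g', (P, g') \in L -> A (J (g' / g))) ->
  locz (gen_ring (k0 `|` [set g' / g | g' in [set g' | (P, g') \in L]])) Q ->
  J @` Q `<=` center A S.
Proof.
move=> hA lS CQ AS dS kA gA [_ _ fr] _ [q /fr [u [w [Au Aw [w0' Qw Qw'] ->]]] <-].
have sub x : gen_ring (k0 `|` [set g' / g | g' in [set g' | (P, g') \in L]]) x -> A (J x).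
  apply: (@gen_min _ _ [set x | A (J x)]); last first.
    by move=> y [[c' _ <-]|[g' hg' <-]]; [apply: kA; exists c'|exact: gA].
  split; rewrite /= ?rmorph1; first exact: subr1.
  - by move=> x1 x2 h1 h2; rewrite !rmorphB; exact: subrB'.
  - by move=> x1 x2 h1 h2; rewrite !rmorphM; exact: subrM'.
exists (J u), (J w); split; [exact: sub|exact: sub| |by rewrite JM JV].
by split; [rewrite !fmorph_eq0|exact: dS.1|rewrite -JV; exact: dS.1].
Qed.

(** At each point one section is a local generator of O(m K_X), and its chart has [S] as a
    localization: the chart generators of the cover are recovered from ratios of sections up to
    denominators that are units at [S]. *)
Lemma local_generator S : Xs S -> exists sigma x0,
  [/\ sigma != 0, x0 \in cover_sections, x0 != 0, unit_in S (x0 * sigma)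
    & forall w, w \in cover_sections -> S (w * sigma)] /\
  locz (chart kF [set` cover_sections] x0) S /\ (dvr S -> m%:Z * KX S = ord S sigma).
Proof.
move=> XS; have [lS [Q [CQ dS hch]]] := cover_charts hC hp data_exists XS.
have hS := local_subr lS; have hQ := C_subr hC CQ; have hd := hdat CQ; have [v0 nu0 _] := hd.
have [t [ht dt0 hvt]] := hpar CQ.
have Jv0 : J (vv Q) != 0 by rewrite !fmorph_eq0.
have SJ q : Q q -> S (J q) by exact: dS.1.
have kS : kF `<=` S by move=> _ [c' _ <-]; apply: (SJ (iota c')); apply: (C_k0 hC CQ); exact: const_mem.
have [g1 g2] := hgen CQ ht dt0; have F0 := Phi_neq0.
have T0 := tau0_neq0 CQ dt0.
have p0 := pchar_gt0 hp.
set y := yP Q; set x := xP Q.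
have y0 : y != 0 by rewrite fmorph_eq0; exact: fib_neq0.
have eth : J (vv Q) ^+ p * th = y ^+ p + J (bt (vv Q) (aa Q)).
  have := congr1 kappa (theta_fib iota hp theta_def (vv Q) (aa Q)).
  rewrite rmorphM rmorphD [kappa (fib _ _ ^+ p)]rmorphXn -JX => e1; exact: e1.
have Sb := SJ _ (bt_mem hC hp CQ hd).
have ratio x0 sigma : sigma != 0 -> unit_in S (x0 * sigma) -> (forall w, w \in cover_sections -> S (w * sigma)) ->
    chart kF [set` cover_sections] x0 `<=` S.
  move=> s0 [x0s _ Sxs] hw; apply: chart_sub_ring => // w /hw Sw.
  have -> : w / x0 = (w * sigma) * (x0 * sigma)^-1 by rewrite -mulf_div divff ?mulr1.
  exact: subrM'.
case: (hch _ _ _ hd) => [hc|[hc ny]]; have [_ BS _] := hc.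
  have Sy : S y by apply: BS; exact: ring2_l.
  have Sx : S x by apply: BS; exact: ring2_r.
  have [P [g [hL [e1 e2 e3] ug hloc]]] := g1.1.
  (* Away from E the general estimate is used with h = 1. *)
  set s0 := Phi * J (twist p l m (vv Q) (nn Q) (dK t)) * 1 ^+ (p * r).
  have s00 : s0 != 0 by rewrite /s0 expr1n mulr1 mulf_neq0 // !fmorph_eq0.
  have hw : forall w, w \in cover_sections -> S (w * s0).
    apply: (sections_members lS CQ dS ht dt0); rewrite ?expr1n ?mulr1 //; first exact: subr1.
    by rewrite eth; apply: (subrD' hS) => //; exact: subrX'.
  have g0 : J g != 0 by rewrite !fmorph_eq0; case: ug => h _ _; apply: contraNneq h => ->; rewrite mul0r.
  have mem w : w \in [:: 1; yP P; xP P] -> J g * w / Phi \in cover_sections.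
    by move=> h; apply/cover_sectionsP; left; exists (P, g) => //; apply/mapP; exists w.
  set x0 := J g * 1 / Phi.
  have hx0 : x0 \in cover_sections by apply: mem; rewrite inE eqxx.
  have ux0 : unit_in S (x0 * s0).
    rewrite /x0 /s0 section_scale // mulr1 expr1n mulr1 -JM; case: ug => h1 h2 h3.
    by split; [rewrite !fmorph_eq0|exact: SJ|rewrite -JV; exact: SJ].
  exists s0, x0; split; first by split=> //; rewrite mulf_neq0 ?invr_eq0 // mulr1.
  split; last first.
    move=> dS'; rewrite hKX //.
    rewrite (order_chart0 hC hp theta_def hl l1 s_def hz unit_ratio hdK dKf0 c_neq0 w0_neq0 dS' lS CQ dS hd ht dt0 hvt hc).
    rewrite -ordX //.
      by congr (ord S _); rewrite /s0 -(order_twist (n := 0) nu0 v0 dt0 (or_intror erefl)) expr0 mulr1.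
    have z0 := z_neq0 l1 hz.
    have xx0 : xi (nn Q) != 0 by rewrite mulf_neq0 // !fmorph_eq0 expf_neq0.
    by apply: mulf_neq0 => //; apply: mulf_neq0; [exact: expf_neq0|rewrite invr_eq0; apply: mulf_neq0; rewrite !fmorph_eq0].
  have AS := ratio _ _ s00 ux0 hw; set A := chart _ _ _ in AS *.
  have hA : subr A by exact: chart_subr.
  have [[lR AR _] [RS _]] := centerP hA lS AS.
  have sec w : w \in [:: 1; yP P; xP P] -> A w.
    by move=> /mem h; have := @chart_mem _ kF [set` cover_sections] x0 _ h; rewrite section_ratio1.
  apply: (locz_by_center hA AS hc); apply: (ring2_min (local_subr lR)).
  - apply: (fraction_mem (P := P) (g := g) (L := L1)) => //; first exact: chart_k0.
    move=> g' hg'; have h : J g' * 1 / Phi \in cover_sections.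
      by apply/cover_sectionsP; left; exists (P, g') => //; rewrite inE eqxx.
    have := @chart_mem _ kF [set` cover_sections] x0 _ h; rewrite /x0 section_ratio2 ?oner_neq0 // JM JV; exact: id.
  - by have := AR _ (sec (yP P) _); rewrite /yP e1 e2; apply; rewrite !inE eqxx orbT.
  - by have := AR _ (sec (xP P) _); rewrite /xP e3; apply; rewrite !inE eqxx !orbT.
(* Near E the generator is the section with theta^r, because v^p theta h^p = 1 + beta h^p is a unit
   there. *)
set h := y^-1.
have Sh : S h by apply: BS; exact: ring2_l.
have Sx : S (h ^+ b * x) by rewrite exprVn; apply: BS; exact: ring2_r.
have h0 : h != 0 by rewrite invr_eq0.
set ep := 1 + J (bt (vv Q) (aa Q)) * h ^+ p.
have uep : unit_in S ep by apply: one_add_unit => //; rewrite invrK.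
have eep : J (vv Q) ^+ p * th * h ^+ p = ep.
  by rewrite eth mulrDl -exprMn divff // expr1n.
have [P [g [hL [e1 e2 e3] ug hloc]]] := g2.1.
set s0 := Phi * J (twist p l m (vv Q) (nn Q) (dK t)) * h ^+ (p * r).
have s00 : s0 != 0 by rewrite /s0 mulf_neq0 ?expf_neq0 // mulf_neq0 // !fmorph_eq0.
have Sep : S ep by case: uep.
have hw : forall w, w \in cover_sections -> S (w * s0).
  apply: (sections_members lS CQ dS ht dt0); rewrite ?eep //; first by rewrite divff //; exact: subr1.
  by rewrite mulrC.
have g0 : J g != 0 by rewrite !fmorph_eq0; case: ug => h' _ _; apply: contraNneq h' => ->; rewrite mul0r.
have th0 : th != 0.
  by apply/eqP => e4; case: uep; rewrite -eep e4 mulr0 mul0r eqxx.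
have mem w : w \in [:: 1; yP P ^+ p.-1; xP P * yP P ^+ (p - b)] ->
    J g * (th ^+ r.-1 * J (vv P) ^- p * w) / Phi \in cover_sections.
  by move=> h'; apply/cover_sectionsP; right; exists (P, g) => //; rewrite inE; apply/orP; right; apply/mapP; exists w.
set x0 := J g * th ^+ r / Phi.
have hx0 : x0 \in cover_sections.
  by apply/cover_sectionsP; right; exists (P, g) => //; rewrite inE eqxx.
have ux0 : unit_in S (x0 * s0).
  rewrite /x0 /s0 (section_scale_theta _ _ _ _ _ _ F0 Jv0) eep; apply: (unitM hS); last exact: unitX.
  have -> : J g * J (twist p l m (vv Q) (nn Q) (dK t)) * J (vv Q) ^- (p * r) =
     J (g * (twist p l m (vv Q) (nn Q) (dK t) * vv Q ^- (p * r))) by rewrite mulrA 2!JM JV JX.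
  case: ug => h1 h2 h3; split.
  - by apply: contraNneq h1 => /eqP; rewrite !fmorph_eq0.
  - exact: (SJ _ h2).
  - by rewrite -JV; exact: (SJ _ h3).
have x00 : x0 != 0 by case: ux0 => h' _ _; apply: contraNneq h' => ->; rewrite mul0r.
exists s0, x0; split; first by split.
split; last first.
  move=> dS'; rewrite hKX //.
  rewrite (order_chart1 hC hp theta_def hl l1 s_def hz unit_ratio hdK dKf0 c_neq0 w0_neq0 dS' lS CQ dS hd ht dt0 hvt hn0 hc ny).
  rewrite -ordX //.
    by congr (ord S _); rewrite /s0 -(order_twist (n := n0) nu0 v0 dt0 (or_introl (esym hpr))).
  have z0 := z_neq0 l1 hz.
  have xx0 : xi (nn Q) != 0 by rewrite mulf_neq0 // !fmorph_eq0 expf_neq0.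
  apply: mulf_neq0 => //; apply: mulf_neq0; first by apply: mulf_neq0; exact: expf_neq0.
  by rewrite invr_eq0; apply: mulf_neq0; rewrite !fmorph_eq0.
have AS := ratio _ _ s00 ux0 hw; set A := chart _ _ _ in AS *.
have hA : subr A by exact: chart_subr.
have [[lR AR _] [RS Rinv]] := centerP hA lS AS; have sR := local_subr lR.
have eyP : yP P = y by rewrite /yP e1 e2.
have exP : xP P = x by rewrite /xP e3.
have sec w : w \in [:: 1; y ^+ p.-1; x * y ^+ (p - b)] -> center A S (w / y ^+ p / ep).
  rewrite -exP -eyP => /mem h'; apply: AR; have := @chart_mem _ kF [set` cover_sections] x0 _ h'.
  rewrite (section_ratio3 _ g0 F0 th0 _ (y := y) _ r0 (ep := ep)) ?e1 ?eyP //.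
have RJ : J @` Q `<=` center A S.
  apply: (fraction_mem (P := P) (g := g) (L := L2)) => //; first exact: chart_k0.
  move=> g' hg'; have h' : J g' * th ^+ r / Phi \in cover_sections.
    by apply/cover_sectionsP; right; exists (P, g') => //; rewrite inE eqxx.
  have := @chart_mem _ kF [set` cover_sections] x0 _ h'; rewrite /x0 (section_ratio2 _ g0 F0 (expf_neq0 r th0)) JM JV; exact: id.
(* The ratio belonging to w = 1 is h^p / ep, and 1 / ep = 1 - beta h^p / ep; so first the inverse of
   ep and then ep lies in the center. *)
have Rep : center A S ep.
  have R1 : center A S ep^-1.
    have ep0 : ep != 0 by case: uep.
    rewrite (one_sub_inv ep0 (erefl _)); apply: (subrB' sR); first exact: subr1.
    apply: (subrM' sR); first by apply: RJ; exists (bt (vv Q) (aa Q)) => //; exact: (bt_mem hC hp CQ hd).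
    by have := sec 1; rewrite inE eqxx div1r -exprVn => /(_ isT).
  by rewrite -[ep]invrK; apply: Rinv => //; rewrite invrK.
(* Multiplying by ep, the ratios for y^(p-1) and x' y^(p-b) become y^(p-1) / y^p = h and x' y^(p-b)
   / y^p = h^b x', the two generators of the chart. *)
apply: (locz_by_center hA AS hc); apply: (ring2_min sR) => //.
  have := subrM' sR (sec (y ^+ p.-1) _) Rep; rewrite !inE eqxx orbT => /(_ isT).
  rewrite divfK; last by case: uep.
  by rewrite -{2}(prednK p0) exprSr invfM mulrA mulfV ?mul1r // expf_neq0.
have := subrM' sR (sec (x * y ^+ (p - b)) _) Rep; rewrite !inE eqxx !orbT => /(_ isT).
rewrite divfK; last by case: uep.
have [_ bp] := bpos; have -> : y ^+ p = y ^+ b * y ^+ (p - b) by rewrite -exprD subnKC.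
by rewrite -mulf_div mulfV ?mulr1 ?expf_neq0 // mulrC.
Qed.

Lemma cover_very_ample : very_ample kF Xs (fun W => m%:Z * KX W).
Proof.
apply: (@very_ample_criterion _ _ _ _ cover_sections).
- exact: (cover_generic hC hp data_exists theta_def hl l1 s_def hz unit_ratio).
- move=> V hV kV; apply: (cover_proper hC hp data_exists theta_def hl l1 s_def hz unit_ratio hV).
  by move=> c'; apply: kV; exists c'.
- move=> S XS; have [[]] := cover_charts hC hp data_exists XS => hS hS' _; split=> //.
  by have [s0 [x0 [[_ h1 h2 _ _] [h3 _]]]] := local_generator XS; exists x0.
(* A section that divides all others at [W] divides the local generator, so it is a generator
   too. *)
move=> W x [XW dW] hx x0 hall; have [s0 [x1 [[s00 h1 h2 u hw] [_ h4]]]] := local_generator XW.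
have hW := dvr_subr dW; rewrite (h4 dW).
have : unit_in W (x * s0).
  split; [by rewrite mulf_neq0|exact: hw|].
  have -> : (x * s0)^-1 = (x1 / x) * (x1 * s0)^-1 by rewrite !invfM mulrACA divff ?mul1r.
  by apply: (subrM' hW); [exact: hall|case: u].
by move/(ord_unit _ dW) => []; rewrite ordM.
Qed.
End CoverSections.

Section BaseDerivation.
Variables (k : closedFieldType) (K : fieldType) (iota : {rmorphism k -> K}).
Variable C : set (set K).
Hypothesis hC : smooth_projective_curve (range iota) C.
Notation k0 := (range iota).

(* If df0 = 0 then its order is the junk value 0 everywhere, so that pD <= 0. *)
Lemma pretango_derivation (p g : nat) (D : set K -> int) (f0 : K) : p \in [pchar k] ->
  has_genus k0 C g -> (1 <= g)%N -> ample k0 C D ->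
  div_form_ge k0 C f0 (fun Q => p%:Z * D Q) -> exists dK : K -> K, jder idfun k0 dK /\ dK f0 = 1.
Proof.
move=> hp hg hg1 hDa hdf0; have [d [a [hd da]]] := exists_der hC hg hg1.
have [d0|d0] := eqVneq (d f0) 0.
  exfalso; apply: (no_negative_section hC hp hDa (oner_neq0 K)) => Q [CQ dQ].
  rewrite ord_one //; have [t ut] := dQ.
  have dt0 : d t != 0 by apply: contraNneq da => e0; apply/eqP; exact: (der_zero hC hd CQ ut e0).
  by have := hdf0 Q (conj CQ dQ); rewrite (ord_dform hC f0 hd dt0 CQ ut) d0 mul0r ord_zero.
exists (fun x => d x / d f0); split; last by rewrite divff.
case: hd => h1 h2 h3; split=> [x y|x y|x kx].
- by rewrite h1 mulrDl.
- by rewrite h2 mulrDl -!mulrA.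
- by rewrite h3 // mul0r.
Qed.
End BaseDerivation.

Theorem proposition10
  (k : closedFieldType) (p : nat) (hp : p \in [pchar k])
  (* the curve C, with function field K *)
  (K : fieldType) (iota : {rmorphism k -> K}) (C : set (set K))
  (hC : smooth_projective_curve (range iota) C)
  (g : nat) (hg : has_genus (range iota) C g) (hg2 : (2 <= g)%N)
  (* the pre-Tango structure L = O_C(D) *)
  (D : set K -> int) (hD : is_divisor C D) (hDample : ample (range iota) C D)
  (f0 : K) (hf0 : ~ exists a : K, f0 = a ^+ p)
  (hdf0 : div_form_ge (range iota) C f0 (fun Q => p%:Z * D Q))
  (* the sheaf N = O_C(G), with L = N^e *)
  (e : nat) (he : (2 <= e)%N) (hep : coprime e p) (heD : (e%:Z %| deg C D)%Z)
  (G : set K -> int) (hG : is_divisor C G) (hGample : ample (range iota) C G)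
  (hGD : lin_equiv C (fun Q => e%:Z * G Q) D)
  (l : nat) (hl : (2 <= l)%N) (hlp : (l %| p.+1)%N) (hle : (l %| e)%N)
  (* the splitting of F^*E *)
  (theta : ruled_field K)
  (htheta : frob_splitting p C (raynaud_E p C D f0) (OD C D) theta)
  (* the section of M^-l defining E + C'' *)
  (s : ruled_field K)
  (hs : branch_section l
          (raynaud_P C (raynaud_E p C D f0))
          (raynaud_M p l C (raynaud_E p C D f0) (expS (OD C G) (e %/ l)))
          (ideal_E C (raynaud_E p C D f0))
          (ideal_C'' p C (raynaud_E p C D f0) (OD C D) theta) s)
  (* the function field F of the cyclic cover X *)
  (F : fieldType) (kappa : {rmorphism ruled_field K -> F}) (z : F)
  (hz : radical_extension kappa l s z)
  (X : set (set F))
  (hX : X = cyclic_cover kappa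
              (raynaud_P C (raynaud_E p C D f0))
              (raynaud_M p l C (raynaud_E p C D f0) (expS (OD C G) (e %/ l))) z)
  (KX : set F -> int)
  (hKX : canonical_divisor_surface (range (fun c => kappa (ratC (iota c)))) X KX)
  (hpl : (p = 3%N /\ l = 4%N) \/ (5 <= p)%N) :
  ample (range (fun c => kappa (ratC (iota c)))) X KX.

Proof.
have l0 : (0 < l)%N := ltnW hl; have e0 : (0 < e)%N := ltnW he.
have [dK [hdK dKf0]] := pretango_derivation hC hp hg (ltnW hg2) hDample hdf0.
have data Q : C Q -> exists v a nu, local_data p D G f0 e l Q v a nu.
  exact: (exists_data hC hp G e l hdK dKf0 hdf0).
have theta_def := theta_eq hC hp data hDample htheta.
(* The divisor of [h] is eG - D; its inverse is the function called [hh] before. *)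
have [h h0 hh] := hGD.
have hi0 : h^-1 != 0 by rewrite invr_eq0.
have ord_hh Q : prime_divisor C Q -> ord Q h^-1 = D Q - e%:Z * G Q.
  by move=> pQ; rewrite ordV; [rewrite hh // opprD addrA subrr add0r|case: pQ].
have [c0 s_def] := branch_formula hC hp data theta_def hlp hle hs hi0 ord_hh.
have unit_ratio Q v a nu : C Q -> local_data p D G f0 e l Q v a nu -> unit_in Q (h^-1 * v / nu ^+ l).
  by move=> CQ; exact: (nu_over_v hC hle hi0 ord_hh CQ).
have [w [Ow w_neq0 KXw]] := hKX.
(* Rational 2-forms are multiples of df0 and dx wedged, so the given canonical divisor is that of c
   times this form. *)
have [c ew] := Omega2_scalar hC hp theta_def hlp hl s_def hz hdK dKf0 Ow.
have c_neq0 : c != 0 by apply: contraNneq w_neq0 => e1; rewrite ew e1 scale0r.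
have w0_neq0 : (wedge ((kappa \o @ratC K) f0) (kappa (ratX K)) :
    der (range (fun c => kappa (ratC (iota c)))) -> der (range (fun c => kappa (ratC (iota c)))) -> F^o) != 0.
  by apply: contraNneq w_neq0 => e1; rewrite ew e1 scaler0.
set b := (p.+1 %/ l)%N.
(* Since b l = p + 1, b (l - 1) = p + 1 - b. For (p, l) = (3, 4) this is 3; for p >= 5 it is at
   least (p + 1)/2 >= 3, as b <= (p + 1)/2. Hence n >= 1. *)
have [n [hn n0]] : exists n, (b * l.-1)%N = n.+2 /\ (0 < n)%N.
  have bl1 : (b * l)%N = p.+1 by rewrite divnK.
  have b3 : (3 <= b * l.-1)%N.
    have bE : (b * l = b * l.-1 + b)%N by rewrite -{1}(prednK l0) mulnS addnC.
    have h2 : (b * 2 <= b * l)%N by rewrite leq_mul2l hl orbT.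
    case: hpl => [[ep el]|p5]; first by rewrite /b ep el.
    by clear -bl1 bE h2 p5; lia.
  by exists (b * l.-1 - 2)%N; clear -b3; split; lia.
have [vv [aa [nn [m [r [L1 [L2 [[vv0 hdat] m0 [pr r0] bpr hgen]]]]]]]] :=
  curve_sections hC hp hdK dKf0 hdf0 hD hG hGample e0 hle l0 hi0 ord_hh b n0.
exists m => //; rewrite hX.
apply: (cover_very_ample hC hp data theta_def hlp hl s_def hz unit_ratio hdK dKf0 c_neq0 w0_neq0 vv0 hdat pr r0 bpr hn hgen).
  (* The parameter is f0 at the generic point and a uniformizer t at a closed point; there v^p /
     [dK t] is regular precisely because (df0) >= pD. *)
  move=> Q CQ; have [->|dQ] := C_cases hC CQ.
    by exists f0; split; [left|rewrite dKf0 oner_neq0|].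
  have [t ut] := dQ; exists t; have [eo dt0] := dform_order hC hdK dKf0 CQ ut.
  split=> //; first by right.
  have [v0 _ /(_ dQ) [ov _ _]] := hdat Q CQ.
  apply/(ord_ge0 dQ); first by rewrite mulf_neq0 ?invr_eq0 // expf_neq0.
  rewrite ordM ?invr_eq0 ?expf_neq0 // ordV // ordX // ov -eo mulrN addrC subr_ge0.
  exact: (hdf0 Q (conj CQ dQ)).
by move=> W pW; rewrite -ew; apply: KXw; rewrite hX.
Qed.
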